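(* There is a universal constant $c$ such that the following holds for every instance of the latent Dirichlet allocation model described in the context. Fix $\delta\in(0,1)$, let $p_{\min}=\min_i\frac{\alpha_i}{\alpha_0}$, and let $\sigma_k(O)$ denote the smallest (non-zero) singular value of $O$. Suppose that we obtain $$N\ \ge\ \left(\frac{(\alpha_0+1)\bigl(6+6\sqrt{\ln(3/\delta)}\bigr)}{p_{\min}\,\sigma_k(O)^2}\right)^2$$ independent samples of $(x_1,x_2,x_3)$ in the LDA model. With probability greater than $1-\delta$ (over the samples) the following holds: for $\theta\in\mathbb{R}^k$ sampled uniformly over the unit sphere $\mathcal{S}^{k-1}$ (independently of the samples), with probability greater than $3/4$ (over $\theta$), the procedure ''empirical ECA for LDA'' returns a set $\{\hat O_1,\dots,\hat O_k\}$ such that there exists a permutation $\sigma$ of $\{1,\dots,k\}$ so that for all $i\in\{1,\dots,k\}$ $$\|O_i-\hat O_{\sigma(i)}\|_2\ \le\ c\,\frac{(\alpha_0+1)^2k^3}{p_{\min}^2\,\sigma_k(O)^3}\left(\frac{1+\sqrt{\ln(1/\delta)}}{\sqrt N}\right),$$ where $O_i$ is the $i$-th column of $O$.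
   Context: LDA model. $\alpha=(\alpha_1,\dots,\alpha_k)$ has strictly positive entries and $\alpha_0:=\alpha_1+\dots+\alpha_k$. The hidden vector $h$ takes values in the probability simplex $\Delta^{k-1}$ and has the Dirichlet distribution with parameter $\alpha$. $O\in\mathbb{R}^{d\times k}$, $d\ge k$, has full rank $k$ and each of its columns is a probability vector on $d$ outcomes. Given $h$, the observations $x_1,x_2,x_3$ are conditionally i.i.d.: for each $v$, an index $i\in\{1,\dots,k\}$ is drawn from the distribution $h$, then an outcome $j\in\{1,\dots,d\}$ is drawn from the $i$-th column of $O$, and $x_v=e_j\in\mathbb{R}^d$ (the $j$-th standard basis vector). Empirical moments. From $N$ independent copies of the triple $(x_1,x_2,x_3)$ let $\hat\mu$, $\hat{\mathbb{E}}[x_1x_2^\top]$, $\hat{\mathbb{E}}[x_1x_2^\top\langle\eta,x_3\rangle]$ be the empirical averages of $x_1$, $x_1x_2^\top$, $x_1x_2^\top\langle\eta,x_3\rangle$ (for $\eta\in\mathbb{R}^d$), and set $$\widehat{\mathrm{Pairs}}_{\alpha_0}:=\hat{\mathbb{E}}[x_1x_2^\top]-\frac{\alpha_0}{\alpha_0+1}\hat\mu\hat\mu^\top,$$ $$\widehat{\mathrm{Triples}}_{\alpha_0}(\eta):=\hat{\mathbb{E}}[x_1x_2^\top\langle\eta,x_3\rangle]-\frac{\alpha_0}{\alpha_0+2}\Bigl(\hat{\mathbb{E}}[x_1x_2^\top]\eta\hat\mu^\top+\hat\mu\eta^\top\hat{\mathbb{E}}[x_1x_2^\top]+\langle\eta,\hat\mu\rangle\hat{\mathbb{E}}[x_1x_2^\top]\Bigr)+\frac{2\alpha_0^2}{(\alpha_0+2)(\alpha_0+1)}\langle\eta,\hat\mu\rangle\hat\mu\hat\mu^\top.$$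 Pseudo-inverse. For a matrix $A$ with linearly independent columns, $A^+=(A^\top A)^{-1}A^\top$. Procedure ''empirical ECA for LDA'' (input $k$, $N$, $\theta\in\mathbb{R}^k$, $\alpha_0$): (i) compute $\widehat{\mathrm{Pairs}}_{\alpha_0}$ and $\widehat{\mathrm{Triples}}_{\alpha_0}(\cdot)$ from $N$ samples; (ii) let $\hat W=A\Sigma^{-1/2}\in\mathbb{R}^{d\times k}$, where $A\in\mathbb{R}^{d\times k}$ is the matrix of orthonormal left singular vectors of $\widehat{\mathrm{Pairs}}_{\alpha_0}$ corresponding to its $k$ largest singular values and $\Sigma\in\mathbb{R}^{k\times k}$ is the diagonal matrix of these singular values; (iii) let $\{\hat v_1,\dots,\hat v_k\}$ be the (orthonormal) left singular vectors of $\hat W^\top\widehat{\mathrm{Triples}}_{\alpha_0}(\hat W\theta)\hat W$; (iv) return $\{\hat O_1,\dots,\hat O_k\}$ where $$\hat Z_i=\frac{2}{(\alpha_0+2)(\hat W\hat v_i)^\top\widehat{\mathrm{Triples}}_{\alpha_0}(\hat W\hat v_i)\hat W\hat v_i},\qquad \hat O_i=\frac1{\hat Z_i}(\hat W^+)^\top\hat v_i.$$ *)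

(* Defs.v *)
From HB Require Import structures.
From mathcomp Require Export all_boot all_order all_algebra all_fingroup.
From mathcomp Require Export all_classical all_reals all_analysis.
Export Order.TTheory GRing.Theory Num.Theory.
Export numFieldNormedType.Exports.

Set Implicit Arguments.
Unset Strict Implicit.
Unset Printing Implicit Defensive.

Local Open Scope classical_set_scope.
Local Open Scope ring_scope.

Section LinearAlgebra.
Context {R : realType}.

(* The Euclidean inner product and norm; the norm `|_| that the library puts
   on matrices is the sup norm. *)
Definition dotv n (u v : 'cV[R]_n) : R := \sum_i u i 0 * v i 0.
Definition norm2 n (u : 'cV[R]_n) : R := Num.sqrt (dotv u u).

(* Thin singular value decomposition M = U diag(s) V^T of a matrix with at
   least as many rows as columns; when m = n it is the usual one.  The factors
   need not be unique, hence a predicate. *)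
Definition is_svd m n (M : 'M[R]_(m, n))
    (U : 'M[R]_(m, n)) (s : 'rV[R]_n) (V : 'M[R]_n) : Prop :=
  [/\ U^T *m U = 1%:M,
      V^T *m V = 1%:M,
      forall i, 0 <= s 0 i,
      forall i j : 'I_n, (i <= j)%N -> s 0 j <= s 0 i
    & M = U *m diag_mx s *m V^T].

(* The smallest non-zero singular value, the singular values of M being the
   square roots of the eigenvalues of M^T M. *)
Definition sigma_min m n (M : 'M[R]_(m, n)) : R :=
  inf [set s : R | 0 < s /\ eigenvalue (M^T *m M) (s ^+ 2)].

(* A^+, for A with linearly independent columns. *)
Definition pinv m n (A : 'M[R]_(m, n)) : 'M[R]_(n, m) :=
  invmx (A^T *m A) *m A^T.

(* Random vectors take values in k.-tuple R, which carries the Borel (product)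
   sigma-algebra. *)
Definition col_of_tuple n (t : n.-tuple R) : 'cV[R]_n := \col_i tnth t i.
Definition tuple_of_col n (u : 'cV[R]_n) : n.-tuple R := [tuple u i 0 | i < n].

End LinearAlgebra.

Section Probability.
Context {R : realType}.

(* S contains an event of probability greater than p; for measurable S this
   says P S > p, and it makes sense without checking that S is measurable. *)
Definition with_prob_gt d (T : measurableType d) (P : probability T R)
    (p : R) (S : set T) : Prop :=
  exists E : set T, [/\ measurable E, (p%:E < P E)%E & E `<=` S].

(* The uniform distribution on the unit sphere of R^k: the rotation invariant
   Borel probability measure carried by the sphere. *)
Definition uniform_sphere k (Q : probability (k.-tuple R) R) : Prop :=
  Q [set t | norm2 (col_of_tuple t) = 1] = 1%E /\
  forall (M : 'M[R]_k) (B : set (k.-tuple R)),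
    M^T *m M = 1%:M -> measurable B ->
    Q [set t | B (tuple_of_col (M *m col_of_tuple t))] = Q B.

(* Lebesgue integral over R^n of a nonnegative function, as an iterated
   integral (Tonelli). *)
Fixpoint lebesgue_iint n : (n.-tuple R -> \bar R) -> \bar R :=
  if n is n'.+1 then fun f =>
    (\int[lebesgue_measure]_x lebesgue_iint (fun t => f [tuple of x :: t]))%E
  else fun f => f [tuple].

Definition gamma_fun (a : R) : R :=
  \int[lebesgue_measure]_(t in `]0, +oo[) (t `^ (a - 1) * expR (- t)).

(* (t_1, ..., t_{k-1}) |-> (t_1, ..., t_{k-1}, 1 - sum_i t_i), the coordinates
   in which the simplex carries Lebesgue measure: the last index is out of
   bounds for t, so that nth returns its default. *)
Definition simplex_pt k (t : k.-1.-tuple R) : k.-tuple R :=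
  [tuple nth (1 - \sum_(y <- t) y) t i | i < k].

(* The density vanishes outside the open simplex (its boundary is negligible). *)
Definition dirichlet_pdf k (alpha : 'I_k -> R) (p : k.-tuple R) : R :=
  if [forall i, 0 < tnth p i] then
    gamma_fun (\sum_i alpha i) / (\prod_i gamma_fun (alpha i))
      * \prod_i tnth p i `^ (alpha i - 1)
  else 0.

(* h has the Dirichlet distribution; f = \1_B gives the probability that h
   lies in B. *)
Definition dirichlet_distributed d (T : measurableType d)
    (P : probability T R) k (alpha : 'I_k -> R) (h : T -> k.-tuple R) : Prop :=
  forall f : k.-tuple R -> R,
    measurable_fun setT f -> (forall p, 0 <= f p) ->
    (\int[P]_w (f (h w))%:E)%E =
    lebesgue_iint (fun t : k.-1.-tuple R =>
      (f (simplex_pt t) * dirichlet_pdf alpha (simplex_pt t))%:E).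

End Probability.

Section LDA.
Context {R : realType}.

Definition emission_matrix d k (O : 'M[R]_(d, k)) : Prop :=
  [/\ forall j i, 0 <= O j i, forall i, \sum_j O j i = 1 & \rank O = k].

(* One draw of the model, with all its variables: h is the topic mixture, z v
   the index drawn from h and x v the outcome drawn from column z v of O, for
   the observations v = 0, 1, 2.  The last clause is their law given h. *)
Definition lda_draw dd (T : measurableType dd) (P : probability T R)
    d k (alpha : 'I_k -> R) (O : 'M[R]_(d, k)) (h : T -> k.-tuple R)
    (z : 'I_3 -> T -> 'I_k) (x : 'I_3 -> T -> 'I_d) : Prop :=
  [/\ measurable_fun setT h,
      forall v i, measurable [set w | z v w = i],
      forall v j, measurable [set w | x v w = j],
      dirichlet_distributed P alpha h
    & forall (B : set (k.-tuple R)) (i : 'I_3 -> 'I_k) (j : 'I_3 -> 'I_d),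
        measurable B ->
        P [set w | B (h w) /\ forall v, z v w = i v /\ x v w = j v] =
        (\int[P]_(w in h @^-1` B)
           (\prod_v (tnth (h w) (i v) * O (j v) (i v)))%:E)%E].

Definition independent_triples dd (T : measurableType dd)
    (P : probability T R) d N (x : 'I_N -> 'I_3 -> T -> 'I_d) : Prop :=
  forall B : 'I_N -> set ('I_3 -> 'I_d),
    P [set w | forall n, B n (x n ^~ w)] =
    (\prod_(n < N) P [set w | B n (x n ^~ w)])%E.

(* A sample is y : 'I_N -> 'I_3 -> 'cV_d, the vector x_v of the n-th triple
   being y n (v - 1). *)
Definition onehot d N (x : 'I_N -> 'I_3 -> 'I_d) :
    'I_N -> 'I_3 -> 'cV[R]_d :=
  fun n v => delta_mx (x n v) 0.

Section Moments.
Context {d N : nat}.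
Implicit Types (y : 'I_N -> 'I_3 -> 'cV[R]_d) (eta : 'cV[R]_d).

Definition emp_mean y : 'cV[R]_d :=
  N%:R^-1 *: \sum_n y n (inord 0).

Definition emp_second y : 'M[R]_d :=
  N%:R^-1 *: \sum_n y n (inord 0) *m (y n (inord 1))^T.

Definition emp_third y eta : 'M[R]_d :=
  N%:R^-1 *: \sum_n dotv eta (y n (inord 2)) *:
               (y n (inord 0) *m (y n (inord 1))^T).

Definition pairs_hat (a0 : R) y : 'M[R]_d :=
  emp_second y - (a0 / (a0 + 1)) *: (emp_mean y *m (emp_mean y)^T).

Definition triples_hat (a0 : R) y eta : 'M[R]_d :=
  emp_third y eta
  - (a0 / (a0 + 2)) *:
      (emp_second y *m eta *m (emp_mean y)^T
       + emp_mean y *m eta^T *m emp_second y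
       + dotv eta (emp_mean y) *: emp_second y)
  + (2 * a0 ^+ 2 / ((a0 + 2) * (a0 + 1)) * dotv eta (emp_mean y)) *:
      (emp_mean y *m (emp_mean y)^T).

End Moments.

(* W = A Sigma^(-1/2), from the first k left singular vectors and singular
   values of a decomposition (U, s, _). *)
Definition whitening d k (lekd : (k <= d)%N) (U : 'M[R]_d) (s : 'rV[R]_d) :
    'M[R]_(d, k) :=
  colsub (widen_ord lekd) U *m
  diag_mx (\row_(i < k) (Num.sqrt (s 0 (widen_ord lekd i)))^-1).

(* Z and the returned vector, for a singular vector v.  Z is only used through
   its inverse (a0 + 2) (Wv)^T T(Wv) Wv / 2, which is also the value of Z^-1
   here when (Wv)^T T(Wv) Wv = 0, since 0^-1 = 0. *)
Definition Z_hat d k (a0 : R) (T : 'cV[R]_d -> 'M[R]_d) (W : 'M[R]_(d, k))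
    (v : 'cV[R]_k) : R :=
  2 / ((a0 + 2) * dotv (W *m v) (T (W *m v) *m (W *m v))).

Definition O_hat d k (a0 : R) (T : 'cV[R]_d -> 'M[R]_d) (W : 'M[R]_(d, k))
    (v : 'cV[R]_k) : 'cV[R]_d :=
  (Z_hat a0 T W v)^-1 *: ((pinv W)^T *m v).

End LDA.

(* Main.v *)
From HB Require Import structures.
Require Import Defs.
From mathcomp Require Import measurable_realfun ring lra.

(** With p_i = alpha_i / a0, the third moments of the Dirichlet law give
  Pairs = B B^T and Triples(h) = B diag(gam_i <b_i, h>) B^T, where the columns
  of B are b_i = sqrt (p_i / (a0 + 1)) O_i and
  gam_i = 2 sqrt (a0 + 1) / ((a0 + 2) sqrt p_i).  The empirical moments are
  polynomial in the empirical frequencies of x_1, (x_1, x_2) and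
  (x_1, x_2, x_3); by a bounded differences argument each of these is within
  f = (1 + 3/2 sqrt (ln (3 / delta))) / sqrt N of its mean in Euclidean norm,
  with probability greater than 1 - delta for the three together.

  On this event, M = W^T B is nearly orthogonal, and W^T Triples(W theta) W is
  close to M diag(lam) M^T with lam_i = gam_i <M e_i, theta>.  Its singular
  vectors are determined as soon as the numbers |lam_i| are separated, that is,
  as soon as theta is not nearly orthogonal to one of the vectors
  gam_i M e_i +- gam_j M e_j; as each strip about a hyperplane has small
  measure, this holds with probability at least 4/5.  A returned vector is
  then a multiple of b_i up to the error, with the right factor.  If the errors
  are too large for this to apply, the bound to be proved is larger than a
  trivial bound on the returned vectors. *)
Set Implicit Arguments.
Unset Strict Implicit.
Unset Printing Implicit Defensive.
Local Open Scope ring_scope.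

(** * Euclidean and Frobenius norms *)

(** The sample size only keeps the [k]-th singular value of the empirical Pairs above a quarter of
    [p_min sigma_k(O)^2 / (a0 + 1)], so that whitening is under control. It does not make the errors
    small against the gaps between the [|lam_i|], which shrink like [k^-3]. Hence the case
    distinction, and hence a very large constant.

    The empirical matrices need not be symmetric, since [x_1] and [x_2] play different roles in a
    finite sample. Left and right singular vectors are therefore treated as a pair, and what must be
    separated is the absolute values [|lam_i|]; this is why both signs occur in the vectors to which
    [theta] must not be orthogonal.

    The power [k^3] is the price of the union bound: there are [2 k^2] such vectors, a strip of
    relative half-width [t] has measure at most [2 k t], and [t = 1 / (20 k^3)] brings the total
    down to [1/5].

    A singular vector is determined up to sign at best. The returned vector is a cubic form of it
    times a linear image of it, of total degree four, so the sign cancels. *)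

Section L2.
Context {R : rcfType} {J : finType}.
Implicit Types u v : J -> R.

Definition l2 u : R := Num.sqrt (\sum_j u j ^+ 2).

Lemma l2_ge0 u : 0 <= l2 u.
Proof. exact: sqrtr_ge0. Qed.

Lemma l2_sqr u : l2 u ^+ 2 = \sum_j u j ^+ 2.
Proof. by rewrite sqr_sqrtr ?sumr_ge0// => i _; rewrite sqr_ge0. Qed.

Lemma eq_l2 u v : u =1 v -> l2 u = l2 v.
Proof. by move=> uv; congr Num.sqrt; apply: eq_bigr => j _; rewrite uv. Qed.

Lemma l2_eq0 u : l2 u = 0 -> forall j, u j = 0.
Proof.
move=> u0 j; apply/eqP; rewrite -sqrf_eq0.
have /eqP := l2_sqr u; rewrite u0 expr0n/= eq_sym psumr_eq0; last first.
  by move=> i _; rewrite sqr_ge0.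
by move=> /allP /(_ j (mem_index_enum _)).
Qed.

Lemma l2Z a u : l2 (fun j => a * u j) = `|a| * l2 u.
Proof.
rewrite /l2 -sqrtr_sqr -sqrtrM ?sqr_ge0// mulr_sumr.
by congr Num.sqrt; apply: eq_bigr => j _; rewrite exprMn.
Qed.

Lemma le_coord_l2 u j : `|u j| <= l2 u.
Proof.
rewrite -sqrtr_sqr ler_wsqrtr// (bigD1 j)//= lerDl sumr_ge0// => i _.
exact: sqr_ge0.
Qed.

Lemma cauchy_schwarz u v : \sum_j u j * v j <= l2 u * l2 v.
Proof.
have [u0|u0] := eqVneq (l2 u) 0.
  by rewrite u0 mul0r big1// => j _; rewrite l2_eq0// mul0r.
have [v0|v0] := eqVneq (l2 v) 0.
  by rewrite v0 mulr0 big1// => j _; rewrite (@l2_eq0 v)// mulr0.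
have up : 0 < l2 u by rewrite lt_def u0 l2_ge0.
have vp : 0 < l2 v by rewrite lt_def v0 l2_ge0.
have : 0 <= \sum_j (l2 v * u j - l2 u * v j) ^+ 2.
  by rewrite sumr_ge0// => j _; exact: sqr_ge0.
have -> : \sum_j (l2 v * u j - l2 u * v j) ^+ 2 =
    2 * l2 u * l2 v * (l2 u * l2 v - \sum_j u j * v j).
  under eq_bigr do rewrite sqrrB !exprMn.
  rewrite big_split/= sumrB -!mulr_sumr -!l2_sqr.
  have -> : \sum_i l2 v * u i * (l2 u * v i) *+ 2 =
      2 * l2 u * l2 v * \sum_j u j * v j.
    by rewrite mulr_sumr; apply: eq_bigr => j _; ring.
  ring.
by rewrite pmulr_rge0 ?subr_ge0// !mulr_gt0.
Qed.

Lemma cauchy_schwarz_norm u v : `|\sum_j u j * v j| <= l2 u * l2 v.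
Proof.
rewrite ler_norml cauchy_schwarz andbT lerNl -sumrN.
under eq_bigr do rewrite -mulNr.
apply: le_trans (cauchy_schwarz _ _) _.
have -> : l2 (fun j => - u j) = l2 u by congr Num.sqrt; apply: eq_bigr => j _; rewrite sqrrN.
by [].
Qed.

Lemma l2_triangle u v : l2 (fun j => u j + v j) <= l2 u + l2 v.
Proof.
rewrite -(ler_pXn2r (ltn0Sn 1)) ?nnegrE ?addr_ge0 ?l2_ge0// sqrrD !l2_sqr.
under eq_bigr do rewrite sqrrD.
rewrite !big_split/= lerD2r lerD2l.
by rewrite mulr2n lerD// cauchy_schwarz.
Qed.

Lemma l2_dist u v w : l2 (fun j => u j + w j) - l2 (fun j => v j + w j) <=
  l2 (fun j => u j - v j).
Proof.
rewrite lerBlDr; apply: le_trans (l2_triangle _ _).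
by rewrite (@eq_l2 _ (fun j => u j - v j + (v j + w j)))// => j; ring.
Qed.

End L2.

Section Frobenius.
Context {R : rcfType}.

Definition nF m n (A : 'M[R]_(m, n)) : R := l2 (fun ij => A ij.1 ij.2).
Definition dot n (u v : 'cV[R]_n) : R := \sum_i u i 0 * v i 0.

Lemma nF_ge0 m n (A : 'M[R]_(m, n)) : 0 <= nF A.
Proof. exact: l2_ge0. Qed.
Hint Resolve nF_ge0 : core.

Lemma nF_sqr m n (A : 'M[R]_(m, n)) : nF A ^+ 2 = \sum_i \sum_j A i j ^+ 2.
Proof. by rewrite l2_sqr pair_big. Qed.

Lemma nF_sqrV n (u : 'cV[R]_n) : nF u ^+ 2 = dot u u.
Proof. by rewrite nF_sqr; apply: eq_bigr => i _; rewrite big_ord1 expr2. Qed.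

Lemma nF_cV n (u : 'cV[R]_n) : nF u = Num.sqrt (dot u u).
Proof. by rewrite -nF_sqrV sqrtr_sqr ger0_norm. Qed.

Lemma nF_eq0 m n (A : 'M[R]_(m, n)) : nF A = 0 -> A = 0.
Proof. by move=> /l2_eq0 A0; apply/matrixP => i j; rewrite (A0 (i, j)) mxE. Qed.

Lemma nFD m n (A B : 'M[R]_(m, n)) : nF (A + B) <= nF A + nF B.
Proof.
apply: le_trans (l2_triangle _ _); rewrite le_eqVlt; apply/orP; left.
by apply/eqP/eq_l2 => ij; rewrite mxE.
Qed.

Lemma nFZ m n a (A : 'M[R]_(m, n)) : nF (a *: A) = `|a| * nF A.
Proof. by rewrite -l2Z; apply: eq_l2 => ij; rewrite mxE. Qed.

Lemma nFN m n (A : 'M[R]_(m, n)) : nF (- A) = nF A.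
Proof. by rewrite -scaleN1r nFZ normrN1 mul1r. Qed.

Lemma nFB m n (A B : 'M[R]_(m, n)) : nF (A - B) <= nF A + nF B.
Proof. by rewrite -(nFN B) nFD. Qed.

Lemma nF_delta n (j : 'I_n) : nF (delta_mx j 0 : 'cV_n) = 1.
Proof.
apply/eqP; rewrite -(eqrXn2 (n := 2))// nF_sqrV /dot (bigD1 j)//= big1 ?addr0.
  by rewrite !mxE !eqxx.
by move=> i ij; rewrite mxE (negPf ij) mul0r.
Qed.

Lemma nFT m n (A : 'M[R]_(m, n)) : nF A^T = nF A.
Proof.
apply/eqP; rewrite -(eqrXn2 (n := 2))// !nF_sqr exchange_big/=.
by under eq_bigr do under eq_bigr do rewrite mxE.
Qed.

Lemma nF0 m n : nF (0 : 'M[R]_(m, n)) = 0.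
Proof. by rewrite -(scale0r 0) nFZ normr0 mul0r. Qed.

Lemma dotC n (u v : 'cV[R]_n) : dot u v = dot v u.
Proof. by apply: eq_bigr => i _; rewrite mulrC. Qed.

Lemma dot_mx n (u v : 'cV[R]_n) : u^T *m v = (dot u v)%:M.
Proof. by apply/matrixP => i j; rewrite !ord1 !mxE mulr1n; apply: eq_bigr => l _; rewrite mxE. Qed.

Lemma dot_mxE n (u v : 'cV[R]_n) : dot u v = (u^T *m v) 0 0.
Proof. by rewrite dot_mx mxE mulr1n. Qed.

Lemma dot_mulmxl m n (A : 'M[R]_(m, n)) u v : dot (A *m u) v = dot u (A^T *m v).
Proof. by rewrite !dot_mxE trmx_mul mulmxA. Qed.

Lemma dotDl n (u v w : 'cV[R]_n) : dot (u + v) w = dot u w + dot v w.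
Proof. by rewrite -big_split; apply: eq_bigr => i _; rewrite mxE mulrDl. Qed.

Lemma dotZl n a (u w : 'cV[R]_n) : dot (a *: u) w = a * dot u w.
Proof. by rewrite mulr_sumr; apply: eq_bigr => i _; rewrite mxE mulrA. Qed.

Lemma dotDr n (u v w : 'cV[R]_n) : dot w (u + v) = dot w u + dot w v.
Proof. by rewrite dotC dotDl !(dotC w). Qed.

Lemma dotZr n a (u w : 'cV[R]_n) : dot w (a *: u) = a * dot w u.
Proof. by rewrite dotC dotZl dotC. Qed.

Lemma dotNl n (u w : 'cV[R]_n) : dot (- u) w = - dot u w.
Proof. by rewrite -scaleN1r dotZl mulN1r. Qed.

Lemma dotNr n (u w : 'cV[R]_n) : dot w (- u) = - dot w u.
Proof. by rewrite dotC dotNl dotC. Qed.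

Lemma nF_cVl2 n (u : 'cV[R]_n) : nF u = l2 (fun i => u i 0).
Proof. by rewrite nF_cV; congr Num.sqrt; apply: eq_bigr => i _; rewrite expr2. Qed.

Lemma dot_le n (u v : 'cV[R]_n) : `|dot u v| <= nF u * nF v.
Proof. by rewrite !nF_cVl2 cauchy_schwarz_norm. Qed.

Lemma nF_col m n (A : 'M[R]_(m, n)) : nF A ^+ 2 = \sum_j nF (col j A) ^+ 2.
Proof.
rewrite nF_sqr exchange_big/=; apply: eq_bigr => j _; rewrite nF_sqrV.
by apply: eq_bigr => i _; rewrite mxE expr2.
Qed.

Lemma nF_row m n (A : 'M[R]_(m, n)) : nF A ^+ 2 = \sum_i nF (row i A) ^+ 2.
Proof.
rewrite -nFT nF_col; apply: eq_bigr => i _; congr (_ ^+ 2).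
by rewrite -nFT; congr nF; apply/matrixP => a b; rewrite !mxE.
Qed.

(** The operator norm of [A] is at most [c]. A predicate suffices, as only upper bounds on operator
    norms occur. *)
Definition opb m n (A : 'M[R]_(m, n)) (c : R) : Prop :=
  forall x : 'cV_n, nF (A *m x) <= c * nF x.

Lemma opb_mul m n p (A : 'M[R]_(m, n)) c (B : 'M[R]_(n, p)) :
  0 <= c -> opb A c -> nF (A *m B) <= c * nF B.
Proof.
move=> c0 Ac; rewrite -(ler_pXn2r (ltn0Sn 1)) ?nnegrE ?mulr_ge0//.
rewrite exprMn !nF_col mulr_sumr; apply: ler_sum => j _.
by rewrite colE -mulmxA -colE -exprMn ler_pXn2r ?nnegrE ?mulr_ge0.
Qed.

(** [|A^T x|^2 = <x, A A^T x>], which is at most [|x| c |A^T x|]. *)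
Lemma opb_tr m n (A : 'M[R]_(m, n)) c : 0 <= c -> opb A c -> opb A^T c.
Proof.
move=> c0 Ac x; have [->|x0] := eqVneq (nF (A^T *m x)) 0.
  by rewrite mulr_ge0.
rewrite -(ler_pM2l (x := nF (A^T *m x))); last by rewrite lt_def x0 /=.
rewrite -expr2 nF_sqrV dot_mulmxl trmxK.
apply: le_trans (ler_norm _) _; apply: le_trans (dot_le _ _) _.
apply: le_trans (ler_wpM2l (nF_ge0 x) (Ac _)) _.
by rewrite mulrCA mulrA mulrC.
Qed.

Lemma opb_mulr m n p (A : 'M[R]_(n, p)) c (B : 'M[R]_(m, n)) :
  0 <= c -> opb A c -> nF (B *m A) <= c * nF B.
Proof.
move=> c0 Ac; rewrite -nFT trmx_mul -(nFT B); apply: opb_mul => //.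
exact: opb_tr.
Qed.

Lemma nF_mul m n p (A : 'M[R]_(m, n)) (B : 'M[R]_(n, p)) :
  nF (A *m B) <= nF A * nF B.
Proof.
apply: opb_mul => // x; rewrite -(ler_pXn2r (ltn0Sn 1)) ?nnegrE ?mulr_ge0//.
rewrite exprMn nF_row [nF A ^+ 2]nF_row mulr_suml; apply: ler_sum => i _.
rewrite row_mul -exprMn ler_pXn2r ?nnegrE ?mulr_ge0//.
rewrite nF_cVl2 /l2 big_ord1 sqrtr_sqr mxE.
have := dot_le (row i A)^T x; rewrite nFT; apply: le_trans.
by rewrite le_eqVlt; apply/orP; left; apply/eqP; congr `|_|; apply: eq_bigr => j _; rewrite !mxE.
Qed.

Lemma opb_nF m n (A : 'M[R]_(m, n)) : opb A (nF A).
Proof. by move=> x; exact: nF_mul. Qed.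

Lemma orth_nF m n (A : 'M[R]_(m, n)) (x : 'cV_n) :
  A^T *m A = 1%:M -> nF (A *m x) = nF x.
Proof. by move=> AA; rewrite !nF_cV dot_mulmxl mulmxA AA mul1mx. Qed.

Lemma opb_orth m n (A : 'M[R]_(m, n)) : A^T *m A = 1%:M -> opb A 1.
Proof. by move=> AA x; rewrite mul1r orth_nF. Qed.

Lemma opb_diag n (s : 'rV[R]_n) c : 0 <= c -> (forall i, `|s 0 i| <= c) -> opb (diag_mx s) c.
Proof.
move=> c0 sc x; rewrite -(ler_pXn2r (ltn0Sn 1)) ?nnegrE ?mulr_ge0//.
rewrite exprMn !nF_sqrV mulr_sumr; apply: ler_sum => i _.
rewrite mul_diag_mx mxE -!expr2 exprMn ler_wpM2r ?sqr_ge0// -real_normK ?num_real//.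
by rewrite ler_pXn2r ?nnegrE.
Qed.

(* Both sides equal tr((A A^T)^2) - 2 tr(A A^T) + n. *)
Lemma nF_gram n (A : 'M[R]_n) : nF (A^T *m A - 1%:M) = nF (A *m A^T - 1%:M).
Proof.
have nFtr (B : 'M[R]_n) : nF B ^+ 2 = \tr (B^T *m B).
  by rewrite nF_col; apply: eq_bigr => j _; rewrite nF_sqrV !mxE; apply: eq_bigr => i _; rewrite !mxE.
have trsq (X : 'M[R]_n) : X^T = X ->
    nF (X - 1%:M) ^+ 2 = \tr (X *m X) - \tr X *+ 2 + \tr (1%:M : 'M[R]_n).
  move=> XT; have XT1 : (X - 1%:M)^T = X - 1%:M by rewrite linearB/= trmx1 XT.
  rewrite nFtr XT1 mulmxBl !mulmxBr mulmx1 !mul1mx.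
  by rewrite !linearB/= mulr2n; ring.
apply/eqP; rewrite -(eqrXn2 (n := 2))// !trsq; try by rewrite trmx_mul trmxK.
by rewrite [\tr (A^T *m A)]mxtrace_mulC -!mulmxA (mxtrace_mulC A^T) !mulmxA.
Qed.

End Frobenius.
#[global] Hint Extern 0 (is_true (0 <= nF _)) => (apply: nF_ge0) : core.

(** * Perturbation of the whitening step *)

Section Whitening.
Context {R : rcfType}.

Lemma ex_kernel_vector m n (C : 'M[R]_(m, n)) : (m < n)%N ->
  exists2 y : 'cV_n, y != 0 & C *m y = 0.
Proof.
move=> mn; have : kermx C^T != 0.
  rewrite -mxrank_eq0 mxrank_ker subn_eq0 -ltnNge.
  by rewrite (leq_ltn_trans _ mn)// rank_leq_col.
case/rowV0Pn => v /sub_kermxP vC v0; exists v^T.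
  by rewrite trmx_eq0.
by apply: trmx_inj; rewrite trmx_mul trmxK vC trmx0.
Qed.

(** On the range of [B] the eigenvalues of [B B^T] are those of [B^T B]. Two applications of
    Cauchy-Schwarz, through the intermediate quantity [g = |B^T x|], replace a diagonalisation. *)
Lemma gram_lower_bound d k (B : 'M[R]_(d, k)) sg (y : 'cV_k) : 0 < sg ->
  (forall y : 'cV_k, sg * nF y ^+ 2 <= nF (B *m y) ^+ 2) ->
  sg * nF (B *m y) <= nF (B *m B^T *m (B *m y)).
Proof.
move=> sg0 Bsg; set x := B *m y; rewrite -mulmxA.
have [->|x0] := eqVneq (nF x) 0; first by rewrite mulr0.
have xp : 0 < nF x by rewrite lt_def x0/=.
set g := nF (B^T *m x).
have h1 : nF x ^+ 2 <= nF y * g.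
  by rewrite nF_sqrV {1}/x dot_mulmxl (le_trans (ler_norm _))// dot_le.
have h2 : g ^+ 2 <= nF x * nF (B *m (B^T *m x)).
  by rewrite /g nF_sqrV dot_mulmxl trmxK (le_trans (ler_norm _))// dot_le.
rewrite -(ler_pM2l xp); apply: le_trans h2.
have h3 : sg * (nF x ^+ 2) ^+ 2 <= nF x ^+ 2 * g ^+ 2.
  apply: (@le_trans _ _ (sg * (nF y * g) ^+ 2)).
    by rewrite (ler_wpM2l (ltW sg0))// ler_pXn2r// ?nnegrE ?sqr_ge0 ?mulr_ge0 ?nF_ge0.
  by rewrite exprMn mulrA ler_wpM2r ?sqr_ge0// Bsg.
rewrite -(ler_pM2l (exprn_gt0 2 xp)); apply: le_trans h3.
by rewrite le_eqVlt; apply/orP; left; apply/eqP; ring.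
Qed.

Section Svd.
Variables (d k : nat) (lekd : (k <= d)%N).
Variables (Ph U V : 'M[R]_d) (s : 'rV[R]_d).
Hypotheses (UU : U^T *m U = 1%:M) (VV : V^T *m V = 1%:M).
Hypotheses (s_ge0 : forall i, 0 <= s 0 i)
  (s_sort : forall i j : 'I_d, (i <= j)%N -> s 0 j <= s 0 i).
Hypothesis (PhE : Ph = U *m diag_mx s *m V^T).
Variables (B : 'M[R]_(d, k)) (e : R).
Let P := B *m B^T.
Hypothesis (e_bd : nF (Ph - P) <= e).

(** Min-max argument: the range of [B] has dimension [k], so it contains a non-zero vector
    orthogonal to the first [i] right singular vectors of [Ph]. There [Ph] expands by at most the
    singular value of index [i], and [B B^T] by at least [sg]. *)
Lemma weyl_lower_bound sg : 0 < sg ->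
  (forall y : 'cV_k, sg * nF y ^+ 2 <= nF (B *m y) ^+ 2) ->
  forall i : 'I_k, sg - e <= s 0 (widen_ord lekd i).
Proof.
move=> sg0 Bsg i.
have i_lt : (i < d)%N := leq_trans (ltn_ord i) lekd.
pose f (j : 'I_i) : 'I_d := widen_ord (ltnW i_lt) j.
(* Indices start at 0: orthogonality to the [i] earlier right singular vectors amounts to [i < k]
   equations in the [k] coordinates of [y]. *)
have [y y0 Cy] := ex_kernel_vector ((colsub f V)^T *m B) (ltn_ord i).
set x := B *m y.
have xp : 0 < nF x.
  have yp : 0 < nF y.
    by rewrite lt_def nF_ge0 andbT; apply: contra_neq y0 => /nF_eq0.
  have := Bsg y; rewrite -/x => /(lt_le_trans (mulr_gt0 sg0 (exprn_gt0 2 yp))).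
  by rewrite exprn_even_gt0//= lt_def nF_ge0 andbT.
have Phx : nF (Ph *m x) <= s 0 (widen_ord lekd i) * nF x.
  have VV' : V^T^T *m V^T = 1%:M by rewrite trmxK; apply: mulmx1C.
  rewrite -(orth_nF x VV') PhE -!mulmxA (orth_nF _ UU).
  set z := V^T *m x.
  rewrite -(ler_pXn2r (ltn0Sn 1)) ?nnegrE ?mulr_ge0 ?nF_ge0//.
  rewrite exprMn !nF_sqrV mulr_sumr; apply: ler_sum => j _.
  rewrite mul_diag_mx mxE -!expr2 exprMn.
  have [ji|ij] := ltnP j i.
    have -> : z j 0 = 0.
      have /matrixP /(_ (Ordinal ji) 0) := Cy; rewrite -mulmxA -/x [RHS]mxE => zj.
      rewrite -[RHS]zj !mxE.
      by apply: eq_bigr => l _; rewrite !mxE; congr (V _ _ * _); apply: val_inj.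
    by rewrite expr0n/= !mulr0.
  rewrite ler_wpM2r ?sqr_ge0// ler_pXn2r ?nnegrE//.
  exact: s_sort.
have := gram_lower_bound y sg0 Bsg; rewrite -/x -/P.
have : nF (P *m x) <= nF (Ph *m x) + e * nF x.
  have -> : P *m x = Ph *m x - (Ph - P) *m x by rewrite mulmxBl opprB addrC subrK.
  rewrite (le_trans (nFB _ _))// lerD2l (le_trans (nF_mul _ _))//.
  by rewrite ler_wpM2r.
move=> h1 /le_trans /(_ h1) h2.
rewrite -(ler_pM2r xp) mulrBl lerBlDr (le_trans h2)// lerD2r//.
Qed.

Let A := colsub (widen_ord lekd) U.
Let Vk := colsub (widen_ord lekd) V.
Let S := \row_i s 0 (widen_ord lekd i).

Let colsub_orth (Y : 'M[R]_d) : Y^T *m Y = 1%:M ->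
  (colsub (widen_ord lekd) Y)^T *m colsub (widen_ord lekd) Y = 1%:M.
Proof.
move=> YY; apply/matrixP => i j.
have /matrixP /(_ (widen_ord lekd i) (widen_ord lekd j)) := YY.
by rewrite !mxE => <-; apply: eq_bigr => l _; rewrite !mxE.
Qed.

Let AA : A^T *m A = 1%:M. Proof. exact: colsub_orth. Qed.
Let VkVk : Vk^T *m Vk = 1%:M. Proof. exact: colsub_orth. Qed.

Let PhVk : Ph *m Vk = A *m diag_mx S.
Proof.
have e1 : Ph *m V = U *m diag_mx s.
  by rewrite PhE -mulmxA VV mulmx1.
apply/matrixP => i j; rewrite mul_mx_diag !mxE.
have /matrixP /(_ i (widen_ord lekd j)) := e1.
rewrite mul_mx_diag !mxE => <-.
by apply: eq_bigr => l _; rewrite !mxE.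
Qed.

Let PhA : Ph^T *m A = Vk *m diag_mx S.
Proof.
have e1 : Ph^T *m U = V *m diag_mx s.
  by rewrite PhE !trmx_mul trmxK tr_diag_mx -!mulmxA UU mulmx1.
apply/matrixP => i j; rewrite mul_mx_diag !mxE.
have /matrixP /(_ i (widen_ord lekd j)) := e1.
rewrite mul_mx_diag !mxE => <-.
by apply: eq_bigr => l _; rewrite !mxE.
Qed.

(** Since [Ph] need not be symmetric, its left and right singular vectors [A] and [Vk] differ. Their
    difference [D] solves the Sylvester equation [D S + P D = - F]. As [P] is positive semidefinite,
    pairing the [j]-th column of this equation with that of [D] bounds the column of [D S] by that
    of [F]; no spectral gap is needed. The residual is then [- D S - E^T A], of norm at most
    [2 e + e]. *)
Lemma svd_residual : nF (P *m A - A *m diag_mx S) <= 3 * e.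
Proof.
pose E := Ph - P; pose D := A - Vk.
have PT : P^T = P by rewrite trmx_mul trmxK.
have PE : P = Ph - E by rewrite /E opprB addrC subrK.
have PE' : P = Ph^T - E^T by rewrite -{1}PT PE linearB.
have nE : nF E <= e := e_bd.
clearbody E.
have e0 : 0 <= e by exact: le_trans (nF_ge0 _) e_bd.
have EA : nF (E^T *m A) <= e.
  rewrite (le_trans (opb_mulr _ (ler01) (opb_orth AA)))// mul1r nFT//.
have EV : nF (E *m Vk) <= e.
  by rewrite (le_trans (opb_mulr _ (ler01) (opb_orth VkVk)))// mul1r.
pose F := E^T *m A - E *m Vk.
have nFF : nF F <= 2 * e.
  by rewrite (le_trans (nFB _ _))// mulr_natl mulr2n lerD.
have sylv : D *m diag_mx S + P *m D = - F.
  rewrite /D mulmxBr {1}PE' {1}PE !mulmxBl PhA PhVk /F.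
  by rewrite !opprB (addrC (_ - E^T *m A)) addrA (addrC (A *m _ - _)) !subrKA.
have DS : nF (D *m diag_mx S) <= 2 * e.
  apply: le_trans nFF; rewrite -(ler_pXn2r (ltn0Sn 1)) ?nnegrE ?nF_ge0//.
  rewrite !nF_col; apply: ler_sum => j _; rewrite ler_pXn2r ?nnegrE ?nF_ge0//.
  set dj := col j D; set t := S 0 j.
  have t0 : 0 <= t by rewrite /t mxE.
  have cDS : col j (D *m diag_mx S) = t *: dj.
    by apply/matrixP => a b; rewrite /t /dj ?mul_mx_diag !mxE mulrC.
  rewrite cDS nFZ ger0_norm//.
  have [->|d0] := eqVneq (nF dj) 0; first by rewrite mulr0.
  rewrite -(ler_pM2l (x := nF dj)); last by rewrite lt_def d0/=.
  have eqj : t *: dj + P *m dj = - col j F.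
    have -> : - col j F = col j (- F) by apply/matrixP => a b; rewrite !mxE.
    rewrite -sylv -cDS /dj !colE mulmxA -mulmxDl.
    by [].
  have : dot dj (t *: dj + P *m dj) <= nF dj * nF (col j F).
    rewrite eqj dotNr (le_trans (ler_norm _))// normrN dot_le//.
  rewrite dotDr dotZr -nF_sqrV; apply: le_trans.
  rewrite mulrCA -expr2 lerDl /P -mulmxA -{1}[B]trmxK -dot_mulmxl.
  by rewrite -nF_sqrV sqr_ge0.
have -> : P *m A - A *m diag_mx S = - (D *m diag_mx S) - E^T *m A.
  by rewrite {1}PE' mulmxBl PhA /D mulmxBl opprB addrAC.
apply: le_trans (nFB _ _) _; rewrite nFN.
by have := lerD DS EA; lra.
Qed.

(** Everything follows from [P A = A S + r0] with [r0] of norm at most [3 e]. Multiplying by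
    [S^(-1/2)] on both sides gives [W^T P W = 1 + L A^T r0 L]. The transposed pseudo-inverse of [W]
    is [A S^(1/2)], whereas [B (W^T B)^T = P W = A S^(1/2) + r0 L]. *)
Lemma whitening_approx tau (W := A *m diag_mx (\row_i (Num.sqrt (S 0 i))^-1)) :
  0 < tau -> (forall i, tau <= S 0 i) ->
  [/\ opb W (Num.sqrt tau)^-1,
    nF (W^T *m B *m (W^T *m B)^T - 1%:M) <= 3 * e / tau
  & (exists2 r : 'M[R]_(d, k), nF r <= 3 * e / Num.sqrt tau &
    (invmx (W^T *m W) *m W^T)^T = B *m (W^T *m B)^T - r)].
Proof.
move=> tau0 tauS; set L := diag_mx _ in W *.
have st0 : 0 < Num.sqrt tau by rewrite sqrtr_gt0.
have S0 i : 0 < S 0 i := lt_le_trans tau0 (tauS i).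
have sS0 i : 0 < Num.sqrt (S 0 i) by rewrite sqrtr_gt0.
have sSE i : Num.sqrt (S 0 i) ^+ 2 = S 0 i by rewrite sqr_sqrtr ?ltW.
have opL : opb L (Num.sqrt tau)^-1.
  apply: opb_diag => [|i]; first by rewrite invr_ge0 ltW.
  rewrite mxE ger0_norm; last by rewrite invr_ge0 ltW.
  by rewrite lef_pV2 ?posrE// ler_wsqrtr.
have LT : L^T = L by rewrite tr_diag_mx.
pose r0 := P *m A - A *m diag_mx S.
have PA : P *m A = A *m diag_mx S + r0 by rewrite /r0 addrC subrK.
have it0 : 0 <= (Num.sqrt tau)^-1 by rewrite invr_ge0 ltW.
have nr0 : nF r0 <= 3 * e := svd_residual.
have LSL : L *m diag_mx S *m L = 1%:M.
  apply/matrixP => a b; rewrite mul_mx_diag mul_diag_mx !mxE.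
  have [->|ij] := eqVneq a b; last by rewrite mulr0n mulr0 mul0r.
  have := S0 b; have := sSE b; rewrite !mulr1n !mxE => e1 sb0.
  by rewrite mulrAC -invfM -expr2 e1 mulVf ?gt_eqF.
have PW : P *m W = A *m (diag_mx S *m L) + r0 *m L.
  by rewrite /W mulmxA PA mulmxDl mulmxA.
have BW : B *m (W^T *m B)^T = P *m W by rewrite (trmx_mul W^T B) trmxK mulmxA.
split.
- move=> x; rewrite -mulmxA (orth_nF _ AA); exact: opL.
- have -> : W^T *m B *m (W^T *m B)^T - 1%:M = L *m (A^T *m (r0 *m L)).
    rewrite -mulmxA BW PW /W trmx_mul LT -mulmxA mulmxDr (mulmxA A^T A) AA.
    by rewrite mul1mx mulmxDr !mulmxA LSL addrC addKr -!mulmxA.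
  apply: le_trans (opb_mul _ it0 opL) _.
  have hA : nF (A^T *m (r0 *m L)) <= 3 * e / Num.sqrt tau.
    rewrite (le_trans (opb_mul _ ler01 (opb_tr ler01 (opb_orth AA))))// mul1r.
    by rewrite (le_trans (opb_mulr _ it0 opL))// mulrC ler_wpM2r.
  rewrite (le_trans (ler_wpM2l it0 hA))// le_eqVlt; apply/orP; left; apply/eqP.
  by rewrite -[in RHS](sqr_sqrtr (ltW tau0)); field; rewrite gt_eqF.
- exists (r0 *m L); first by rewrite (le_trans (opb_mulr _ it0 opL))// mulrC ler_wpM2r.
  have WW : W^T *m W = L *m L.
    by rewrite /W trmx_mul LT -!mulmxA (mulmxA A^T A) AA mul1mx.
  have WWi : invmx (W^T *m W) = diag_mx S.
    have h : diag_mx S *m (W^T *m W) = 1%:M.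
      rewrite WW mulmxA; apply: mulmx1C; rewrite -LSL mulmxA//.
    have [_ u] := mulmx1_unit h.
    by rewrite -[LHS]mul1mx -h -mulmxA mulmxV ?mulmx1.
  rewrite BW PW WWi (trmx_mul (diag_mx S)) trmxK tr_diag_mx addrK /W -!mulmxA.
  congr (_ *m _).
  by apply/matrixP => i j; rewrite !mul_mx_diag !mxE; case: eqP => [->|_]; rewrite ?mulr1n ?mulr0n ?mul0r// mulrC.
Qed.

End Svd.
End Whitening.

(** * Perturbation of singular vectors *)

Section SingularVectors.
Context {R : rcfType}.

(* Adding and subtracting the two equations decouples them into
   (lam - s)(a + b) = e + f and (lam + s)(a - b) = e - f. *)
Lemma singular_pair_coord (lam s a b e f g : R) :
  lam * a - s * b = e -> lam * b - s * a = f ->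
  0 <= s -> 0 <= g -> g <= `|s - `|lam| | ->
  g ^+ 2 * (a ^+ 2 + b ^+ 2) <= e ^+ 2 + f ^+ 2.
Proof.
move=> <- <- s0 g0 gs.
have [h1 h2] : g ^+ 2 <= (lam - s) ^+ 2 /\ g ^+ 2 <= (lam + s) ^+ 2.
  have l0 : 0 <= `|lam| by exact: normr_ge0.
  have h : g ^+ 2 <= (s - `|lam|) ^+ 2.
    by rewrite -(real_normK (num_real (s - _))) ler_pXn2r ?nnegrE.
  have [l|l] := ger0P lam; move: h; rewrite ?(ger0_norm l) ?(ltr0_norm l) => h.
    by split; nra.
  by split; nra.
have e1 : 0 <= (a + b) ^+ 2 by exact: sqr_ge0.
have e2 : 0 <= (a - b) ^+ 2 by exact: sqr_ge0.
have := ler_wpM2r e1 h1; have := ler_wpM2r e2 h2; lra.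
Qed.

Variables (k : nat) (lam : 'I_k -> R) (a b e f : 'cV[R]_k) (s eta : R).
Hypotheses (ae : forall i, lam i * a i 0 - s * b i 0 = e i 0)
  (bf : forall i, lam i * b i 0 - s * a i 0 = f i 0).
Hypotheses (s0 : 0 <= s) (eta0 : 0 < eta) (e_le : nF e <= eta) (f_le : nF f <= eta).

Lemma singular_pair_sum (Pd : pred 'I_k) g : 0 <= g ->
  (forall i, Pd i -> g <= `|s - `|lam i| |) ->
  g ^+ 2 * (\sum_(i | Pd i) (a i 0 ^+ 2 + b i 0 ^+ 2)) <= 2 * eta ^+ 2.
Proof.
move=> g0 gP; apply: (@le_trans _ _ (nF e ^+ 2 + nF f ^+ 2)); last first.
  by rewrite mulr_natl mulr2n lerD// ler_pXn2r ?nnegrE ?nF_ge0// ltW.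
rewrite mulr_sumr !nF_sqrV -big_split/=.
rewrite [leRHS](bigID Pd)/= -[leLHS]addr0 lerD//.
  apply: ler_sum => i Pi; rewrite -!expr2.
  exact: singular_pair_coord (ae i) (bf i) s0 g0 (gP i Pi).
by apply: sumr_ge0 => i _; rewrite addr_ge0// -expr2 sqr_ge0.
Qed.

(** Otherwise all coordinates would be separated by [2 eta], and
    [4 eta^2 (|a|^2 + |b|^2) <= 2 eta^2] contradicts [|a|^2 + |b|^2 >= 1]. *)
Lemma singular_value_near : 2^-1 <= nF a ^+ 2 -> 2^-1 <= nF b ^+ 2 ->
  exists i, `|s - `|lam i| | <= 2 * eta.
Proof.
move=> a1 b1; have [/existsP//|] := boolP [exists i, `|s - `|lam i| | <= 2 * eta].
rewrite negb_exists => /forallP h.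
have eta2 : 0 <= 2 * eta by rewrite mulr_ge0// ltW.
have h' i : xpredT i -> 2 * eta <= `|s - `|lam i| |.
  by move=> _; rewrite ltW// ltNge h.
have := singular_pair_sum eta2 h'; rewrite big_split/=.
have -> : \sum_i a i 0 ^+ 2 = nF a ^+ 2.
  by rewrite nF_sqrV; apply: eq_bigr => i _; rewrite expr2.
have -> : \sum_i b i 0 ^+ 2 = nF b ^+ 2.
  by rewrite nF_sqrV; apply: eq_bigr => i _; rewrite expr2.
have : 0 < eta ^+ 2 by exact: exprn_gt0.
by nra.
Qed.

(** For [j] other than [i], the distance from [s] to [|lam j|] is at least [D - 2 eta >= D / 2]. *)
Lemma singular_vector_off i D : 0 < D -> 4 * eta <= D ->
  `|s - `|lam i| | <= 2 * eta ->
  (forall j, j != i -> D <= `| `|lam i| - `|lam j| |) ->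
  \sum_(j | j != i) a j 0 ^+ 2 <= 8 * eta ^+ 2 / D ^+ 2.
Proof.
move=> D0 eD si gap.
have D2 : 0 <= D / 2 by rewrite divr_ge0// ltW.
have h' j : j != i -> D / 2 <= `|s - `|lam j| |.
  move=> /gap; have := ler_distD s `|lam i| `|lam j|.
  by rewrite (distrC `|lam i| s); lra.
have h2 := singular_pair_sum D2 h'; rewrite big_split/= in h2.
have b0 : 0 <= \sum_(j | j != i) b j 0 ^+ 2.
  by apply: sumr_ge0 => j _; rewrite sqr_ge0.
rewrite ler_pdivlMr ?exprn_gt0//.
have : 0 <= D ^+ 2 * \sum_(j | j != i) b j 0 ^+ 2 by rewrite mulr_ge0 ?sqr_ge0.
by move: h2; rewrite expr_div_n; lra.
Qed.

End SingularVectors.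

(** * Matching the singular vectors with the columns of [M] *)

Section Matching.
Context {R : rcfType}.

Lemma near_isometry k (M : 'M[R]_k) beta (u : 'cV_k) :
  nF (M *m M^T - 1%:M) <= beta ->
  `|nF (M^T *m u) ^+ 2 - nF u ^+ 2| <= beta * nF u ^+ 2.
Proof.
move=> Mb.
have -> : nF (M^T *m u) ^+ 2 - nF u ^+ 2 = dot u ((M *m M^T - 1%:M) *m u).
  by rewrite !nF_sqrV dot_mulmxl trmxK mulmxBl mul1mx dotDr dotNr mulmxA.
apply: le_trans (dot_le _ _) _; rewrite expr2 mulrCA.
by rewrite ler_wpM2l// (le_trans (nF_mul _ _))// ler_wpM2r.
Qed.

Variables (k : nat) (M E : 'M[R]_k) (lam : 'I_k -> R) (beta kappa ell D : R).
Variables (U V : 'M[R]_k) (s : 'rV[R]_k).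
Hypotheses (UU : U^T *m U = 1%:M) (VV : V^T *m V = 1%:M) (s0 : forall i, 0 <= s 0 i).
Hypothesis (XE : M *m diag_mx (\row_i lam i) *m M^T + E = U *m diag_mx s *m V^T).
Hypotheses (Mb : nF (M *m M^T - 1%:M) <= beta) (beta8 : beta <= 8^-1).
Hypotheses (ell0 : 0 <= ell) (lam_le : forall i, `|lam i| <= ell) (Ek : opb E kappa) (kappa0 : 0 <= kappa).
Let eta := 3 / 2 * (beta * ell + kappa).
Hypotheses (eta0 : 0 < eta) (etaD : 8 * eta <= D).
Hypothesis gap : forall i j, j != i -> D <= `| `|lam i| - `|lam j| |.

Let beta0 : 0 <= beta. Proof. exact: le_trans (nF_ge0 _) Mb. Qed.

Let opM : opb M^T (3 / 2).
Proof.
move=> x; rewrite -(ler_pXn2r (ltn0Sn 1)) ?nnegrE ?mulr_ge0 ?nF_ge0 ?invr_ge0//.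
rewrite exprMn; have := near_isometry x Mb; rewrite ler_norml => /andP[_ h].
have : 0 <= nF x ^+ 2 by exact: sqr_ge0.
have := ler_wpM2r (sqr_ge0 (nF x)) beta8.
by nra.
Qed.

(** Applying [M^T] to the singular vector equation gives, with [L = diag lam], [L (M^T u) - t (M^T
    w) = - ((M^T M - 1) L (M^T u) + M^T X u)]. The defect of [M^T M] is that of [M M^T], by
    [nF_gram]; the factor [3 / 2] in [eta] is the bound on the norm of [M^T]. *)
Let residual (X : 'M[R]_k) (u w : 'cV[R]_k) (t : R) :
  opb X kappa -> nF u = 1 ->
  (M *m diag_mx (\row_i lam i) *m M^T + X) *m u = t *: w ->
  exists2 e : 'cV[R]_k, nF e <= eta &
  forall i, lam i * (M^T *m u) i 0 - t * (M^T *m w) i 0 = e i 0.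
Proof.
move=> opX u1 Xu; set L := diag_mx _ in Xu.
exists (- ((M^T *m M - 1%:M) *m (L *m (M^T *m u)) + M^T *m (X *m u))).
  rewrite nFN (le_trans (nFD _ _))// /eta mulrDr lerD//.
    have opL : opb L ell by apply: opb_diag => // i; rewrite mxE.
    have Mu : nF (M^T *m u) <= 3 / 2 by have := opM u; rewrite u1 mulr1.
    apply: le_trans (nF_mul _ _) _; rewrite nF_gram mulrCA.
    rewrite ler_pM// mulrC (le_trans (opL _))// ler_wpM2l//.
  have h32 : (0 : R) <= 3 / 2 by lra.
  rewrite (le_trans (opM _))// (ler_wpM2l h32)//.
  by rewrite (le_trans (opX _))// u1 mulr1.
move=> i; have /matrixP /(_ i 0) : - ((M^T *m M - 1%:M) *m (L *m (M^T *m u)) + M^T *m (X *m u)) =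
    L *m (M^T *m u) - t *: (M^T *m w).
  rewrite mulmxBl mul1mx scalemxAr -Xu mulmxDl mulmxDr -!mulmxA.
  by rewrite addrAC opprB opprD addrA addrAC.
by move=> ->; rewrite [RHS]mxE mul_diag_mx !mxE.
Qed.

Let colU_unit (Y : 'M[R]_k) j : Y^T *m Y = 1%:M -> nF (col j Y) = 1.
Proof.
by move=> YY; rewrite colE (orth_nF _ YY) nF_delta.
Qed.

(** Each left singular vector [u_j] has one dominant coordinate in [M^T u_j]: the squared norm is at
    least [7/8] and the other coordinates contribute at most [1/8]. The position of that coordinate,
    as a function of [j], is injective, hence a permutation. *)
Theorem singular_vectors_match : exists sg : 'S_k, forall i,
  \sum_(l | l != i) (M^T *m col (sg i) U) l 0 ^+ 2 <= 8 * eta ^+ 2 / D ^+ 2.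
Proof.
have D0 : 0 < D by apply: lt_le_trans etaD; rewrite mulr_gt0.
pose X := M *m diag_mx (\row_i lam i) *m M^T + E.
have XE' : X = U *m diag_mx s *m V^T := XE.
have XV : X *m V = U *m diag_mx s by rewrite XE' -mulmxA VV mulmx1.
have XU : X^T *m U = V *m diag_mx s.
  by rewrite XE' !trmx_mul trmxK tr_diag_mx -!mulmxA UU mulmx1.
have XT : X^T = M *m diag_mx (\row_i lam i) *m M^T + E^T.
  by rewrite /X linearD/= !trmx_mul trmxK tr_diag_mx mulmxA.
have colD (Y Z W : 'M[R]_k) j : Z *m W = Y *m diag_mx s ->
    Z *m col j W = s 0 j *: col j Y.
  move=> ZW; rewrite colE mulmxA ZW -colE; apply/matrixP => p q.
  by rewrite mul_mx_diag !mxE mulrC.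
have sqa (u : 'cV[R]_k) : nF u = 1 -> 7 / 8 <= nF (M^T *m u) ^+ 2.
  move=> u1; have := near_isometry u Mb; rewrite u1 expr1n mulr1 ler_norml.
  by move: beta8 => b8 /andP[]; lra.
have near j : exists i, 3 / 4 <= (M^T *m col j U) i 0 ^+ 2 /\
    \sum_(l | l != i) (M^T *m col j U) l 0 ^+ 2 <= 8 * eta ^+ 2 / D ^+ 2.
  have nU := colU_unit j UU; have nV := colU_unit j VV.
  have [e e_le ee] : exists2 e : 'cV[R]_k, nF e <= eta & forall i,
      lam i * (M^T *m col j U) i 0 - s 0 j * (M^T *m col j V) i 0 = e i 0.
    apply: residual nU _; first exact: opb_tr kappa0 Ek.
    by rewrite -XT (colD V).
  have [f f_le ff] : exists2 e : 'cV[R]_k, nF e <= eta & forall i,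
      lam i * (M^T *m col j V) i 0 - s 0 j * (M^T *m col j U) i 0 = e i 0.
    by apply: residual Ek nV _; rewrite -/X (colD U).
  have [i si] : exists i, `|s 0 j - `|lam i| | <= 2 * eta.
    apply: (singular_value_near ee ff) => //.
      by apply: le_trans (sqa _ nU); lra.
    by apply: le_trans (sqa _ nV); lra.
  have off : \sum_(l | l != i) (M^T *m col j U) l 0 ^+ 2 <= 8 * eta ^+ 2 / D ^+ 2.
    apply: (singular_vector_off ee ff) => //; last by move=> l; exact: gap.
    by move: etaD eta0; lra.
  exists i; split=> //.
  have := sqa _ nU; rewrite nF_sqrV /dot (bigD1 i)//= -expr2.
  under [X in _ + X]eq_bigr do rewrite -expr2.
  have : 8 * eta ^+ 2 / D ^+ 2 <= 8^-1.
    rewrite ler_pdivrMr ?exprn_gt0//.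
    have : (8 * eta) ^+ 2 <= D ^+ 2.
      by rewrite ler_pXn2r ?nnegrE// ltW// mulr_gt0.
    by rewrite exprMn; lra.
  by move: off; lra.
have [pi piP] := fin_all_exists near.
(* If two singular vectors shared the coordinate [i], column [i] of [M] would have squared norm at
   least [3/4 + 3/4] in the basis [U], but its squared norm is at most [1 + beta <= 9/8]. *)
have pi_inj : injective pi.
  move=> j1 j2 e12; apply/eqP; apply: contraT => j12.
  have [p1 _] := piP j1; have [p2 _] := piP j2; rewrite -e12 in p2.
  set i := pi j1 in p1 p2.
  have : nF (U^T *m col i M) ^+ 2 <= 9 / 8.
    have UT : U^T^T *m U^T = 1%:M by rewrite trmxK; apply: mulmx1C.
    rewrite (orth_nF _ UT) nF_sqrV.
    have := le_coord_l2 (fun ij => (M^T *m M - 1%:M) ij.1 ij.2) (i, i).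
    rewrite -/(nF _) nF_gram => /le_trans /(_ Mb); rewrite !mxE eqxx mulr1n/=.
    have -> : \sum_j M^T i j * M j i = dot (col i M) (col i M).
      by apply: eq_bigr => l _; rewrite !mxE.
    rewrite ler_norml => /andP[_]; move: beta8; lra.
  rewrite nF_sqrV /dot (bigD1 j1)//= (bigD1 j2) 1?eq_sym//=.
  have swap j : (U^T *m col i M) j 0 = (M^T *m col j U) i 0.
    by rewrite !mxE; apply: eq_bigr => l _; rewrite !mxE mulrC.
  rewrite !swap -!expr2 => h.
  have : 0 <= \sum_(j | (j != j1) && (j != j2)) (U^T *m col i M) j 0 * (U^T *m col i M) j 0.
    by apply: sumr_ge0 => j _; rewrite -expr2 sqr_ge0.
  by move: h p1 p2; lra.
exists (perm pi_inj)^-1%g => i.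
have := (piP ((perm pi_inj)^-1%g i)).2.
by have -> : pi ((perm pi_inj)^-1%g i) = i by rewrite -(permE pi_inj) permKV.
Qed.

End Matching.

(** * Perturbation of the recovered vectors *)

Lemma dot_diag (R : rcfType) k (s : 'rV[R]_k) (a b : 'cV[R]_k) :
  dot a (diag_mx s *m b) = \sum_l s 0 l * a l 0 * b l 0.
Proof. by apply: eq_bigr => l _; rewrite mul_diag_mx mxE mulrCA mulrA. Qed.

(** With [x] near [ga a^3] and [F] near [a v], the product is near [a^4] times the target, so the
    sign of [a] is immaterial. The three terms are the errors of [a^4], of [F] and of [x]. *)
Lemma recovered_split (R : rcfType) d (v f F : 'cV[R]_d) (om ga a x : R) :
  F = a *: v + f -> (om * ga) *: v - (om * x) *: F =
    - ((a ^+ 4 - 1) *: ((om * ga) *: v) + (om * ga * a ^+ 3) *: f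
      + (om * (x - ga * a ^+ 3)) *: F).
Proof. by move=> ->; apply/matrixP => p q; rewrite !mxE; ring. Qed.

Section Recovery.
Context {R : rcfType}.
Variables (d k : nat) (O B W r : 'M[R]_(d, k)) (gam : 'I_k -> R) (T : 'cV[R]_d -> 'M[R]_d).
Variables (om g ot beta c eT rho : R).
Let M := W^T *m B.
Let kap := eT * c ^+ 3.
Hypotheses (om0 : 0 < om) (OB : forall i, col i O = (om * gam i) *: col i B)
  (O1 : forall i, nF (col i O) <= 1) (gam0 : forall i, 0 < gam i)
  (g0 : 0 <= g) (gam_le : forall i, gam i <= g) (B_le : nF B <= ot).
Hypotheses (Mb : nF (M *m M^T - 1%:M) <= beta) (c0 : 0 <= c) (Wc : opb W c) (r_le : nF r <= rho).
Hypotheses (eT0 : 0 <= eT) (TP : forall h u w : 'cV[R]_d,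
  `|dot u (T h *m w) - \sum_l gam l * (B^T *m h) l 0 * (B^T *m u) l 0 * (B^T *m w) l 0|
    <= eT * nF h * nF u * nF w).

Let MT (x : 'cV_k) : M^T *m x = B^T *m (W *m x).
Proof. by rewrite /M trmx_mul trmxK mulmxA. Qed.

Let whitened_error (h u w : 'cV[R]_k) :
  `|dot (W *m u) (T (W *m h) *m (W *m w)) -
    \sum_l gam l * (M^T *m h) l 0 * (M^T *m u) l 0 * (M^T *m w) l 0|
    <= kap * nF h * nF u * nF w.
Proof.
rewrite !MT; apply: le_trans (TP _ _ _) _.
have -> : kap * nF h * nF u * nF w = eT * (c * nF h) * (c * nF u) * (c * nF w).
  by rewrite /kap; ring.
by rewrite !ler_pM ?mulr_ge0 ?nF_ge0.
Qed.

(** The trilinear estimate becomes an operator norm bound on pairing [E w] with itself. *)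
Lemma whitened_triples_error (h : 'cV[R]_k) :
  opb (W^T *m T (W *m h) *m W -
    M *m diag_mx (\row_l (gam l * (M^T *m h) l 0)) *m M^T) (kap * nF h).
Proof.
set E := _ - _ => w.
have [->|E0] := eqVneq (nF (E *m w)) 0; first by rewrite !mulr_ge0.
rewrite -(ler_pM2l (x := nF (E *m w))); last by rewrite lt_def E0/=.
rewrite -expr2 nF_sqrV; set u := E *m w.
have -> : dot u u = dot (W *m u) (T (W *m h) *m (W *m w)) -
    \sum_l gam l * (M^T *m h) l 0 * (M^T *m u) l 0 * (M^T *m w) l 0.
  rewrite {2}/u /E mulmxBl dotDr dotNr; congr (_ - _).
    by rewrite dot_mulmxl !mulmxA.
  set L := diag_mx _.
  rewrite -(mulmxA (M *m L)) -(mulmxA M) [dot u _]dotC dot_mulmxl dotC.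
  by rewrite dot_diag; apply: eq_bigr => l _; congr (_ * _ * _); rewrite mxE.
apply: le_trans (ler_norm _) _; apply: le_trans (whitened_error _ _ _) _.
by rewrite le_eqVlt; apply/orP; left; apply/eqP; ring.
Qed.

(** The vector returned by the procedure: in the application [om = (a0 + 2) / 2], so that the scalar
    is the inverse of [Z], and [B M^T - r] is the transposed pseudo-inverse of [W]. *)
Definition recovered (u : 'cV[R]_k) : 'cV[R]_d :=
  (om * dot (W *m u) (T (W *m u) *m (W *m u))) *: ((B *m M^T - r) *m u).

Let cube_error (u : 'cV[R]_k) : nF u = 1 ->
  `|dot (W *m u) (T (W *m u) *m (W *m u)) - \sum_l gam l * (M^T *m u) l 0 ^+ 3| <= kap.
Proof.
move=> u1; have := whitened_error u u u; rewrite u1 !mulr1.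
by rewrite [X in _ - X](eq_bigr (fun l => gam l * (M^T *m u) l 0 ^+ 3))// => l _; ring.
Qed.

Let residual_le (u : 'cV[R]_k) : nF u = 1 -> nF (r *m u) <= rho.
Proof. by move=> u1; rewrite (le_trans (nF_mul _ _))// u1 mulr1. Qed.

Let recovered_factor (u : 'cV[R]_k) b : nF u = 1 -> nF (M^T *m u) <= b ->
  nF ((B *m M^T - r) *m u) <= b * ot + rho.
Proof.
move=> u1 ub; rewrite mulmxBl (le_trans (nFB _ _))// lerD ?residual_le//.
rewrite -mulmxA (le_trans (nF_mul _ _))// mulrC ler_pM//.
Qed.

Let cubes_le (Pd : pred 'I_k) (a : 'cV[R]_k) b : nF a <= b ->
  `|\sum_(l | Pd l) gam l * a l 0 ^+ 3| <= g * b * \sum_(l | Pd l) a l 0 ^+ 2.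
Proof.
move=> ab; rewrite mulr_sumr (le_trans (ler_norm_sum _ _ _))//.
apply: ler_sum => l _; rewrite normrM normrX exprS -mulrA.
rewrite (gtr0_norm (gam0 l)) ler_pM ?(ltW (gam0 l)) ?mulr_ge0 ?exprn_ge0//.
rewrite -normrX (ger0_norm (sqr_ge0 _)) ler_wpM2r ?sqr_ge0//.
by apply: le_trans ab; rewrite nF_cVl2; exact: (le_coord_l2 (fun i => a i 0)).
Qed.

(** The crude bound for the case in which perturbation theory does not apply: [beta] need not be
    small, and [u] need not be near any particular direction. *)
Lemma recovered_le b (u : 'cV[R]_k) : nF u = 1 -> 0 <= b -> 1 + beta <= b ^+ 2 ->
  nF (recovered u) <= om * (g * b ^+ 3 + kap) * (b * ot + rho).
Proof.
move=> u1 b0 bb.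
have ub : nF (M^T *m u) <= b.
  rewrite -(ler_pXn2r (ltn0Sn 1)) ?nnegrE ?nF_ge0//; apply: le_trans bb.
  by have := near_isometry u Mb; rewrite u1 expr1n mulr1 ler_norml => /andP[_]; lra.
rewrite nFZ normrM (gtr0_norm om0) ler_pM ?mulr_ge0 ?(ltW om0)//; last first.
  exact: recovered_factor.
rewrite ler_wpM2l ?(ltW om0)//.
have := cube_error u1; have := cubes_le xpredT ub.
have -> : \sum_l (M^T *m u) l 0 ^+ 2 = nF (M^T *m u) ^+ 2.
  by rewrite nF_sqrV; apply: eq_bigr => l _; rewrite expr2.
set x := dot _ _; set y := \sum_l _ => h1 h2.
have h3 : g * b * nF (M^T *m u) ^+ 2 <= g * b ^+ 3.
  rewrite [b ^+ 3]exprS (mulrA g b (b ^+ 2)) ler_wpM2l ?mulr_ge0 ?g0//.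
  by rewrite ler_pXn2r ?nnegrE ?nF_ge0.
by have := ler_normD (x - y) y; rewrite subrK; lra.
Qed.

(** Here [M^T u = a_i e_i + a'] with [|a_i^2 - 1| <= beta + nu^2] and [|a'| <= nu]. The three
    summands bound the three terms of [recovered_split]. *)
Lemma recovered_dist nu i (u : 'cV[R]_k) : nF u = 1 -> beta <= 8^-1 -> 0 <= nu <= 1 ->
  \sum_(l | l != i) (M^T *m u) l 0 ^+ 2 <= nu ^+ 2 ->
  nF (col i O - recovered u) <= 3 * (beta + nu ^+ 2) + 2 * om * g * (nu * ot + rho)
    + om * (2 * g * nu ^+ 2 + kap) * (2 * ot + rho).
Proof.
move=> u1 b8 /andP[nu0 nu1]; set a := M^T *m u => off.
have beta0 : 0 <= beta := le_trans (nF_ge0 _) Mb.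
have na : `|nF a ^+ 2 - 1| <= beta.
  by have := near_isometry u Mb; rewrite u1 expr1n mulr1.
have aE : nF a ^+ 2 = a i 0 ^+ 2 + \sum_(l | l != i) a l 0 ^+ 2.
  by rewrite nF_cVl2 l2_sqr (bigD1 i).
set S2 := \sum_(l | _) _ in off aE.
have S20 : 0 <= S2 by apply: sumr_ge0 => l _; rewrite sqr_ge0.
have nu2 : nu ^+ 2 <= 1 by rewrite expr_le1.
have ai2 : `|a i 0 ^+ 2 - 1| <= beta + nu ^+ 2.
  by move: na; rewrite aE !ler_norml => /andP[h1 h2]; apply/andP; split; lra.
have ai_le : a i 0 ^+ 2 <= 9 / 8.
  by move: na; rewrite aE ler_norml => /andP[h1 h2]; lra.
have ai4 : `|a i 0 ^+ 4 - 1| <= 3 * (beta + nu ^+ 2).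
  have -> : a i 0 ^+ 4 - 1 = (a i 0 ^+ 2 - 1) * (a i 0 ^+ 2 + 1) by ring.
  rewrite normrM mulrC ler_pM// ger0_norm ?addr_ge0 ?sqr_ge0//; lra.
have na2 : nF a <= 3 / 2.
  rewrite -(ler_pXn2r (ltn0Sn 1)) ?nnegrE ?nF_ge0 ?divr_ge0//.
  by move: na; rewrite ler_norml => /andP[h1 h2]; lra.
have nai : `|a i 0| <= 3 / 2.
  by apply: le_trans na2; rewrite nF_cVl2; exact: (le_coord_l2 (fun i => a i 0)).
have nai3 : `|a i 0 ^+ 3| <= 2.
  rewrite exprS normrM (ger0_norm (sqr_ge0 _)).
  apply: le_trans (ler_pM _ _ nai ai_le) _; rewrite ?sqr_ge0//; lra.
pose a' := \col_l (if l == i then 0 else a l 0).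
have a'E : a = a i 0 *: delta_mx i 0 + a'.
  apply/matrixP => l j; rewrite ord1 !mxE; case: eqP => [->|_] /=.
    by rewrite mulr1 addr0.
  by rewrite mulr0 add0r.
have a'_le : nF a' <= nu.
  rewrite -(ler_pXn2r (ltn0Sn 1)) ?nnegrE ?nF_ge0//; apply: le_trans off.
  rewrite nF_sqrV /dot (bigD1 i)//= mxE eqxx mulr0 add0r.
  by apply: ler_sum => l /negPf li; rewrite mxE li expr2.
set x := dot (W *m u) (T (W *m u) *m (W *m u)).
pose y := \sum_(l | l != i) gam l * a l 0 ^+ 3.
have xP : `|x - (gam i * a i 0 ^+ 3 + y)| <= kap.
  by have := cube_error u1; rewrite (bigD1 i).
have y_le : `|y| <= 2 * g * nu ^+ 2.
  apply: (le_trans (cubes_le _ na2)).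
  have h : g * (3 / 2) * S2 <= g * (3 / 2) * nu ^+ 2.
    by rewrite ler_wpM2l// mulr_ge0 ?g0// divr_ge0.
  apply: le_trans h _; have : 0 <= g * nu ^+ 2 by rewrite mulr_ge0 ?g0 ?sqr_ge0.
  lra.
have fE : (B *m M^T - r) *m u = a i 0 *: col i B + (B *m a' - r *m u).
  rewrite mulmxBl -mulmxA -/a {1}a'E mulmxDr -scalemxAr -colE addrA//.
have -> : col i O - recovered u =
    - ((a i 0 ^+ 4 - 1) *: col i O
      + (om * gam i * a i 0 ^+ 3) *: (B *m a' - r *m u)
      + (om * (x - gam i * a i 0 ^+ 3)) *: ((B *m M^T - r) *m u)).
  by rewrite OB; apply: recovered_split fE.
rewrite nFN; apply: le_trans (nFD _ _) _.
have om_ge0 := ltW om0.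
have Ba : nF (B *m a' - r *m u) <= nu * ot + rho.
  rewrite (le_trans (nFB _ _))// lerD ?residual_le//.
  by rewrite (le_trans (nF_mul _ _))// mulrC ler_pM.
rewrite lerD//; last first.
  rewrite nFZ normrM (ger0_norm om_ge0) ler_pM ?mulr_ge0//; last first.
    apply: recovered_factor => //; apply: le_trans na2 _; lra.
  rewrite ler_wpM2l//; have := ler_normD (x - (gam i * a i 0 ^+ 3 + y)) y.
  have -> : x - (gam i * a i 0 ^+ 3 + y) + y = x - gam i * a i 0 ^+ 3 by ring.
  lra.
apply: le_trans (nFD _ _) _; rewrite lerD// nFZ.
  by rewrite -[leRHS]mulr1 ler_pM.
rewrite ler_pM// normrM -[2 * om * g]mulrA mulrC ler_pM//.
rewrite normrM (ger0_norm om_ge0) (gtr0_norm (gam0 i)) ler_pM// ltW//.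
Qed.

End Recovery.

(** * Deterministic recovery bound *)

(** [C1] and [C2] relate the errors of the two moments to the rate [eps]. The power of ten is not
    optimised; it only has to dominate the numerical constants in [trivial_arith] and
    [main_arith]. *)
Definition rate_const {R : rcfType} (C1 C2 : R) : R := 10 ^+ 9 * (1 + C1 + C2).

Section Deterministic.
Context {R : rcfType}.
Variables (d k : nat) (k_gt0 : (0 < k)%N) (lekd : (k <= d)%N).
Variables (O : 'M[R]_(d, k)) (p : 'I_k -> R) (a0 pm sk eps C1 C2 e eT : R).
Hypotheses (a0_gt0 : 0 < a0) (pm_gt0 : 0 < pm) (pm_le : forall i, pm <= p i)
  (p_le1 : forall i, p i <= 1) (sum_p : \sum_i p i = 1)
  (O1 : forall i, nF (col i O) <= 1) (sk_gt0 : 0 < sk) (sk_le1 : sk <= 1)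
  (skP : forall y : 'cV_k, sk * nF y <= nF (O *m y)).

Definition canonical_mx : 'M[R]_(d, k) :=
  O *m diag_mx (\row_i Num.sqrt (p i / (a0 + 1))).
Definition tensor_weight i : R :=
  2 * Num.sqrt (a0 + 1) / ((a0 + 2) * Num.sqrt (p i)).
Let B := canonical_mx.
Let gam := tensor_weight.
(** A lower bound for the non-zero eigenvalues of [B B^T], by [B_lower]. *)
Let sP := pm * sk ^+ 2 / (a0 + 1).

Variables (Ph U V : 'M[R]_d) (s : 'rV[R]_d) (T : 'cV[R]_d -> 'M[R]_d).
Hypotheses (UU : U^T *m U = 1%:M) (VV : V^T *m V = 1%:M)
  (s_ge0 : forall i, 0 <= s 0 i)
  (s_sort : forall i j : 'I_d, (i <= j)%N -> s 0 j <= s 0 i)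
  (PhE : Ph = U *m diag_mx s *m V^T).
Hypotheses (Ph_e : nF (Ph - B *m B^T) <= e) (e_sP : e <= 3 / 4 * sP)
  (eps_gt0 : 0 < eps) (eC1 : e <= C1 * eps) (eT_gt0 : 0 < eT) (eTC2 : eT <= C2 * eps).
Hypothesis TP : forall h u w : 'cV[R]_d,
  `|dot u (T h *m w) - \sum_l gam l * (B^T *m h) l 0 * (B^T *m u) l 0 * (B^T *m w) l 0|
    <= eT * nF h * nF u * nF w.

Let eT0 : 0 <= eT := ltW eT_gt0.
(** In terms of the square roots [q] and [r] the basic errors are bounded by monomials in [q], [r],
    [sk], [K] and [eps], so that comparing them amounts to comparing exponents. *)
Let q := Num.sqrt pm.
Let r := Num.sqrt (a0 + 1).
Let A1 : 1 <= a0 + 1. Proof. by rewrite lerDr ltW. Qed.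
Let A0 : 0 < a0 + 1. Proof. by rewrite (lt_le_trans ltr01). Qed.
Let q0 : 0 < q. Proof. by rewrite sqrtr_gt0. Qed.
Let r1 : 1 <= r. Proof. by rewrite -sqrtr1 ler_wsqrtr. Qed.
Let r0 : 0 < r. Proof. by rewrite (lt_le_trans ltr01). Qed.
Let q2 : q ^+ 2 = pm. Proof. by rewrite sqr_sqrtr ?ltW. Qed.
Let r2 : r ^+ 2 = a0 + 1. Proof. by rewrite sqr_sqrtr ?ltW. Qed.
Let q1 : q <= 1.
Proof. by rewrite -sqrtr1 ler_wsqrtr// (le_trans (pm_le (Ordinal k_gt0))). Qed.
Let p0 i : 0 < p i. Proof. exact: lt_le_trans (pm_le i). Qed.
Let sp0 i : 0 < Num.sqrt (p i). Proof. by rewrite sqrtr_gt0. Qed.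
Let sP0 : 0 < sP. Proof. by rewrite divr_gt0// mulr_gt0// exprn_gt0. Qed.
Let gam_gt0 i : 0 < gam i.
Proof. by rewrite divr_gt0 ?mulr_gt0 ?addr_gt0. Qed.

Let gam_le i : gam i <= 2 / (q * r).
Proof.
rewrite /gam /tensor_weight -/r.
have -> : 2 / (q * r) = 2 * r / (r ^+ 2 * q).
  by field; rewrite !gt_eqF.
rewrite ler_wpM2l ?mulr_ge0 ?(ltW r0)//.
rewrite lef_pV2 ?posrE ?mulr_gt0 ?exprn_gt0 ?addr_gt0//.
rewrite r2; apply: ler_pM; rewrite ?(ltW A0) ?(ltW q0)//; last exact: ler_wsqrtr.
by rewrite lerD2l ler1n.
Qed.

Let gam_ge i : r^-1 <= gam i.
Proof.
rewrite /gam /tensor_weight -/r.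
have -> : r^-1 = 2 * r / (2 * r ^+ 2) by field; rewrite gt_eqF.
rewrite ler_wpM2l ?mulr_ge0 ?(ltW r0)//.
rewrite lef_pV2 ?posrE ?mulr_gt0 ?exprn_gt0 ?addr_gt0// r2.
have : Num.sqrt (p i) <= 1 by rewrite -sqrtr1 ler_wsqrtr.
by have := sp0 i; move: a0_gt0; nra.
Qed.

Let om := (a0 + 2) / 2.
Let om0 : 0 < om. Proof. by rewrite divr_gt0// addr_gt0. Qed.
Let om_le : om <= r ^+ 2. Proof. by rewrite r2 /om; move: a0_gt0; lra. Qed.

Let colB i : col i B = Num.sqrt (p i / (a0 + 1)) *: col i O.
Proof. by apply/matrixP => l j; rewrite /B /canonical_mx mul_mx_diag !mxE mulrC. Qed.

Let OB i : col i O = (om * gam i) *: col i B.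
Proof.
rewrite colB scalerA sqrtrM ?ltW// sqrtrV ?ltW// -/r.
have -> : om * gam i * (Num.sqrt (p i) / r) = 1.
  rewrite /om /gam /tensor_weight -/r; field.
  by rewrite !gt_eqF//= addr_gt0.
by rewrite scale1r.
Qed.

Let B_le : nF B <= r^-1.
Proof.
rewrite -(ler_pXn2r (ltn0Sn 1)) ?nnegrE ?nF_ge0 ?invr_ge0 ?(ltW r0)//.
rewrite nF_col exprVn r2 -[leRHS]mul1r -[X in _ <= X * _]sum_p mulr_suml; apply: ler_sum => i _.
rewrite colB nFZ exprMn ger0_norm ?sqrtr_ge0// sqr_sqrtr; last by rewrite divr_ge0 ?ltW.
rewrite -[leRHS]mulr1 ler_wpM2l ?divr_ge0 ?expr_le1 ?(ltW A0) ?(ltW (p0 i))//.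
Qed.

Let B_lower (y : 'cV[R]_k) : sP * nF y ^+ 2 <= nF (B *m y) ^+ 2.
Proof.
rewrite /B /canonical_mx -mulmxA; set z := diag_mx _ *m y.
have h : pm / (a0 + 1) * nF y ^+ 2 <= nF z ^+ 2.
  rewrite !nF_cVl2 !l2_sqr mulr_sumr; apply: ler_sum => i _.
  rewrite /z mul_diag_mx mxE mxE exprMn sqr_sqrtr; last by rewrite divr_ge0 ?ltW.
  by rewrite ler_wpM2r ?sqr_ge0// ler_wpM2r ?invr_ge0 ?(ltW A0).
have hz : (sk * nF z) ^+ 2 <= nF (O *m z) ^+ 2.
  by rewrite ler_pXn2r ?nnegrE ?mulr_ge0 ?(ltW sk_gt0) ?nF_ge0.
apply: le_trans hz; rewrite exprMn.
have -> : sP * nF y ^+ 2 = sk ^+ 2 * (pm / (a0 + 1) * nF y ^+ 2) by rewrite /sP; ring.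
by rewrite ler_wpM2l ?sqr_ge0.
Qed.

Lemma singular_values_ge i : sP / 4 <= s 0 (widen_ord lekd i).
Proof.
have := weyl_lower_bound lekd UU VV s_ge0 s_sort PhE Ph_e sP0 B_lower i.
by move: e_sP; lra.
Qed.

Let W := colsub (widen_ord lekd) U *m
  diag_mx (\row_i (Num.sqrt (s 0 (widen_ord lekd i)))^-1).
Let M := W^T *m B.
Let beta := 3 * e / (sP / 4).
Let c := (Num.sqrt (sP / 4))^-1.
Let rho := 3 * e / Num.sqrt (sP / 4).

Lemma whitened_spec : [/\ opb W c, nF (M *m M^T - 1%:M) <= beta
  & exists2 rr : 'M[R]_(d, k), nF rr <= rho &
    (invmx (W^T *m W) *m W^T)^T = B *m M^T - rr].
Proof.
have tau0 : 0 < sP / 4 by rewrite divr_gt0.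
have WE : W = colsub (widen_ord lekd) U *m diag_mx
    (\row_i (Num.sqrt ((\row_i s 0 (widen_ord lekd i)) 0 i))^-1).
  by congr (_ *m diag_mx _); apply/rowP => i; rewrite !mxE.
have tauS i : sP / 4 <= (\row_i s 0 (widen_ord lekd i)) 0 i.
  by rewrite mxE; exact: singular_values_ge.
by have := whitening_approx UU VV s_ge0 PhE Ph_e tau0 tauS; rewrite /= -WE.
Qed.

(** Its product with [theta] is [lam_i + lam_j] or [lam_i - lam_j]. For [i = j] and the minus sign
    it is the zero vector, for which the separation hypothesis below is void, so all index pairs can
    be kept. *)
Definition gap_vector (i j : 'I_k) (b : bool) : 'cV[R]_k :=
  gam i *: col i M + (-1) ^+ b *: (gam j *: col j M).

(** The [2 k^2] gap vectors have strips of measure at most [2 k t] each; with this [t] the total is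
    [1/5]. *)
Definition gap_radius : R := (20 * k%:R ^+ 3)^-1.

Let K : R := k%:R ^+ 3.
Let K1 : 1 <= K. Proof. by rewrite exprn_ege1// ler1n. Qed.
Let K_gt0 : 0 < K. Proof. exact: lt_le_trans K1. Qed.
(** [X] is the rate to be proved. [Z] has one factor [1 / q] less; that factor is lost only at the
    end, through the bound [gam_le]. *)
Let X := r ^+ 4 * K * eps / (q ^+ 4 * sk ^+ 3).
Let Z := q * X.
Let kap := eT * c ^+ 3.
(** The gap between the [|lam_i|]: [gap_radius] times the lower bound [1 / r] on the norm of a gap
    vector. *)
Let D := (20 * r * K)^-1.

Let tauE : sP / 4 = (q * sk / (2 * r)) ^+ 2.
Proof. by rewrite /sP -q2 -r2; field; rewrite gt_eqF. Qed.
Let sqtE : Num.sqrt (sP / 4) = q * sk / (2 * r).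
Proof. by rewrite tauE sqrtr_sqr gtr0_norm// divr_gt0 ?mulr_gt0. Qed.
Let e0 : 0 <= e. Proof. exact: le_trans (nF_ge0 _) Ph_e. Qed.
Let C10 : 0 <= C1. Proof. by rewrite -(pmulr_lge0 _ eps_gt0) (le_trans e0). Qed.
Let C20 : 0 <= C2. Proof. by rewrite -(pmulr_lge0 _ eps_gt0) (le_trans eT0). Qed.
Let ZE : Z = (r ^+ 4 / (q ^+ 3 * sk ^+ 3)) * K * eps.
Proof. by rewrite /Z /X; field; rewrite !gt_eqF. Qed.

(** Since [r] and [K] are at least 1 and [q] and [sk] at most 1, every monomial with smaller
    exponents is dominated by [Z]. *)
Let le_Z a b m n : (a <= 4)%N -> (b <= 3)%N -> (m <= 3)%N -> (n <= 1)%N ->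
  r ^+ a / (q ^+ b * sk ^+ m) * K ^+ n * eps <= Z.
Proof.
move=> a4 b3 m3 n1; rewrite ZE (ler_pM2r eps_gt0).
have qs0 b' m' : 0 < q ^+ b' * sk ^+ m' by rewrite mulr_gt0 ?exprn_gt0.
have K0 : 0 <= K := le_trans ler01 K1.
have ra a' : 0 <= r ^+ a' by rewrite exprn_ge0 ?(ltW r0).
have qsV b' m' : 0 <= (q ^+ b' * sk ^+ m')^-1 by rewrite invr_ge0 ltW.
have Kn n' : 0 <= K ^+ n' by rewrite exprn_ge0.
have raV a' b' m' : 0 <= r ^+ a' / (q ^+ b' * sk ^+ m') by rewrite mulr_ge0.
apply: ler_pM => //.
  apply: ler_pM => //; first by rewrite ler_weXn2l.
  rewrite lef_pV2 ?posrE//.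
  by apply: ler_pM; rewrite ?exprn_ge0 ?(ltW q0) ?(ltW sk_gt0) ?ler_wiXn2l ?(ltW q0) ?(ltW sk_gt0).
by rewrite -[leRHS]expr1 ler_weXn2l.
Qed.

Let Z_ge0 : 0 <= Z.
Proof.
have h := @le_Z 0 0 0 0 isT isT isT isT.
by apply: le_trans h; rewrite !expr0 !mulr1 divr1 mul1r ltW.
Qed.

Let beta_le : beta <= 12 * C1 * Z.
Proof.
have -> : beta = 12 * (r ^+ 2 / (q ^+ 2 * sk ^+ 2)) * e.
  by rewrite /beta tauE; field; rewrite !gt_eqF.
have h := @le_Z 2 2 2 0 isT isT isT isT; rewrite expr0 mulr1 in h.
have Y0 : 0 <= r ^+ 2 / (q ^+ 2 * sk ^+ 2).
  by rewrite divr_ge0 ?mulr_ge0 ?exprn_ge0 ?(ltW r0) ?(ltW q0) ?(ltW sk_gt0).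
move: Y0 h; set Y := _ / _ => Y0 h.
have h1 := ler_wpM2l Y0 eC1; have h2 := ler_wpM2l C10 h.
by move: h1 h2; lra.
Qed.

Let r_kap : r * kap <= 8 * C2 * Z.
Proof.
have -> : r * kap = 8 * (r ^+ 4 / (q ^+ 3 * sk ^+ 3)) * eT.
  by rewrite /kap /c sqtE; field; rewrite !gt_eqF.
have h := @le_Z 4 3 3 0 isT isT isT isT; rewrite expr0 mulr1 in h.
have Y0 : 0 <= r ^+ 4 / (q ^+ 3 * sk ^+ 3).
  by rewrite divr_ge0 ?mulr_ge0 ?exprn_ge0 ?(ltW r0) ?(ltW q0) ?(ltW sk_gt0).
move: Y0 h; set Y := _ / _ => Y0 h.
have h1 := ler_wpM2l Y0 eTC2; have h2 := ler_wpM2l C20 h.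
by move: h1 h2; lra.
Qed.

Let r_rho : r * rho <= 6 * C1 * Z.
Proof.
have -> : r * rho = 6 * (r ^+ 2 / (q ^+ 1 * sk ^+ 1)) * e.
  by rewrite /rho sqtE; field; rewrite !gt_eqF.
have h := @le_Z 2 1 1 0 isT isT isT isT; rewrite expr0 mulr1 in h.
have Y0 : 0 <= r ^+ 2 / (q ^+ 1 * sk ^+ 1).
  by rewrite divr_ge0 ?mulr_ge0 ?exprn_ge0 ?(ltW r0) ?(ltW q0) ?(ltW sk_gt0).
move: Y0 h; set Y := _ / _ => Y0 h.
have h1 := ler_wpM2l Y0 eC1; have h2 := ler_wpM2l C10 h.
by move: h1 h2; lra.
Qed.

Let r_rho_le : r * rho <= 9 / 2.
Proof.
have h : e <= 3 / 4 * (q * sk / r) ^+ 2.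
  by rewrite exprMn exprVn exprMn q2 r2.
have -> : r * rho = 6 * (r ^+ 2 / (q * sk)) * e.
  by rewrite /rho sqtE; field; rewrite !gt_eqF.
apply: (@le_trans _ _ (6 * (r ^+ 2 / (q * sk)) * (3 / 4 * (q * sk / r) ^+ 2))).
  by rewrite ler_wpM2l// !mulr_ge0 ?invr_ge0 ?exprn_ge0 ?mulr_ge0 ?(ltW r0) ?(ltW q0) ?(ltW sk_gt0).
have -> : 6 * (r ^+ 2 / (q * sk)) * (3 / 4 * (q * sk / r) ^+ 2) = 9 / 2 * (q * sk).
  by field; rewrite !gt_eqF.
by rewrite ler_piMr ?divr_ge0// mulr_ile1 ?(ltW q0) ?(ltW sk_gt0).
Qed.

Let beta9 : beta <= 9.
Proof.
rewrite /beta ler_pdivrMr; last by rewrite divr_gt0.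
by move: e_sP; lra.
Qed.

(** The [eta] of the matching argument, [3 / (q r)] being the bound on [|lam_i|]: a weight at most
    [2 / (q r)] times [|M^T theta| <= 3/2]. *)
Let eta := 3 / 2 * (beta * (3 / (q * r)) + kap).
Let beta_ge0 : 0 <= beta.
Proof. by apply: divr_ge0; [exact: mulr_ge0|rewrite ltW// divr_gt0]. Qed.
Let c_gt0 : 0 < c. Proof. by rewrite invr_gt0 sqrtr_gt0 divr_gt0. Qed.
Let kap_ge0 : 0 <= kap. Proof. by rewrite mulr_ge0// exprn_ge0// ltW. Qed.
Let D_gt0 : 0 < D. Proof. by rewrite invr_gt0 mulr_gt0// mulr_gt0. Qed.

Let eta_D : 8 * eta / D <= (8640 * C1 + 1920 * C2) * 12 * Z.
Proof.
have -> : 8 * eta / D = 240 * K * (beta * 3 / q + r * kap).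
  by rewrite /eta /D; field; rewrite !gt_eqF.
have e1 : K * (r * kap) <= 8 * C2 * Z.
  have -> : K * (r * kap) = 8 * (r ^+ 4 / (q ^+ 3 * sk ^+ 3) * K) * eT.
    by rewrite /kap /c sqtE; field; rewrite !gt_eqF.
  have h := @le_Z 4 3 3 1 isT isT isT isT; rewrite expr1 in h.
  have Y0 : 0 <= r ^+ 4 / (q ^+ 3 * sk ^+ 3) * K.
    by rewrite mulr_ge0 ?(ltW K_gt0)// divr_ge0 ?mulr_ge0 ?exprn_ge0 ?(ltW r0) ?(ltW q0) ?(ltW sk_gt0).
  move: Y0 h; set Y := _ * K => Y0 h.
  have h1 := ler_wpM2l Y0 eTC2; have h2 := ler_wpM2l C20 h.
  by move: h1 h2; lra.
have e2 : K * (beta * 3 / q) <= 36 * C1 * Z.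
  have -> : K * (beta * 3 / q) = 36 * (r ^+ 2 / (q ^+ 3 * sk ^+ 2) * K) * e.
    by rewrite /beta tauE; field; rewrite !gt_eqF.
  have h := @le_Z 2 3 2 1 isT isT isT isT; rewrite expr1 in h.
  have Y0 : 0 <= r ^+ 2 / (q ^+ 3 * sk ^+ 2) * K.
    by rewrite mulr_ge0 ?(ltW K_gt0)// divr_ge0 ?mulr_ge0 ?exprn_ge0 ?(ltW r0) ?(ltW q0) ?(ltW sk_gt0).
  move: Y0 h; set Y := _ * K => Y0 h.
  have h1 := ler_wpM2l Y0 eC1; have h2 := ler_wpM2l C10 h.
  by move: h1 h2; lra.
have c1z := mulr_ge0 C10 Z_ge0; have c2z := mulr_ge0 C20 Z_ge0.
by move: e1 e2; rewrite -[240 * K * _]mulrA mulrDr; lra.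
Qed.

Let XE : X = Z / q.
Proof. by rewrite /Z; field; rewrite gt_eqF. Qed.
Let qV1 : 1 <= q^-1. Proof. by rewrite invf_ge1. Qed.
Let ZX : Z <= X. Proof. by rewrite XE ler_peMr. Qed.

(** The weight [om], at most [r^2], is split into one factor [r] for each bound; these cancel the
    [1 / r] in the bounds for [gam] and for [B]. *)
Let scaled_prod x y z w : 0 <= y -> 0 <= w -> r * y = x -> r * w = z -> om * y * w <= x * z.
Proof.
move=> y0 w0 <- <-.
have -> : r * y * (r * w) = r ^+ 2 * y * w by ring.
by rewrite !ler_wpM2r.
Qed.

(** Both [8 eta / D] and [8 beta] are at most [c4 Z]. Hence [1 <= c4 Z] as soon as one of the
    smallness conditions [8 eta <= D] and [beta <= 1/8] fails. *)
Let c4 := 12 * (8640 * C1 + 1920 * C2).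
Let c40 : 0 <= c4.
Proof.
exact: (mulr_ge0 (ler0n R 12)
  (addr_ge0 (mulr_ge0 (ler0n R 8640) C10) (mulr_ge0 (ler0n R 1920) C20))).
Qed.
Let rho_ge0 : 0 <= rho.
Proof. by apply: divr_ge0; [exact: mulr_ge0|exact: sqrtr_ge0]. Qed.
Let g_ge0 : 0 <= 2 / (q * r). Proof. by rewrite divr_ge0// mulr_ge0// ltW. Qed.

Let trivial_arith : 1 <= c4 * Z ->
  1 + om * (2 / (q * r) * 4 ^+ 3 + kap) * (4 * r^-1 + rho) <= rate_const C1 C2 * X.
Proof.
move=> c4Z.
have f1 : r * (2 / (q * r) * 4 ^+ 3 + kap) = 128 * q^-1 + r * kap.
  by field; rewrite !gt_eqF.
have f2 : r * (4 * r^-1 + rho) = 4 + r * rho by field; rewrite gt_eqF.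
have p1 : 0 <= 2 / (q * r) * 4 ^+ 3 + kap.
  by rewrite addr_ge0// mulr_ge0// exprn_ge0.
have p2 : 0 <= 4 * r^-1 + rho by rewrite addr_ge0// mulr_ge0// invr_ge0 ltW.
have h := scaled_prod p1 p2 f1 f2.
have rk0 : 0 <= r * kap by rewrite mulr_ge0// ltW.
have h2 : (128 * q^-1 + r * kap) * (4 + r * rho) <= (128 * q^-1 + r * kap) * (17 / 2).
  rewrite ler_wpM2l//; last by move: r_rho_le; lra.
  by rewrite addr_ge0// mulr_ge0// (le_trans ler01).
have h3 : q^-1 <= c4 * X.
  have := ler_wpM2r (le_trans ler01 qV1) c4Z; rewrite mul1r XE.
  by rewrite -mulrA.
have X0 : 0 <= X := le_trans Z_ge0 ZX.
have c1x := mulr_ge0 C10 X0; have c2x := mulr_ge0 C20 X0.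
have kx : r * kap <= 8 * (C2 * X).
  by apply: le_trans r_kap _; rewrite -mulrA ler_wpM2l// ler_wpM2l.
move: h h2 h3 kx qV1; rewrite /rate_const /c4.
set a := om * _ * _; set y := q^-1; set rk := r * kap; set b := _ * (4 + _).
by clearbody a y rk b; lra.
Qed.

Let main_arith nu : 0 <= nu <= 3 / 8 -> nu <= 3 / 8 * (c4 * Z) ->
  3 * (beta + nu ^+ 2) + 2 * om * (2 / (q * r)) * (nu * r^-1 + rho)
    + om * (2 * (2 / (q * r)) * nu ^+ 2 + kap) * (2 * r^-1 + rho) <= rate_const C1 C2 * X.
Proof.
move=> /andP[nu0 nu1] nuZ.
have X0 : 0 <= X := le_trans Z_ge0 ZX.
have nu2 : nu ^+ 2 <= nu by rewrite expr2 ler_piMl//; move: nu1; lra.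
have y0 : 0 <= q^-1 by rewrite invr_ge0 ltW.
have zx (x a : R) : 0 <= a -> x <= a * Z -> x <= a * X.
  by move=> a0' /le_trans; apply; rewrite ler_wpM2l.
have zxq (x a : R) : x <= a * Z -> q^-1 * x <= a * X.
  by move=> h; rewrite XE mulrCA [leRHS]mulrC -mulrA mulrCA; have := ler_wpM2l y0 h; lra.
have c1x := mulr_ge0 C10 X0; have c2x := mulr_ge0 C20 X0.
have bX := zx _ _ (mulr_ge0 (ler0n _ 12) C10) beta_le.
have kX := zx _ _ (mulr_ge0 (ler0n _ 8) C20) r_kap.
have nuZ' : nu <= (3 / 8 * c4) * Z by rewrite -mulrA.
have c40' : 0 <= 3 / 8 * c4 by apply: mulr_ge0 => //; rewrite divr_ge0.
have nX := zx _ _ c40' nuZ'.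
have nqX := zxq _ _ nuZ'.
have rqX := zxq _ _ r_rho.
have f1 : r * (2 / (q * r)) = 2 * q^-1 by field; rewrite !gt_eqF.
have f2 : r * (nu * r^-1 + rho) = nu + r * rho by field; rewrite gt_eqF.
have ri0 : 0 <= r^-1 by rewrite invr_ge0 ltW.
have h1 := scaled_prod g_ge0 (addr_ge0 (mulr_ge0 nu0 ri0) rho_ge0) f1 f2.
have f3 : r * (2 * (2 / (q * r)) * nu ^+ 2 + kap) = 4 * q^-1 * nu ^+ 2 + r * kap.
  by field; rewrite !gt_eqF.
have f4 : r * (2 * r^-1 + rho) = 2 + r * rho by field; rewrite gt_eqF.
have p3 : 0 <= 2 * (2 / (q * r)) * nu ^+ 2 + kap.
  by rewrite addr_ge0// mulr_ge0 ?sqr_ge0// mulr_ge0.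
have h2 := scaled_prod p3 (addr_ge0 (mulr_ge0 (ler0n _ 2) ri0) rho_ge0) f3 f4.
have rk0 : 0 <= r * kap by rewrite mulr_ge0// ltW.
have h3 : (4 * q^-1 * nu ^+ 2 + r * kap) * (2 + r * rho) <=
    (4 * (q^-1 * nu) + r * kap) * (13 / 2).
  apply: ler_pM.
  - by rewrite addr_ge0// mulr_ge0 ?sqr_ge0// mulr_ge0.
  - by rewrite addr_ge0// mulr_ge0// ltW.
  - by rewrite lerD2r -mulrA ler_wpM2l// ler_wpM2l.
  - by move: r_rho_le; lra.
have h4 : 2 * q^-1 * (nu + r * rho) = 2 * (q^-1 * nu) + 2 * (q^-1 * (r * rho)) by ring.
rewrite h4 in h1.
have -> : 2 * om * (2 / (q * r)) * (nu * r^-1 + rho) =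
  2 * (om * (2 / (q * r)) * (nu * r^-1 + rho)) by ring.
move: h1 h2 h3 nqX rqX kX bX nX nu2; rewrite /rate_const /c4.
set a1 := om * _ * _; set a2 := om * _ * _; set a3 := _ * (2 + r * rho).
set b1 := q^-1 * nu; set b2 := q^-1 * (r * rho); set b3 := r * kap; set n2 := nu ^+ 2.
by clearbody a1 a2 a3 b1 b2 b3 n2; lra.
Qed.

Variable theta : 'cV[R]_k.
Hypothesis theta1 : nF theta = 1.
Hypothesis theta_gap : forall i j b,
  gap_radius * nF (gap_vector i j b) <= `|dot (gap_vector i j b) theta|.

Let lam l := gam l * (M^T *m theta) l 0.

Let dot_gap i j b : dot (gap_vector i j b) theta = lam i + (-1) ^+ b * lam j.
Proof.
rewrite /gap_vector dotDl !dotZl /lam.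
have cM l : dot (col l M) theta = (M^T *m theta) l 0.
  by rewrite !mxE; apply: eq_bigr => a _; rewrite !mxE.
by rewrite !cM.
Qed.

(** The vector is [M x] with [|x|^2 = gam_i^2 + gam_j^2 >= 2 / r^2], and [M] shrinks squared norms
    by a factor of at least [7/8]; [nF_gram] passes from [M^T] to [M]. *)
Let gap_vector_ge i j b : i != j -> beta <= 8^-1 -> r^-1 <= nF (gap_vector i j b).
Proof.
move=> ij b8; have [_ Mb _] := whitened_spec.
pose x : 'cV[R]_k := gam i *: delta_mx i 0 + ((-1) ^+ b * gam j) *: delta_mx j 0.
have -> : gap_vector i j b = M *m x.
  by rewrite /gap_vector /x mulmxDr -!scalemxAr -!colE scalerA.
have MTb : nF (M^T *m M^T^T - 1%:M) <= beta by rewrite trmxK nF_gram.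
have := near_isometry x MTb; rewrite trmxK => nx.
have x2 : nF x ^+ 2 = gam i ^+ 2 + gam j ^+ 2.
  rewrite nF_sqrV /x !(dotDl, dotDr, dotZl, dotZr).
  have dd (l m : 'I_k) : dot (delta_mx l 0) (delta_mx m 0 : 'cV[R]_k) = (l == m)%:R.
    rewrite /dot (bigD1 l)//= big1 ?addr0; last first.
      by move=> a al; rewrite mxE (negPf al) mul0r.
    by rewrite !mxE !eqxx !andbT mul1r.
  rewrite !dd !eqxx (negPf ij) eq_sym (negPf ij) !mulr0 !mulr1 addr0 add0r.
  by case: (b); rewrite ?expr0 ?expr1; ring.
have rV0 : 0 <= r^-1 by rewrite invr_ge0 ltW.
have gi : r^-1 ^+ 2 <= gam i ^+ 2 by rewrite ler_pXn2r ?nnegrE// ltW.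
have gj : r^-1 ^+ 2 <= gam j ^+ 2 by rewrite ler_pXn2r ?nnegrE// ltW.
rewrite -(ler_pXn2r (ltn0Sn 1)) ?nnegrE ?nF_ge0//.
move: nx; rewrite ler_norml => /andP[h _].
have h1 := ler_wpM2r (sqr_ge0 (nF x)) b8.
have ri2 := sqr_ge0 r^-1.
by move: h h1; rewrite x2; lra.
Qed.

(** The difference of the absolute values of two numbers is, up to sign, either their sum or their
    difference. *)
Let lam_gap i j : j != i -> beta <= 8^-1 -> D <= `| `|lam i| - `|lam j| |.
Proof.
move=> ji b8.
have DE : D = gap_radius * r^-1 by rewrite /D /gap_radius -/K; field; rewrite !gt_eqF.
have gr0 : 0 <= gap_radius.
  by rewrite /gap_radius invr_ge0 mulr_ge0// ltW.
have h (b : bool) : D <= `|lam i + (-1) ^+ b * lam j|.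
  rewrite -dot_gap DE; apply: le_trans (theta_gap _ _ _).
  by rewrite ler_wpM2l// gap_vector_ge// eq_sym.
have hp := h false; have hm := h true.
rewrite expr0 mul1r in hp; rewrite expr1 mulN1r in hm.
have [li|li] := ger0P (lam i); have [lj|lj] := ger0P (lam j) => //.
- by rewrite opprK.
- by rewrite -opprD normrN.
- by rewrite opprK addrC distrC.
Qed.

Variables (U' V' : 'M[R]_k) (s' : 'rV[R]_k).
Hypotheses (UU' : U'^T *m U' = 1%:M) (VV' : V'^T *m V' = 1%:M)
  (s'_ge0 : forall i, 0 <= s' 0 i)
  (X'E : W^T *m T (W *m theta) *m W = U' *m diag_mx s' *m V'^T).

Theorem eca_recovery : exists sg : 'S_k, forall i,
  nF (col i O - (om * dot (W *m col (sg i) U') (T (W *m col (sg i) U') *m (W *m col (sg i) U')))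
    *: ((invmx (W^T *m W) *m W^T)^T *m col (sg i) U')) <=
  rate_const C1 C2 * ((a0 + 1) ^+ 2 * k%:R ^+ 3 * eps / (pm ^+ 2 * sk ^+ 3)).
Proof.
have -> : (a0 + 1) ^+ 2 * k%:R ^+ 3 * eps / (pm ^+ 2 * sk ^+ 3) = X.
  by rewrite /X -q2 -r2 -!exprM.
have [Wc Mb [rr rr_le ->]] := whitened_spec.
have colU1 j : nF (col j U') = 1 by rewrite colE (orth_nF _ UU') nF_delta.
(* The bound [beta <= 9], which holds in all cases, gives [1 + beta <= 4^2]. *)
have rec_le u : nF u = 1 -> nF (recovered B W rr T om u) <=
    om * (2 / (q * r) * 4 ^+ 3 + kap) * (4 * r^-1 + rho).
  move=> u1; apply: (recovered_le om0 gam_gt0 g_ge0 gam_le B_le Mb Wc rr_le eT0 TP) => //.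
  by move: beta9; lra.
(* Nothing is matched here: any permutation will do, as the two vectors are bounded separately. *)
have trivial_case : 1 <= c4 * Z -> exists sg : 'S_k, forall i,
    nF (col i O - recovered B W rr T om (col (sg i) U')) <= rate_const C1 C2 * X.
  move=> c4Z; exists 1%g => i; apply: le_trans (nFB _ _) _.
  apply: le_trans (trivial_arith c4Z); rewrite lerD//.
  exact: rec_le.
have [b8|b8] := lerP beta 8^-1; last first.
  apply: trivial_case; have := beta_le; move: b8; rewrite /c4.
  by have := mulr_ge0 C20 Z_ge0; have := mulr_ge0 C10 Z_ge0; lra.
have [eD|eD] := lerP (8 * eta) D; last first.
  apply: trivial_case; rewrite /c4 [12 * _]mulrC; apply: le_trans eta_D.
  by rewrite ler_pdivlMr// mul1r ltW.
(* Strictness comes from [eT], also when [beta = 0]. *)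
have eta0 : 0 < eta.
  apply: mulr_gt0; first by rewrite divr_gt0.
  rewrite ltr_wpDl//; last by rewrite mulr_gt0// exprn_gt0.
  by rewrite mulr_ge0// divr_ge0// mulr_ge0// ltW.
pose E := W^T *m T (W *m theta) *m W - M *m diag_mx (\row_l lam l) *m M^T.
have Ek : opb E kap.
  have := whitened_triples_error (ltW c_gt0) Wc eT0 TP theta.
  by rewrite theta1 mulr1.
have XE' : M *m diag_mx (\row_i lam i) *m M^T + E = U' *m diag_mx s' *m V'^T.
  by rewrite -X'E /E addrC subrK.
have ell0 : 0 <= 3 / (q * r) by rewrite divr_ge0// mulr_ge0// ltW.
have lam_le i : `|lam i| <= 3 / (q * r).
  have nM : nF (M^T *m theta) <= 3 / 2.
    rewrite -(ler_pXn2r (ltn0Sn 1)) ?nnegrE ?nF_ge0 ?divr_ge0//.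
    have := near_isometry theta Mb; rewrite theta1 expr1n mulr1 ler_norml => /andP[_].
    by move: b8; lra.
  have -> : 3 / (q * r) = 2 / (q * r) * (3 / 2) by field; rewrite !gt_eqF.
  rewrite /lam normrM (gtr0_norm (gam_gt0 i)) ler_pM ?(ltW (gam_gt0 i))//.
  by apply: le_trans nM; rewrite nF_cVl2; exact: (le_coord_l2 (fun l => (M^T *m theta) l 0)).
have [sg sgP] := singular_vectors_match UU' VV' s'_ge0 XE' Mb b8 ell0 lam_le Ek kap_ge0
  eta0 eD (fun i j ji => lam_gap ji b8).
exists sg => i.
(* [nu^2 = 9 eta^2 / D^2] exceeds the bound [8 eta^2 / D^2] of the matching without a square root of
   8. *)
pose nu := 3 * eta / D.
have nuE : nu = 3 / 8 * (8 * eta / D) by rewrite /nu; field; rewrite gt_eqF.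
have nu01 : 0 <= nu <= 3 / 8.
  apply/andP; split.
    by apply: divr_ge0; [apply: mulr_ge0|]; rewrite ?(ltW eta0) ?(ltW D_gt0).
  rewrite nuE -[leRHS]mulr1 ler_wpM2l ?divr_ge0// ler_pdivrMr// mul1r//.
have nuZ : nu <= 3 / 8 * (c4 * Z).
  by rewrite nuE ler_wpM2l ?divr_ge0// /c4 [12 * _]mulrC.
apply: le_trans (main_arith nu01 nuZ).
apply: (recovered_dist om0 OB O1 gam_gt0 g_ge0 gam_le B_le Mb Wc rr_le eT0 TP) => //.
  by move: nu01 => /andP[-> h]; apply: le_trans h _; lra.
apply: le_trans (sgP i) _; rewrite /nu expr_div_n ler_wpM2r ?invr_ge0 ?sqr_ge0//.
by rewrite -/eta (_ : (3 * eta) ^+ 2 = 9 * eta ^+ 2); [rewrite ler_wpM2r ?sqr_ge0// ler_nat|ring].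
Qed.

End Deterministic.

Local Open Scope classical_set_scope.
Local Open Scope ring_scope.

(** * Elementary probability *)

Section FiniteProbability.
Context {R : realType} {d : measure_display} {T : measurableType d}.
Variable P : probability T R.

Definition pr (A : set T) : R := fine (P A).

Lemma prE A : measurable A -> P A = (pr A)%:E.
Proof. by move=> mA; rewrite fineK// fin_num_measure. Qed.

Lemma pr_ge0 A : 0 <= pr A.
Proof. by rewrite fine_ge0. Qed.

Lemma pr_le A B : measurable A -> measurable B -> A `<=` B -> pr A <= pr B.
Proof. by move=> mA mB AB; rewrite -lee_fin -!prE// le_measure ?inE. Qed.

Lemma pr_setC A : measurable A -> pr (~` A) = 1 - pr A.
Proof.
move=> mA; apply: EFin_inj.
by rewrite -prE ?probability_setC ?EFinB -?prE//; exact: measurableC.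
Qed.

Lemma pr_bigcup (I : finType) (A : I -> set T) (C : set T) :
  measurable C -> (forall i, measurable (A i)) -> (forall x, C x -> exists i, A i x) ->
  pr C <= \sum_i pr (A i).
Proof.
move=> mC mA CA.
have mU (s : seq I) : measurable (\big[setU/set0]_(i <- s) A i).
  by apply: bigsetU_measurable.
apply: (@le_trans _ _ (pr (\big[setU/set0]_(i <- index_enum I) A i))).
  apply: pr_le => // x /CA[i Ai]; rewrite -bigcup_seq; exists i => //=.
  exact: mem_index_enum.
elim: (index_enum I) => [|i s ih]; first by rewrite !big_nil /pr measure0.
rewrite !big_cons; apply: le_trans (lerD (lexx _) ih).
rewrite -lee_fin EFinD -!prE//; last exact: measurableU.
exact: measureU2.
Qed.

(** The sum of the probabilities is the integral, over the set [S] of full measure, of the number of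
    sets containing the point. *)
Lemma sum_pr_le (I : finType) (A : I -> set T) (S : set T) (b : R) :
  measurable S -> P S = 1%E -> (forall i, measurable (A i)) ->
  (forall x, S x -> \sum_i (x \in A i)%:R <= b) -> \sum_i pr (A i) <= b.
Proof.
move=> mS PS mA SA.
have PAS i : P (A i) = P (A i `&` S).
  apply/eqP; rewrite eq_le; apply/andP; split; last first.
    by rewrite le_measure ?inE//; exact: measurableI.
  have mSC := measurableC mS.
  have : (P (~` S) = 0)%E by rewrite probability_setC// PS subee.
  move=> PSC; apply: (@le_trans _ _ (P ((A i `&` S) `|` ~` S))).
    apply: le_measure; rewrite ?inE//.
      by apply: measurableU => //; exact: measurableI.
    by move=> x Ax; have [Sx|Sx] := pselect (S x); [left|right].
  have h : (P ((A i `&` S) `|` ~` S) <= P (A i `&` S) + P (~` S))%E.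
    by apply: measureU2 => //; exact: measurableI.
  by rewrite PSC adde0 in h.
have PAi i : P (A i) = (\int[P]_(x in S) (\1_(A i) x)%:E)%E.
  by rewrite integral_indic.
rewrite -lee_fin -sumEFin.
under eq_bigr do rewrite -prE// PAi.
have mI i : measurable_fun S (EFin \o (\1_(A i) : T -> R)).
  by apply/measurable_EFinP; exact: measurable_indic.
have I0 i x : S x -> (0 <= (\1_(A i) x)%:E :> \bar R)%E by rewrite lee_fin.
rewrite -(ge0_integral_sum P mS mI I0).
apply: (@le_trans _ _ (\int[P]_(x in S) (cst b%:E x))%E); last first.
  by rewrite integral_cst// [X in (_ * X)%E](_ : _ = 1%E) ?mule1.
apply: ge0_le_integral => //.
- by move=> x Sx; apply: sume_ge0 => i _; rewrite lee_fin.
- exact: emeasurable_sum.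
- by move=> x Sx; rewrite sumEFin lee_fin; under eq_bigr do rewrite indicE; exact: SA.
Qed.

End FiniteProbability.

(** * Arithmetic progressions in a strip *)

Section Counting.
Context {R : realType}.

Lemma count_lt_line m (x L : R) : 0 < x -> 0 <= L ->
  \sum_(b < m) (b%:R * x < L)%R%:R <= L / x + 1.
Proof.
move=> x0 L0; elim: m => [|m ih].
  by rewrite big_ord0 addr_ge0// divr_ge0// ltW.
rewrite big_ord_recr/=; case: ltP => h; last by rewrite addr0.
have : \sum_(b < m) (b%:R * x < L)%R%:R <= m%:R :> R.
  apply: (@le_trans _ _ (\sum_(b < m) 1)); last by rewrite sumr_const card_ord.
  by apply: ler_sum => b _; rewrite lern1 leq_b1.
have : m%:R <= L / x by rewrite ler_pdivlMr// ltW.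
by rewrite mulr1n; lra.
Qed.

(** Terms preceding the first one in the strip are discarded by shifting [y]. Once [|y| < s], a term
    in the strip satisfies [b x < 2 s]. *)
Lemma count_in_strip_pos m (x y s : R) : 0 < x -> 0 <= s ->
  \sum_(b < m) (`|b%:R * x + y| < s)%R%:R <= 2 * s / x + 1.
Proof.
move=> x0 s0; elim: m y => [|m ih] y.
  by rewrite big_ord0 addr_ge0// divr_ge0 ?mulr_ge0// ltW.
have [ys|ys] := ltP `|y| s.
  have s20 : 0 <= 2 * s by rewrite mulr_ge0.
  apply: le_trans (count_lt_line m.+1 x0 s20); apply: ler_sum => b _.
  rewrite ler_nat; case: ltP => //= h; rewrite lt0b.
  by move: h ys; rewrite !ltr_norml; lra.
rewrite big_ord_recl/= mul0r add0r ltNge ys add0r; apply: le_trans (ih (x + y)).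
apply: ler_sum => b _; by rewrite /bump/= add1n -natr1 mulrDl mul1r addrA.
Qed.

Lemma count_in_strip m (x y s : R) : x != 0 -> 0 <= s ->
  \sum_(b < m) (`|b%:R * x + y| < s)%R%:R <= 2 * s / `|x| + 1.
Proof.
move=> x0 s0; have [xp|xn] := ltP 0 x.
  by rewrite gtr0_norm//; exact: count_in_strip_pos.
have xn' : 0 < - x by rewrite oppr_gt0 lt_def eq_sym x0.
rewrite ler0_norm//; apply: le_trans (count_in_strip_pos m (- y) xn' s0).
apply: ler_sum => b _; rewrite ler_nat.
by rewrite -normrN opprD mulrN.
Qed.

End Counting.

(** * Anti-concentration on the sphere *)

Section GridCount.
Context {R : realType}.
Variables (k m : nat) (i : 'I_k).

Definition ffun_update (g : {ffun 'I_k -> 'I_m}) (b : 'I_m) : {ffun 'I_k -> 'I_m} :=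
  [ffun j => if j == i then b else g j].

(** Resampling one coordinate preserves the uniform law: exchanging [g i] with [b] is an involution
    of the pairs [(g, b)]. *)
Lemma sum_ffun_update (F : {ffun 'I_k -> 'I_m} -> R) :
  \sum_g \sum_b F (ffun_update g b) = m%:R * \sum_g F g.
Proof.
rewrite (pair_big xpredT xpredT (fun g b => F (ffun_update g b)))/=.
pose f (p : {ffun 'I_k -> 'I_m} * 'I_m) := (ffun_update p.1 p.2, p.1 i).
have fK : involutive f.
  move=> [g b]; rewrite /f /=; congr (_, _); last by rewrite ffunE eqxx.
  by apply/ffunP => j; rewrite !ffunE; case: eqP => [->|].
rewrite (reindex_inj (inv_inj fK))/=.
under eq_bigr => p _.
  rewrite (_ : ffun_update _ _ = p.1); last first.
    by apply/ffunP => j; rewrite !ffunE; case: eqP => [->|].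
  over.
rewrite -(pair_big xpredT xpredT (fun g (b : 'I_m) => F g))/=.
under eq_bigr do rewrite sumr_const card_ord -mulr_natl.
by rewrite mulr_sumr.
Qed.

(** When all coordinates of [g] but the [i]-th are fixed, the products with [th] form an arithmetic
    progression of step [th i]. *)
Lemma grid_count (th : 'I_k -> R) (s : R) : th i != 0 -> 0 <= s ->
  m%:R * \sum_(g : {ffun 'I_k -> 'I_m}) (`|\sum_j (g j).+1%:R * th j| < s)%R%:R
    <= (m ^ k)%:R * (2 * s / `|th i| + 1).
Proof.
move=> thi s0.
rewrite -(sum_ffun_update (fun g => (`|\sum_j (g j).+1%:R * th j| < s)%R%:R)).
apply: (@le_trans _ _ (\sum_(g : {ffun 'I_k -> 'I_m}) (2 * s / `|th i| + 1))); last first.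
  by rewrite sumr_const card_ffun !card_ord -[leLHS]mulr_natl.
apply: ler_sum => g _; set y := \sum_(j | j != i) (g j).+1%:R * th j.
apply: le_trans (count_in_strip m (th i + y) thi s0).
apply: ler_sum => b _; rewrite (bigD1 i)//= ffunE eqxx -natr1 mulrDl mul1r -addrA.
rewrite (eq_bigr (fun j => (g j).+1%:R * th j))// => j ji.
by rewrite ffunE (negPf ji).
Qed.

End GridCount.

Section Sphere.
Context {R : realType} {k : nat}.
Variable Q : probability (k.-tuple R) R.
Hypothesis Q_unif : uniform_sphere Q.

Definition strip (w : 'cV[R]_k) (c : R) : set (k.-tuple R) :=
  [set t | `|dotv w (col_of_tuple t)| < c].

Lemma measurable_dotv (w : 'cV[R]_k) :
  measurable_fun setT (fun t : k.-tuple R => dotv w (col_of_tuple t)).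
Proof.
apply: measurable_sum => i; apply: measurable_funM => //.
by under eq_fun do rewrite mxE; exact: measurable_tnth.
Qed.

Lemma measurable_strip w c : measurable (strip w c).
Proof.
have mf : measurable_fun setT (fun t : k.-tuple R => `|dotv w (col_of_tuple t)|).
  exact: measurableT_comp (measurable_dotv w).
have := mf measurableT `]-oo, c[%classic (measurable_itv _).
by rewrite setTI; congr measurable; apply/seteqP; split=> t /=; rewrite in_itv.
Qed.

Definition sphere : set (k.-tuple R) := [set t | norm2 (col_of_tuple t) = 1].

Lemma measurable_sphere : measurable sphere.
Proof.
have mf : measurable_fun setT
    (fun t : k.-tuple R => dotv (col_of_tuple t) (col_of_tuple t)).
  apply: measurable_sum => i.
  by apply: measurable_funM; under eq_fun do rewrite mxE; exact: measurable_tnth.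
have := mf measurableT [set 1] (measurable_set1 _).
rewrite setTI; congr measurable; apply/seteqP; split=> t /=.
  by rewrite /sphere/= /norm2 => ->; rewrite sqrtr1.
rewrite /sphere/= /norm2 => h; rewrite -[RHS](expr1n _ 2) -h sqr_sqrtr//.
by apply: sumr_ge0 => i _; rewrite -expr2 sqr_ge0.
Qed.

(* The Householder reflection exchanging w and w'. *)
Lemma ex_reflection (w w' : 'cV[R]_k) : nF w = nF w' ->
  exists2 M : 'M[R]_k, M^T *m M = 1%:M & M^T *m w' = w.
Proof.
move=> ww'; have [->|ne] := eqVneq w w'.
  by exists 1%:M; rewrite trmx1 mul1mx.
pose v := w - w'; pose n := dot v v.
have n0 : n != 0.
  rewrite /n -nF_sqrV sqrf_eq0; apply: contra_neq ne => /nF_eq0 /eqP.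
  by rewrite subr_eq0 => /eqP.
pose M : 'M[R]_k := 1%:M - (2 / n) *: (v *m v^T).
have MT : M^T = M by rewrite /M linearB/= linearZ/= trmx1 trmx_mul trmxK.
exists M; rewrite MT.
  rewrite /M mulmxBl mul1mx mulmxBr mulmx1 -scalemxAl -scalemxAr scalerA.
  rewrite -mulmxA (mulmxA v^T) dot_mx mul_scalar_mx -scalemxAr scalerA -/n.
  have -> : 2 / n * (2 / n) * n = 2 / n + 2 / n by field.
  by rewrite scalerDl opprB addrK subrK.
rewrite /M mulmxBl mul1mx -scalemxAl -mulmxA dot_mx mul_mx_scalar scalerA.
have -> : 2 / n * dot v w' = -1.
  have h : dot w w = dot w' w' by rewrite -!nF_sqrV ww'.
  have nE : n = - 2 * dot v w'.
    by rewrite /n /v !(dotDl, dotDr, dotNl, dotNr) h (dotC w' w); ring.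
  by move: n0; rewrite nE => n0; field; move: n0; rewrite mulf_eq0 negb_or => /andP[].
by rewrite scaleN1r opprK /v addrC subrK.
Qed.

Lemma pr_strip_rot w w' c : nF w = nF w' -> pr Q (strip w c) = pr Q (strip w' c).
Proof.
move=> /ex_reflection [M MM Mw]; rewrite /pr; congr fine.
rewrite -(Q_unif.2 M _ MM (measurable_strip w' c)); congr (Q _).
have colK u : col_of_tuple (tuple_of_col u) = u :> 'cV[R]_k.
  by apply/matrixP => i j; rewrite ord1 !mxE tnth_mktuple.
have e t : dotv w' (M *m col_of_tuple t) = dotv w (col_of_tuple t).
  by rewrite -Mw [RHS]dot_mulmxl trmxK.
by apply/seteqP; split=> t; rewrite /strip/= colK e.
Qed.

(* By rotation invariance, the strips about the vectors of {1, ..., m}^k have the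
   same measure as the given one.  A unit vector has a coordinate of absolute
   value at least 1 / sqrt k, and is thus in at most a fraction 2 k t + 1 / m of
   them. *)
Lemma pr_strip_le w t : 0 <= t -> pr Q (strip w (t * nF w)) <= 2 * k%:R * t.
Proof.
move=> t0.
(* For [k = 0] the sphere is empty and cannot carry [Q]. *)
have k0 : (0 < k)%N.
  rewrite lt0n; apply: contraTneq isT => kE.
  have : sphere = set0.
    apply/seteqP; split=> // x; rewrite /sphere/= /norm2 /dotv big1 ?sqrtr0.
      by move=> /esym/eqP; rewrite oner_eq0.
    by move=> i; have := ltn_ord i; rewrite {2}kE.
  by move=> s0; have := Q_unif.1; rewrite -/sphere s0 measure0 => /eqP; rewrite eq_sym onee_eq0.
have [w0|w0] := eqVneq (nF w) 0.
  rewrite w0 mulr0 (_ : strip w 0 = set0) ?/pr ?measure0/= ?mulr_ge0//.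
  by apply/seteqP; split=> // x; rewrite /strip/= normr_lt0.
have wp : 0 < nF w by rewrite lt_def w0/=.
set q := pr _ _.
have sk0 : 0 < Num.sqrt (k%:R : R) by rewrite sqrtr_gt0 ltr0n.
have bound m : q * m.+1%:R <= 2 * k%:R * t * m.+1%:R + 1.
  set M := m.+1; have M0 : 0 < M%:R :> R by rewrite ltr0n.
  (* Entries start at 1, so that no grid vector vanishes and each can be scaled to the norm of
     [w]. *)
  pose u (g : {ffun 'I_k -> 'I_M}) : 'cV[R]_k := \col_j (g j).+1%:R.
  have u_le g : nF (u g) <= M%:R * Num.sqrt k%:R.
    rewrite -(ler_pXn2r (ltn0Sn 1)) ?nnegrE ?nF_ge0 ?mulr_ge0 ?(ltW sk0)//.
    rewrite exprMn (sqr_sqrtr (ler0n R k)) nF_cVl2 l2_sqr.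
    have -> : M%:R ^+ 2 * k%:R = \sum_(j < k) M%:R ^+ 2 :> R.
      by rewrite sumr_const card_ord mulr_natr.
    apply: ler_sum => j _; rewrite mxE ler_pXn2r ?nnegrE// ler_nat.
    exact: ltn_ord.
  have u_gt g : 0 < nF (u g).
    rewrite lt_def nF_ge0 andbT; apply/eqP => /nF_eq0 /matrixP /(_ (Ordinal k0) 0).
    by rewrite !mxE => /eqP; rewrite pnatr_eq0.
  pose A g := strip (u g) (t * nF (u g)).
  have AE g : pr Q (A g) = q.
    pose a := nF w / nF (u g).
    have a0 : 0 < a by rewrite divr_gt0.
    rewrite /A (_ : strip _ _ = strip (a *: u g) (a * (t * nF (u g)))); last first.
      apply/seteqP; split=> x; rewrite /strip/= [dotv (a *: _) _]dotZl normrM (gtr0_norm a0);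
        by rewrite ltr_pM2l.
    have aw : nF (a *: u g) = nF w.
      by rewrite nFZ (gtr0_norm a0) /a divfK ?gt_eqF.
    rewrite (pr_strip_rot _ aw) /q; congr (pr Q (strip _ _)).
    by rewrite mulrCA /a divfK ?gt_eqF.
  have : \sum_g pr Q (A g) <= (M ^ k)%:R / M%:R * (2 * (t * (M%:R * Num.sqrt k%:R)) * Num.sqrt k%:R + 1).
    apply: (sum_pr_le measurable_sphere Q_unif.1) => [g|x].
      exact: measurable_strip.
    rewrite /sphere/= => xn; set th := col_of_tuple x in xn.
    have [i thi] : exists i, (Num.sqrt k%:R)^-1 <= `|th i 0|.
      have [/existsP//|] := boolP [exists i, (Num.sqrt k%:R)^-1 <= `|th i 0|].
      rewrite negb_exists => /forallP h; exfalso.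
      have : \sum_i th i 0 ^+ 2 < \sum_(i < k) (k%:R^-1 : R).
        apply: ltr_sum => [|i _]; first by apply/hasP; exists (Ordinal k0) => //; rewrite mem_index_enum.
        have := h i; rewrite -ltNge => hi.
        have -> : k%:R^-1 = (Num.sqrt k%:R : R)^-1 ^+ 2 by rewrite exprVn sqr_sqrtr.
        by rewrite -(real_normK (num_real (th i 0))) ltr_pXn2r ?nnegrE ?invr_ge0 ?sqrtr_ge0.
      rewrite sumr_const card_ord -[X in _ < X]mulr_natl divff ?pnatr_eq0 -?lt0n//.
      have -> : \sum_i th i 0 ^+ 2 = nF th ^+ 2 by rewrite nF_cVl2 l2_sqr.
      have -> : nF th = 1 by rewrite nF_cV.
      by rewrite expr1n ltxx.
    have thi0 : 0 < `|th i 0| by rewrite (lt_le_trans _ thi)// invr_gt0.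
    rewrite mulrAC ler_pdivlMr// mulrC.
    have s0 : 0 <= t * (M%:R * Num.sqrt k%:R) by rewrite mulr_ge0// mulr_ge0// ltW.
    have thn : th i 0 != 0 by rewrite -normr_gt0.
    apply: (@le_trans _ _ ((M ^ k)%:R * (2 * (t * (M%:R * Num.sqrt k%:R)) / `|th i 0| + 1))); last first.
      rewrite ler_wpM2l// lerD2r ler_wpM2l ?mulr_ge0//.
      by rewrite -[leRHS]invrK lef_pV2 ?posrE ?invr_gt0.
    apply: le_trans (grid_count M (th := fun j => th j 0) thn s0).
    rewrite ler_wpM2l//; apply: ler_sum => g _; rewrite ler_nat.
    have -> : \sum_j (g j).+1%:R * th j 0 = dotv (u g) th.
      by apply: eq_bigr => j _; rewrite [u g j 0]mxE.
    case: (boolP (x \in A g)) => //; rewrite inE /A /strip/= => h.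
    by rewrite lt0b (lt_le_trans h)// ler_wpM2l.
  under eq_bigr do rewrite AE.
  rewrite sumr_const card_ffun !card_ord -[X in X <= _ -> _]mulr_natl.
  have Mk0 : 0 < (M ^ k)%:R :> R by rewrite ltr0n expn_gt0.
  set Y := 2 * _ * _ + 1 => hq.
  have {}hq : (M ^ k)%:R * q <= (M ^ k)%:R * (Y / M%:R) by rewrite [leRHS]mulrA [leRHS]mulrAC.
  rewrite (ler_pM2l Mk0) ler_pdivlMr// in hq; apply: le_trans hq _.
  have -> : Y = 2 * (t * M%:R) * Num.sqrt k%:R ^+ 2 + 1 by rewrite /Y; ring.
  rewrite (sqr_sqrtr (ler0n R k)).
  by rewrite le_eqVlt; apply/orP; left; apply/eqP; ring.
(* The additive error in [bound] does not grow with the grid, so dividing by its size removes it in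
   the limit. *)
rewrite leNgt; apply/negP => h.
set D := q - 2 * k%:R * t.
have D0 : 0 < D by rewrite subr_gt0.
have := archi_boundP (ltW (divr_gt0 ltr01 D0 : 0 < 1 / D)).
set m := Num.bound _; rewrite ltr_pdivrMr// => h2.
have := bound m; rewrite -natr1 => h3.
have : D * (m%:R + 1) <= 1 by rewrite /D; lra.
by move: D0 h2; clearbody D; lra.
Qed.

(** Union bound over the strips and the complement of the sphere. Strips are defined by a strict
    inequality, so a zero vector [w a] has an empty strip. *)
Lemma pr_all_gaps (I : finType) (w : I -> 'cV[R]_k) t : 0 <= t ->
  exists E : set (k.-tuple R), [/\ measurable E,
    1 - #|I|%:R * (2 * k%:R * t) <= pr Q E &
    forall x, E x -> norm2 (col_of_tuple x) = 1 /\
      forall a, t * nF (w a) <= `|dotv (w a) (col_of_tuple x)|].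
Proof.
move=> t0; pose B a := strip (w a) (t * nF (w a)).
pose U := ~` sphere `|` \big[setU/set0]_(a <- index_enum I) B a.
have mB : measurable (\big[setU/set0]_(a <- index_enum I) B a).
  by apply: bigsetU_measurable => a _; exact: measurable_strip.
have mU : measurable U.
  by apply: measurableU => //; apply: measurableC; exact: measurable_sphere.
exists (~` U); split; first exact: measurableC.
  rewrite pr_setC// lerD2l lerN2.
  pose B' (o : unit + I) := if o is inr a then B a else ~` sphere.
  apply: (@le_trans _ _ (\sum_o pr Q (B' o))).
    apply: pr_bigcup => // [[u|a]|x].
    - by apply: measurableC; exact: measurable_sphere.
    - exact: measurable_strip.
    - move=> [nx|]; first by exists (inl tt).
      by rewrite -bigcup_seq => -[a _ Ba]; exists (inr a).
  rewrite big_sumType/= big_const card_unit/= addr0.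
  rewrite pr_setC; last exact: measurable_sphere.
  rewrite {1}/pr Q_unif.1/= subrr add0r.
  apply: (@le_trans _ _ (\sum_(a : I) (2 * k%:R * t))).
    by apply: ler_sum => a _; exact: pr_strip_le.
  by rewrite sumr_const -[leLHS]mulr_natl.
move=> x /not_orP[/contrapT sx nB]; split=> // a.
rewrite leNgt; apply/negP => h; apply: nB; rewrite -bigcup_seq; exists a => //=.
exact: mem_index_enum.
Qed.

End Sphere.

(** * Moment generating functions *)

Section Exponential.
Context {R : realType}.

(** The tangent at the mean [m] lies below the graph; its values at [a] and [b] average to
    [expR m]. *)
Lemma expR_convex (t a b : R) : 0 <= t <= 1 ->
  expR ((1 - t) * a + t * b) <= (1 - t) * expR a + t * expR b.
Proof.
move=> /andP[t0 t1]; set m := _ + t * b.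
have tangent x : expR m * (1 + (x - m)) <= expR x.
  have -> : expR x = expR m * expR (x - m) by rewrite -expRD addrC subrK.
  by rewrite ler_wpM2l ?expR_ge0// expR_ge1Dx.
have ha := ler_wpM2l (_ : 0 <= 1 - t) (tangent a).
have hb := ler_wpM2l t0 (tangent b).
rewrite subr_ge0 in ha; have {}ha := ha t1.
apply: le_trans (lerD ha hb); rewrite /m.
by rewrite le_eqVlt; apply/orP; left; apply/eqP; ring.
Qed.

Lemma fact_double_ge n : (2 ^ n * n`! <= (n.*2)`!)%N.
Proof.
elim: n => // n ih; rewrite doubleS !factS expnS mulnACA leq_mul//.
  by rewrite mul2n doubleS.
by rewrite (leq_trans ih)// leq_pmull.
Qed.

(* Termwise: w^(2n)/(2n)! <= (w^2/2)^n/n!. *)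
Lemma cosh_le (w : R) : expR w + expR (- w) <= 2 * expR (w ^+ 2 / 2).
Proof.
pose s k := series (exp_coeff w) k + series (exp_coeff (- w)) k.
pose c := series (exp_coeff (w ^+ 2 / 2)).
have sS k : s k.+1 = s k + (exp_coeff w k + exp_coeff (- w) k).
  by rewrite /s !seriesSr addrACA.
have even_le n : exp_coeff w n.*2 + exp_coeff (- w) n.*2 <= 2 * exp_coeff (w ^+ 2 / 2) n.
  rewrite /exp_coeff/= exprNn -signr_odd odd_double expr0 mul1r -mul2n.
  rewrite exprM -mulr2n -[leLHS]mulr_natl ler_wpM2l// expr_div_n -mulrA.
  apply: ler_wpM2l; first by apply: exprn_ge0; exact: sqr_ge0.
  rewrite -invfM lef_pV2 ?posrE ?mulr_gt0 ?exprn_gt0 ?ltr0n ?fact_gt0//.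
  by rewrite -natrX -natrM ler_nat mul2n fact_double_ge.
have odd_eq n : exp_coeff w n.*2.+1 + exp_coeff (- w) n.*2.+1 = 0.
  by rewrite /exp_coeff/= exprNn -signr_odd/= odd_double expr1 mulN1r mulNr subrr.
have s_even n : s n.*2 <= 2 * c n.
  elim: n => [|n ih]; first by rewrite /s /c !seriesEnat/= !big_geq// addr0 mulr0.
  rewrite doubleS sS odd_eq addr0 sS /c seriesSr mulrDr lerD//.
have c_mono : nondecreasing_seq c.
  apply/nondecreasing_seqP => i.
  by rewrite /c seriesSr lerDl exp_coeff_ge0// divr_ge0// sqr_ge0.
have c_le n : c n <= expR (w ^+ 2 / 2).
  by apply: nondecreasing_cvgn_le => //; exact: is_cvg_series_exp_coeff.
have s_le k : s k <= 2 * expR (w ^+ 2 / 2).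
  rewrite -(odd_double_half k); case: (odd k); rewrite ?add0n ?add1n.
    rewrite sS; apply: le_trans (_ : 2 * c (k./2).+1 <= _); last by rewrite ler_wpM2l.
    by rewrite /c seriesSr mulrDr lerD.
  by apply: le_trans (s_even _) _; rewrite ler_wpM2l.
have cw := @is_cvg_series_exp_coeff R w; have cnw := @is_cvg_series_exp_coeff R (- w).
rewrite -(limD cw cnw); apply: limr_le; first exact: is_cvgD.
by apply: nearW => k; exact: s_le.
Qed.

End Exponential.

(** * Hoeffding's lemma for a finite law *)

Section Hoeffding.
Context {R : realType} {S : finType}.
Variable p : S -> R.
Hypotheses (p0 : forall s, 0 <= p s) (p1 : \sum_s p s = 1).

(* Convexity reduces to two values; there, Jensen for exp(- th u) and
   th (1 - th) <= 1/4 leave (cosh (u / 2))^2. *)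
Lemma two_point_mgf (th u : R) : 0 <= th <= 1 ->
  1 - th + th * expR u <= expR (th * u) * expR (u ^+ 2 / 4).
Proof.
move=> /andP[th0 th1].
have e1 : expR (- (th * u)) <= 1 - th + th * expR (- u).
  have := @expR_convex R th 0 (- u); rewrite th0 th1 => /(_ isT).
  by rewrite mulr0 add0r mulrN expR0 mulr1.
have pp : 0 <= 1 - th + th * expR u.
  by rewrite addr_ge0 ?subr_ge0// mulr_ge0// expR_ge0.
rewrite -ler_pdivrMl ?expR_gt0// -expRN mulrC.
apply: le_trans (ler_wpM2l pp e1) _.
have eu : expR u * expR (- u) = 1 by rewrite expRxMexpNx_1.
have c2 : expR (u / 2) + expR (- (u / 2)) <= 2 * expR (u ^+ 2 / 8).
  by apply: le_trans (cosh_le _) _; rewrite (_ : (u / 2) ^+ 2 / 2 = u ^+ 2 / 8)//; field.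
have sq : (expR (u / 2) + expR (- (u / 2))) ^+ 2 <= 4 * expR (u ^+ 2 / 4).
  have -> : 4 * expR (u ^+ 2 / 4) = (2 * expR (u ^+ 2 / 8)) ^+ 2.
    rewrite exprMn -expRM_natl (_ : 2 ^+ 2 = 4); last by ring.
    by congr (_ * expR _); field.
  by rewrite ler_pXn2r ?nnegrE ?addr_ge0 ?mulr_ge0 ?expR_ge0.
have e2 : (expR (u / 2) + expR (- (u / 2))) ^+ 2 = expR u + expR (- u) + 2.
  rewrite sqrrD -!expRM_natl expRxMexpNx_1.
  rewrite (_ : 2 * (u / 2) = u); last by lra.
  by rewrite (_ : 2 * - (u / 2) = - u); [ring|lra].
have h4 : th * (1 - th) <= 4^-1 by have := sqr_ge0 (th - 2^-1); lra.
have p2 : 0 <= expR u + expR (- u) - 2.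
  have h := expR_gt0 u; rewrite -(pmulr_rge0 _ h) mulrBr mulrDr eu.
  by rewrite (_ : _ - _ = (expR u - 1) ^+ 2); [exact: sqr_ge0|ring].
have -> : (1 - th + th * expR u) * (1 - th + th * expR (- u)) =
    1 + th * (1 - th) * (expR u + expR (- u) - 2).
  have -> : (1 - th + th * expR u) * (1 - th + th * expR (- u)) =
    (1 - th) ^+ 2 + th * (1 - th) * (expR u + expR (- u)) + th ^+ 2 * (expR u * expR (- u)) by ring.
  by rewrite eu; ring.
by have := ler_wpM2r p2 h4; move: sq; rewrite e2; lra.
Qed.

(** Each value is a convex combination of [a] and [a + c], which reduces to a two-point law with
    weight [thb]. The exponent has [c^2 / 4] instead of the optimal [c^2 / 8]; for [c = sqrt 2] it
    amounts to [lam^2 / 2] per step. *)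
Lemma hoeffding_mgf (x : S -> R) (c lam : R) : 0 < c ->
  (forall s s', x s - x s' <= c) ->
  \sum_s p s * expR (lam * x s) <=
    expR (lam * (\sum_s p s * x s) + lam ^+ 2 * c ^+ 2 / 4).
Proof.
move=> c0 xc.
have [s0 _] : exists s0 : S, true.
  apply/existsP; rewrite -[X in is_true X]negbK negb_exists; apply/negP => /forallP n.
  by move: p1; rewrite big1 => [/eqP|s]; [rewrite eq_sym oner_eq0|have := n s].
pose m0 := [arg min_(s < s0) x s]%O.
have m0P s : x m0 <= x s by rewrite /m0; case: arg_minP => // i _; exact.
set a := x m0 in m0P.
pose th s := (x s - a) / c.
have th01 s : 0 <= th s <= 1.
  apply/andP; split; first by rewrite divr_ge0 ?subr_ge0// ltW.
  by rewrite ler_pdivrMr// mul1r xc.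
pose thb := \sum_s p s * th s.
have thb01 : 0 <= thb <= 1.
  apply/andP; split; first by apply: sumr_ge0 => s _; rewrite mulr_ge0//; case/andP: (th01 s).
  rewrite -p1; apply: ler_sum => s _; rewrite -[leRHS]mulr1 ler_wpM2l//.
  by case/andP: (th01 s).
have xE s : x s = a + th s * c by rewrite /th divfK ?gt_eqF//; ring.
have mean : \sum_s p s * x s = a + thb * c.
  under eq_bigr do rewrite xE mulrDr mulrA.
  by rewrite big_split/= -!mulr_suml p1 mul1r.
have step : \sum_s p s * expR (lam * x s) <= expR (lam * a) * (1 - thb + thb * expR (lam * c)).
  have -> : expR (lam * a) * (1 - thb + thb * expR (lam * c)) =
      \sum_s p s * ((1 - th s) * expR (lam * a) + th s * expR (lam * (a + c))).
    have -> : \sum_s p s * ((1 - th s) * expR (lam * a) + th s * expR (lam * (a + c))) =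
        \sum_s (expR (lam * a) * p s + (expR (lam * (a + c)) - expR (lam * a)) * (p s * th s)).
      by apply: eq_bigr => s _; ring.
    by rewrite big_split/= -!mulr_sumr p1 -/thb (mulrDr lam a c) expRD; ring.
  apply: ler_sum => s _; rewrite ler_wpM2l//.
  apply: le_trans (expR_convex _ _ (th01 s)); rewrite ler_expR xE.
  by rewrite le_eqVlt; apply/orP; left; apply/eqP; ring.
apply: le_trans step _; rewrite mean (mulrDr lam) -(addrA (lam * a)) expRD ler_wpM2l ?expR_ge0//.
apply: le_trans (two_point_mgf (lam * c) thb01) _.
by rewrite -expRD ler_expR exprMn le_eqVlt; apply/orP; left; apply/eqP; ring.
Qed.

End Hoeffding.

(** * Concentration of empirical frequencies *)

Section RandomWalk.
Context {R : realType} {S J : finType}.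
Variables (p : S -> R) (Y : S -> J -> R).

(* walk n F u is the expectation of F (u + Y_1 + ... + Y_n) for independent
   steps with law p. *)
Fixpoint walk n (F : (J -> R) -> R) (u : J -> R) : R :=
  if n is n'.+1 then \sum_s p s * walk n' F (fun j => u j + Y s j) else F u.

Definition ffun_cons n (s : S) (g : {ffun 'I_n -> S}) : {ffun 'I_n.+1 -> S} :=
  [ffun i => if unlift ord0 i is Some j then g j else s].

Lemma sum_ffun_recl n (F : {ffun 'I_n.+1 -> S} -> R) :
  \sum_h F h = \sum_s \sum_g F (ffun_cons s g).
Proof.
rewrite (pair_big xpredT xpredT (fun s g => F (ffun_cons s g)))/=.
rewrite (reindex (fun sg : S * {ffun 'I_n -> S} => ffun_cons sg.1 sg.2))//=.
apply: onW_bij; exists (fun h : {ffun 'I_n.+1 -> S} => (h ord0, [ffun j => h (lift ord0 j)])).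
  move=> [s g] /=; rewrite ffunE unlift_none; congr (_, _).
  by apply/ffunP => j; rewrite !ffunE liftK.
by move=> h; apply/ffunP => i; rewrite ffunE; case: unliftP => [j ->|->] //=; rewrite ffunE.
Qed.

Lemma walkE n F u :
  \sum_(g : {ffun 'I_n -> S}) (\prod_i p (g i)) * F (fun j => u j + \sum_i Y (g i) j) =
  walk n F u.
Proof.
elim: n u => [|n ih] u /=.
  rewrite (eq_bigr (fun=> F u)) => [|g _]; last first.
    rewrite big_ord0 mul1r; congr F; apply/funext => j.
    by rewrite big_ord0 addr0.
  by rewrite sumr_const card_ffun card_ord expn0.
rewrite sum_ffun_recl; apply: eq_bigr => s _; rewrite -ih mulr_sumr.
apply: eq_bigr => g _; rewrite big_ord_recl mulrA; congr (_ * _ * F _).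
- by rewrite ffunE unlift_none.
- by apply: eq_bigr => i _; rewrite ffunE liftK.
- apply/funext => j; rewrite big_ord_recl ffunE unlift_none -addrA.
  by congr (_ + (_ + _)); apply: eq_bigr => i _; rewrite ffunE liftK.
Qed.

Hypotheses (p0 : forall s, 0 <= p s) (p1 : \sum_s p s = 1).

Lemma walk_le n F G u : (forall u, F u <= G u) -> walk n F u <= walk n G u.
Proof.
move=> FG; elim: n u => [|n ih] u //=.
by apply: ler_sum => s _; rewrite ler_wpM2l.
Qed.

Lemma walkZ n a F u : walk n (fun u => a * F u) u = a * walk n F u.
Proof.
elim: n u => [|n ih] u //=; rewrite mulr_sumr; apply: eq_bigr => s _.
by rewrite ih mulrCA.
Qed.

(** Jensen's inequality one step at a time, from the nonnegativity of a variance. *)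
Lemma walk_sqr_le n F u : walk n F u ^+ 2 <= walk n (fun u => F u ^+ 2) u.
Proof.
elim: n u => [|n ih] u //=.
set m := \sum_s _.
have h : 0 <= \sum_s p s * (walk n F (fun j => u j + Y s j) - m) ^+ 2.
  by apply: sumr_ge0 => s _; rewrite mulr_ge0// sqr_ge0.
apply: (@le_trans _ _ (\sum_s p s * walk n F (fun j => u j + Y s j) ^+ 2)); last first.
  by apply: ler_sum => s _; rewrite ler_wpM2l.
rewrite -subr_ge0; apply: le_trans h _; rewrite le_eqVlt; apply/orP; left; apply/eqP.
have -> : \sum_s p s * (walk n F (fun j => u j + Y s j) - m) ^+ 2 =
  \sum_s (p s * walk n F (fun j => u j + Y s j) ^+ 2
    + (- 2 * m) * (p s * walk n F (fun j => u j + Y s j)) + m ^+ 2 * p s).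
  by apply: eq_bigr => s _; ring.
by rewrite !big_split/= -!mulr_sumr p1 -/m; ring.
Qed.

Hypothesis Y_mean : forall j, \sum_s p s * Y s j = 0.
Hypothesis Y_var : \sum_s p s * l2 (Y s) ^+ 2 <= 1.
Hypothesis Y_diam : forall s s', l2 (fun j => Y s j - Y s' j) <= Num.sqrt 2.

(** The cross terms vanish by [Y_mean], and by [Y_var] each step adds at most 1. *)
Lemma walk_l2_sqr n u : walk n (fun u => l2 u ^+ 2) u <= l2 u ^+ 2 + n%:R.
Proof.
elim: n u => [|n ih] u /=; first by rewrite addr0.
apply: (@le_trans _ _ (\sum_s p s * (l2 (fun j => u j + Y s j) ^+ 2 + n%:R))).
  by apply: ler_sum => s _; rewrite ler_wpM2l.
have -> : \sum_s p s * (l2 (fun j => u j + Y s j) ^+ 2 + n%:R) =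
    \sum_s ((l2 u ^+ 2 + n%:R) * p s + p s * l2 (Y s) ^+ 2 + \sum_j 2 * u j * (p s * Y s j)).
  apply: eq_bigr => s _.
  have -> : \sum_j 2 * u j * (p s * Y s j) = p s * \sum_j 2 * u j * Y s j.
    by rewrite mulr_sumr; apply: eq_bigr => j _; ring.
  have -> : l2 (fun j => u j + Y s j) ^+ 2 = l2 u ^+ 2 + l2 (Y s) ^+ 2 + \sum_j 2 * u j * Y s j.
    by rewrite !l2_sqr -!big_split/=; apply: eq_bigr => j _; ring.
  ring.
rewrite !big_split/= -!mulr_sumr p1 mulr1 exchange_big/=.
rewrite [X in _ + X]big1 => [|j _]; last by rewrite -mulr_sumr Y_mean mulr0.
by rewrite -natr1; move: Y_var; lra.
Qed.

Lemma walk_l2_le n : walk n l2 (fun=> 0) <= Num.sqrt n%:R.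
Proof.
have l20 : l2 (fun=> 0 : R) = 0 :> R.
  by move=> J'; rewrite /l2 big1 ?sqrtr0// => j _; rewrite expr0n.
have h := le_trans (walk_sqr_le n l2 (fun=> 0)) (walk_l2_sqr n (fun=> 0)).
rewrite l20 expr0n add0r in h.
apply: le_trans (ler_norm _) _; rewrite -sqrtr_sqr; exact: ler_wsqrtr.
Qed.

(** Coupling: two walks with the same steps keep their distance. *)
Lemma walk_lipschitz n u v : walk n l2 u - walk n l2 v <= l2 (fun j => u j - v j).
Proof.
elim: n u v => [|n ih] u v /=.
  have := @l2_dist R J u v (fun=> 0).
  have e (w : J -> R) : (fun j => w j + 0) = w by apply/funext => j; rewrite addr0.
  by rewrite !e.
rewrite -sumrB; apply: (@le_trans _ _ (\sum_s p s * l2 (fun j => u j - v j))).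
  apply: ler_sum => s _; rewrite -mulrBr ler_wpM2l//; apply: le_trans (ih _ _) _.
  by rewrite le_eqVlt; apply/orP; left; apply/eqP; apply: eq_l2 => j; ring.
by rewrite -mulr_suml p1 mul1r.
Qed.

(* Hoeffding's lemma at each step; the conditional expectation changes by at most
   the diameter of the steps, because it is a 1-Lipschitz function of the
   position. *)
Lemma walk_mgf n lam u :
  walk n (fun u => expR (lam * l2 u)) u <= expR (lam * walk n l2 u + n%:R * lam ^+ 2 / 2).
Proof.
elim: n u => [|n ih] u /=; first by rewrite mul0r mul0r addr0.
pose x s := walk n l2 (fun j => u j + Y s j).
apply: (@le_trans _ _ (\sum_s p s * (expR (lam * x s) * expR (n%:R * lam ^+ 2 / 2)))).
  by apply: ler_sum => s _; rewrite ler_wpM2l// -expRD ih.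
have -> : \sum_s p s * (expR (lam * x s) * expR (n%:R * lam ^+ 2 / 2)) =
    (\sum_s p s * expR (lam * x s)) * expR (n%:R * lam ^+ 2 / 2).
  by rewrite mulr_suml; apply: eq_bigr => s _; rewrite mulrA.
have s2 : 0 < Num.sqrt 2 :> R by rewrite sqrtr_gt0.
have xc s s' : x s - x s' <= Num.sqrt 2.
  apply: le_trans (walk_lipschitz _ _ _) _; apply: le_trans (Y_diam s s').
  by rewrite le_eqVlt; apply/orP; left; apply/eqP; apply: eq_l2 => j; ring.
apply: le_trans (ler_wpM2r (expR_ge0 _) (hoeffding_mgf p0 p1 lam s2 xc)) _.
rewrite -expRD ler_expR sqr_sqrtr// -natr1 -/x.
by rewrite le_eqVlt; apply/orP; left; apply/eqP; rewrite /x; field.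
Qed.

Lemma walk_tail n t : (0 < n)%N -> 0 <= t ->
  walk n (fun u => (Num.sqrt n%:R + t <= l2 u)%R%:R) (fun=> 0) <= expR (- (t ^+ 2 / (2 * n%:R))).
Proof.
move=> n0 t0; have n0' : 0 < n%:R :> R by rewrite ltr0n.
(* Chernoff's bound; this value minimises [- lam t + n lam^2 / 2]. *)
pose lam := t / n%:R; have lam0 : 0 <= lam by rewrite divr_ge0// ltW.
set y := Num.sqrt n%:R + t.
apply: (@le_trans _ _ (walk n (fun u => expR (- (lam * y)) * expR (lam * l2 u)) (fun=> 0))).
  apply: walk_le => u; rewrite -expRD; have [h|h] := leP y (l2 u); last by rewrite expR_ge0.
  by rewrite mulr1n -[leLHS]expR0 ler_expR addrC subr_ge0 ler_wpM2l.
rewrite walkZ; apply: le_trans (ler_wpM2l (expR_ge0 _) (walk_mgf _ _ _)) _.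
rewrite -expRD ler_expR.
have h := ler_wpM2l lam0 (walk_l2_le n).
apply: (@le_trans _ _ (- (lam * y) + (lam * Num.sqrt n%:R + n%:R * lam ^+ 2 / 2))).
  by rewrite lerD2l lerD2r.
rewrite /y /lam le_eqVlt; apply/orP; left; apply/eqP; field.
by rewrite gt_eqF.
Qed.

End RandomWalk.

(** * Empirical frequencies as a centred random walk *)

Section EmpiricalFrequencies.
Context {R : realType} {S J : finType}.
Variables (p : S -> R) (phi : S -> J).
Hypotheses (p0 : forall s, 0 <= p s) (p1 : \sum_s p s = 1).

Let f j := \sum_(s | phi s == j) p s.
Let Y s j := (phi s == j)%:R - f j.

Let sum_f (g : J -> R) : \sum_s p s * g (phi s) = \sum_j f j * g j.
Proof.
rewrite (partition_big phi xpredT)//=; apply: eq_bigr => j _.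
by rewrite mulr_suml; apply: eq_bigr => s /eqP ->.
Qed.

Let f0 j : 0 <= f j. Proof. by apply: sumr_ge0. Qed.
Let f1 : \sum_j f j = 1.
Proof.
have := sum_f (fun=> 1); under eq_bigr do rewrite mulr1.
by under [in X in _ = X -> _]eq_bigr do rewrite mulr1; rewrite p1 => <-.
Qed.

Let mean j : \sum_s p s * Y s j = 0.
Proof.
under eq_bigr do rewrite mulrBr.
rewrite sumrB -mulr_suml p1 mul1r.
rewrite (sum_f (fun i => (i == j)%:R)) (bigD1 j)//= eqxx mulr1 big1 ?addr0 ?subrr//.
by move=> i /negPf ->; rewrite mulr0.
Qed.

(** The exact value is [1 - \sum_j f j ^ 2]. *)
Let var : \sum_s p s * l2 (Y s) ^+ 2 <= 1.
Proof.
have e s : l2 (Y s) ^+ 2 = 1 - 2 * f (phi s) + \sum_j f j ^+ 2.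
  rewrite l2_sqr /Y; under eq_bigr do rewrite sqrrB.
  rewrite !big_split/= sumrN; congr (_ - _ + _).
    rewrite (bigD1 (phi s))//= eqxx expr1n big1 ?addr0// => j.
    by rewrite eq_sym => /negPf ->; rewrite expr0n.
  rewrite (bigD1 (phi s))//= eqxx mul1r big1 ?addr0 ?mulr_natl// => j.
  by rewrite eq_sym => /negPf ->; rewrite mul0r mul0rn.
under eq_bigr do rewrite e.
have -> : \sum_s p s * (1 - 2 * f (phi s) + \sum_j f j ^+ 2) =
    \sum_s ((1 + \sum_j f j ^+ 2) * p s + (- 2) * (p s * f (phi s))).
  by apply: eq_bigr => s _; ring.
rewrite big_split/= -!mulr_sumr p1 sum_f.
have -> : \sum_j f j * f j = \sum_j f j ^+ 2 by apply: eq_bigr => j _; rewrite expr2.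
have : 0 <= \sum_j f j ^+ 2 by apply: sumr_ge0 => j _; rewrite sqr_ge0.
lra.
Qed.

(** The centre [f] cancels, leaving the difference of two standard basis vectors. *)
Let diam s s' : l2 (fun j => Y s j - Y s' j) <= Num.sqrt 2.
Proof.
rewrite /l2 ler_wsqrtr//.
have -> : \sum_j (Y s j - Y s' j) ^+ 2 = \sum_j ((phi s == j)%:R - (phi s' == j)%:R) ^+ 2.
  by apply: eq_bigr => j _; rewrite /Y; ring.
apply: (@le_trans _ _ (\sum_j ((phi s == j)%:R + (phi s' == j)%:R))).
  by apply: ler_sum => j _; case: eqP => _; case: eqP => _ /=; lra.
rewrite big_split/=.
have one t : \sum_j (phi t == j)%:R = 1 :> R.
  rewrite (bigD1 (phi t))//= eqxx big1 ?addr0// => j.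
  by rewrite eq_sym => /negPf ->.
by rewrite !one; lra.
Qed.

Lemma empirical_tail n t : (0 < n)%N -> 0 <= t ->
  \sum_(g : {ffun 'I_n -> S} | (1 + t) / Num.sqrt n%:R <=
      l2 (fun j => n%:R^-1 * (\sum_i (phi (g i) == j)%:R) - f j)) \prod_i p (g i)
    <= expR (- (t ^+ 2 / 2)).
Proof.
move=> n0 t0; have n0' : 0 < n%:R :> R by rewrite ltr0n.
have sn0 : 0 < Num.sqrt n%:R :> R by rewrite sqrtr_gt0.
have := walk_tail p0 p1 mean var diam n0 (mulr_ge0 t0 (ltW sn0)).
rewrite -walkE exprMn sqr_sqrtr ?(ltW n0')//.
have -> : t ^+ 2 * n%:R / (2 * n%:R) = t ^+ 2 / 2 by field; rewrite gt_eqF.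
apply: le_trans; rewrite [leRHS](bigID (fun g : {ffun 'I_n -> S} =>
  (1 + t) / Num.sqrt n%:R <= l2 (fun j => n%:R^-1 * (\sum_i (phi (g i) == j)%:R) - f j)))/=.
rewrite -[leLHS]addr0 lerD//; last first.
  by apply: sumr_ge0 => g _; rewrite mulr_ge0// prodr_ge0.
apply: ler_sum => g h.
rewrite (_ : (_ <= _)%R = true) ?mulr1//.
have -> : l2 (fun j => 0 + \sum_i Y (g i) j) =
    n%:R * l2 (fun j => n%:R^-1 * (\sum_i (phi (g i) == j)%:R) - f j).
  rewrite -[X in X * _](gtr0_norm n0') -l2Z; apply: eq_l2 => j.
  rewrite add0r /Y sumrB sumr_const card_ord mulrBr mulrA mulfV ?gt_eqF// mul1r.
  by rewrite -[f j *+ n]mulr_natl.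
have -> : Num.sqrt n%:R + t * Num.sqrt n%:R = n%:R * ((1 + t) / Num.sqrt n%:R).
  rewrite -[X in X * (_ / _)](sqr_sqrtr (ltW n0')); field.
  by rewrite gt_eqF.
rewrite (ler_pM2l n0') h mulr1. by rewrite lexx.
Qed.

End EmpiricalFrequencies.

(** * The beta integral *)

Section Scaling.
Context {R : realType}.
Local Notation mu := (@lebesgue_measure R).

Definition scaling (s : R) : measurableTypeR R -> measurableTypeR R := fun x => s * x.

Lemma measurable_scaling s : measurable_fun setT (scaling s).
Proof. exact: mulrl_measurable. Qed.

Lemma lebesgue_measure_scale (s : R) (s0 : 0 < s) (A : set R) : measurable A ->
  mu A = pushforward (mscale (NngNum (ltW s0)) mu) (scaling s) A.
Proof.
move=> mA; apply: lebesgue_measure_unique => //=; first exact: measurable_scaling.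
move=> ? _ [[a b]] _ <-.
rewrite /pushforward/= /mscale/=.
have -> : scaling s @^-1` `]a, b]%classic = `]a / s, b / s]%classic.
  by apply/seteqP; split=> x /=; rewrite !in_itv/= /scaling ltr_pdivrMr// ler_pdivlMr// ![x * s]mulrC.
rewrite !lebesgue_measure_itv/= !lte_fin ltr_pM2r ?invr_gt0//.
case: ifP => _; last by rewrite mule0.
by rewrite -!EFinB -EFinM; congr EFin; field; rewrite gt_eqF.
Qed.

Lemma ge0_integral_scale (s : R) (s0 : 0 < s) (D : set R) (f : R -> \bar R) :
  measurable D -> measurable_fun D f -> (forall x, D x -> (0 <= f x)%E) ->
  (\int[mu]_(x in D) f x = s%:E * \int[mu]_(x in [set x | D (s * x)%R]) f (s * x)%R)%E.
Proof.
move=> mD mf f0.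
transitivity (\int[pushforward (mscale (NngNum (ltW s0)) mu) (scaling s)]_(x in D) f x)%E.
  apply: eq_measure_integral => [|ms A mA _]; first exact: measurable_scaling.
  exact: (lebesgue_measure_scale s0 mA).
have mp : measurable [set x | D (s * x)].
  by rewrite -[X in measurable X]setTI; exact: measurable_scaling.
rewrite ge0_integral_pushforward//=; last by move=> x; rewrite inE; exact: f0.
rewrite ge0_integral_mscale//=.
- apply: (measurable_comp mD _ mf (measurable_funTS (measurable_scaling s))) => _ [x Dx <-].
  exact: Dx.
- by move=> x; exact: f0.
- exact: measurable_scaling.
Qed.

End Scaling.

Section BetaIntegral.
Context {R : realType}.
Local Notation mu := (@lebesgue_measure R).
Implicit Types a m x : R.

Definition beta_density a m x : R := x `^ (a - 1) * (1 - x) `^ (m - 1).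
Definition beta_integral a m : \bar R :=
  (\int[mu]_(x in `]0%R, 1%R[) (beta_density a m x)%:E)%E.

Lemma measurable_onem_powR m (D : set R) : measurable_fun D (fun x => (1 - x) `^ m).
Proof.
apply: measurable_funTS.
have h : measurable_fun setT (fun x : R => 1 - x) by exact: measurable_funB.
exact: (measurableT_comp (measurable_powR m) h).
Qed.

Lemma measurable_beta_density a m (D : set R) : measurable_fun D (beta_density a m).
Proof.
apply: measurable_funM; last exact: measurable_onem_powR.
by apply: measurable_funTS; exact: measurable_powR.
Qed.

Lemma beta_density_ge0 a m x : 0 <= beta_density a m x.
Proof. by rewrite mulr_ge0// powR_ge0. Qed.

Lemma measurable_EFin_beta_density a m (D : set R) :
  measurable_fun D (fun x => (beta_density a m x)%:E).
Proof. by apply/measurable_EFinP; exact: measurable_beta_density. Qed.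

Lemma integral_beta_densityZ a m c (D : set R) : measurable D -> 0 <= c ->
  (\int[mu]_(x in D) (c%:E * (beta_density a m x)%:E) =
   c%:E * \int[mu]_(x in D) (beta_density a m x)%:E)%E.
Proof.
move=> mD c0; apply: ge0_integralZl => //; first exact: measurable_EFin_beta_density.
by move=> x _; rewrite lee_fin beta_density_ge0.
Qed.

(** Insert [1 = x + (1 - x)] into the integrand. *)
Lemma beta_integral_split a m : 0 < a -> 0 < m ->
  beta_integral a m = (beta_integral (a + 1) m + beta_integral a (m + 1))%E.
Proof.
move=> a0 m0; rewrite /beta_integral -ge0_integralD//.
- apply: eq_integral => x; rewrite inE/= in_itv/= => /andP[x0 x1].
  rewrite -EFinD /beta_density; congr EFin.
  have e1 : x `^ (a + 1 - 1) = x * x `^ (a - 1) by rewrite addrK mulr_powRB1// ltW.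
  have e2 : (1 - x) `^ (m + 1 - 1) = (1 - x) * (1 - x) `^ (m - 1).
    by rewrite addrK mulr_powRB1// subr_ge0 ltW.
  by rewrite e1 e2; ring.
- by move=> x _; rewrite lee_fin beta_density_ge0.
- by apply/measurable_EFinP; exact: measurable_beta_density.
- by move=> x _; rewrite lee_fin beta_density_ge0.
- by apply/measurable_EFinP; exact: measurable_beta_density.
Qed.

Lemma is_derive_onem_powR m x : x < 1 ->
  is_derive x 1 (fun x => - (1 - x) `^ m) (m * (1 - x) `^ (m - 1)).
Proof.
move=> x1; have x1' : 0 < 1 - x by rewrite subr_gt0.
have h1 : is_derive x (1 : R) (fun x => 1 - x) (-1).
  by apply: is_derive_eq; rewrite add0r mul1r.
have h2 := is_derive1_powR m x1'.
have h3 : is_derive x (1 : R) (fun x => (1 - x) `^ m) (m * (1 - x) `^ (m - 1) * -1).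
  exact: (@is_derive1_comp _ (fun y => y `^ m) (fun x => 1 - x)).
by apply: is_derive_eq; rewrite mulrN1 opprK.
Qed.

(* Integration by parts on [e, 1 - e]; the boundary terms vanish with e. *)
Lemma beta_integral_parts a m : 0 < a -> 0 < m ->
  (m%:E * beta_integral (a + 1) m = a%:E * beta_integral a (m + 1))%E.
Proof.
move=> a0 m0.
(* The shift by 3 keeps [e n] below one half, so that the interval is never degenerate. *)
pose e n : R := (n.+3%:R)^-1.
have e0 n : 0 < e n by rewrite invr_gt0.
have e12 n : e n < 2^-1 by rewrite ltf_pV2 ?posrE// ltr_nat.
pose I n := `[e n, 1 - e n]%classic.
have I01 n x : I n x -> 0 < x < 1.
  by rewrite /I/= in_itv/= => /andP[h1 h2]; have := e0 n; lra.
have mI n : measurable (I n) by exact: measurable_itv.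
have eI n : e n < 1 - e n by have := e12 n; lra.
pose F x := x `^ a; pose f x := a * x `^ (a - 1).
pose G x := - (1 - x) `^ m; pose g x := m * (1 - x) `^ (m - 1).
have dF x : 0 < x -> is_derive x 1 F (f x) by move=> x0; exact: is_derive1_powR.
have dG x : x < 1 -> is_derive x 1 G (g x) by exact: is_derive_onem_powR.
have df x : 0 < x -> derivable f x 1.
  move=> x0; apply: derivableM => //.
  by have := is_derive1_powR (a - 1) x0; case.
have dg x : x < 1 -> derivable g x 1.
  move=> x1; apply: derivableM => //.
  have [h _] := is_derive_onem_powR (m - 1) x1.
  have -> : (fun x => (1 - x) `^ (m - 1)) = - (fun x => - (1 - x) `^ (m - 1)).
    by apply/funext => y; rewrite fctE opprK.
  exact: derivableN.
have LR n (H : R -> R) : (forall x, 0 < x < 1 -> derivable H x 1) ->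
    derivable_oo_LRcontinuous H (e n) (1 - e n).
  move=> dH; have cH x : 0 < x < 1 -> {for x, continuous H}.
    by move=> x01; apply: differentiable_continuous; apply/derivable1_diffP; exact: dH.
  split.
  - by move=> x; rewrite in_itv/= => /andP[h1 h2]; apply: dH; have := e0 n; lra.
  - by apply: cvg_at_right_filter; apply: cH; have := e0 n; have := e12 n; lra.
  - by apply: cvg_at_left_filter; apply: cH; have := e0 n; have := e12 n; lra.
have ibp n : (\int[mu]_(x in I n) (F x * g x)%:E =
    (F (1 - e n) * G (1 - e n) - F (e n) * G (e n))%:E - \int[mu]_(x in I n) (f x * G x)%:E)%E.
  apply: integration_by_parts => //.
  - apply: derivable_within_continuous => x /I01/andP[x0 _]; exact: df.
  - by apply: LR => x /andP[x0 _]; have [] := dF _ x0.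
  - move=> x xI; have x0 : 0 < x.
      by move: xI; rewrite in_itv/= => /andP[h _]; exact: lt_trans h.
    by rewrite derive1E; have [_ ->] := dF _ x0.
  - apply: derivable_within_continuous => x /I01/andP[_ x1]; exact: dg.
  - by apply: LR => x /andP[_ x1]; have [] := dG _ x1.
  - move=> x xI; have x1 : x < 1.
      move: xI; rewrite in_itv/= => /andP[_ h]; apply: lt_trans h _.
      by have := e0 n; lra.
    by rewrite derive1E; have [_ ->] := dG _ x1.
pose A n := (\int[mu]_(x in I n) (beta_density (a + 1) m x)%:E)%E.
pose B n := (\int[mu]_(x in I n) (beta_density a (m + 1) x)%:E)%E.
pose dl n := F (1 - e n) * G (1 - e n) - F (e n) * G (e n).
have AB n : (m%:E * A n = (dl n)%:E + a%:E * B n)%E.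
  have -> : (m%:E * A n = \int[mu]_(x in I n) (F x * g x)%:E)%E.
    rewrite /A -integral_beta_densityZ ?(ltW m0)//.
    by apply: eq_integral => x _; rewrite -EFinM /beta_density addrK /F /g; congr EFin; ring.
  rewrite ibp; congr (_ + _)%E.
  have -> : (\int[mu]_(x in I n) (f x * G x)%:E =
      \int[mu]_(x in I n) - (a%:E * (beta_density a (m + 1) x)%:E))%E.
    apply: eq_integral => x _; rewrite -EFinM -EFinN /beta_density addrK /f /G; congr EFin; ring.
  rewrite integral_ge0N => [|x _]; last first.
    by rewrite -EFinM lee_fin mulr_ge0 ?beta_density_ge0 ?(ltW a0).
  by rewrite oppeK integral_beta_densityZ// ltW.
have UI : \bigcup_n I n = `]0, 1[%classic.
  apply/seteqP; split=> x /=.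
    by move=> [n _ /I01]; rewrite in_itv.
  rewrite in_itv/= => /andP[x0 x1].
  pose y := Num.min x (1 - x); have y0 : 0 < y by rewrite lt_min x0 subr_gt0.
  pose n := Num.bound y^-1.
  have en : e n <= y.
    rewrite -[leRHS]invrK lef_pV2 ?posrE ?invr_gt0//.
    apply: ltW; apply: lt_le_trans (archi_boundP _) _; first by rewrite invr_ge0 ltW.
    by rewrite ler_nat -addn3 leq_addr.
  exists n => //; rewrite /I/= in_itv/=.
  by move: en; rewrite le_min => /andP[h1 h2]; rewrite h1/=; lra.
have ndI : nondecreasing_seq I.
  apply/nondecreasing_seqP => n; rewrite subsetEset => x; rewrite /I/= !in_itv/=.
  have : e n.+1 <= e n by rewrite lef_pV2 ?posrE// ler_nat.
  by move=> h /andP[h1 h2]; lra.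
have cvgI b l : (\int[mu]_(x in I n) (beta_density b l x)%:E)%E @[n --> \oo] --> beta_integral b l.
  rewrite /beta_integral -UI; apply: ge0_nondecreasing_set_cvg_integral => //.
  - by move=> n; exact: measurable_EFin_beta_density.
  - by move=> n x _; rewrite lee_fin beta_density_ge0.
have e_cvg : e n @[n --> \oo] --> 0.
  have h := @cvg_harmonic R; rewrite -(cvg_shiftn 2) in h.
  by rewrite (_ : e = (fun n => harmonic (n + 2)%N))//; apply/funext => n; rewrite addn2.
have ep b : 0 < b -> (e n) `^ b @[n --> \oo] --> 0.
  by move=> b0; have /cvg_at_rightP := powR_cvg0 b0; apply; split.
have dl_cvg : dl n @[n --> \oo] --> 0.
  have dE n : dl n = (e n) `^ a * (1 - e n) `^ m - (1 - e n) `^ a * (e n) `^ m.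
    by rewrite /dl /F /G subKr; ring.
  have p1 n b : 0 < b -> (1 - e n) `^ b <= 1.
    move=> b0; apply: (@le_trans _ _ (1 `^ b)); last by rewrite powR1.
    have h1 := e0 n; have h2 := e12 n.
    by apply: ge0_ler_powR; rewrite ?nnegrE ?(ltW b0)//; lra.
  apply: (@squeeze_cvgr _ _ _ _ (fun n => - (e n) `^ m) (fun n => (e n) `^ a)).
  - apply: nearW => n; rewrite dE.
    have x1 := ler_wpM2r (powR_ge0 (e n) m) (p1 n a a0); have x2 := ler_wpM2l (powR_ge0 (e n) a) (p1 n m m0).
    have x3 := mulr_ge0 (powR_ge0 (e n) a) (powR_ge0 (1 - e n) m).
    have x4 := mulr_ge0 (powR_ge0 (1 - e n) a) (powR_ge0 (e n) m).
    by rewrite mul1r in x1; rewrite mulr1 in x2; lra.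
  - by rewrite -oppr0; apply: cvgN; exact: ep.
  - exact: ep.
have c1 : (m%:E * A n)%E @[n --> \oo] --> (m%:E * beta_integral (a + 1) m)%E.
  by apply: cvgeZl => //; exact: cvgI.
have c2 : (m%:E * A n)%E @[n --> \oo] --> (0%:E + a%:E * beta_integral a (m + 1))%E.
  under eq_fun do rewrite AB.
  apply: cvgeD => //.
    by apply: cvg_EFin => //; exact: nearW.
  by apply: cvgeZl => //; exact: cvgI.
by rewrite (cvg_unique _ c1 c2)// add0e.
Qed.

End BetaIntegral.

(** * Finiteness of the beta integral and iterated integrals over the simplex *)

Section BetaReal.
Context {R : realType}.
Local Notation mu := (@lebesgue_measure R).
Implicit Types a m s : R.

Lemma beta_integral_ge0 a m : (0 <= beta_integral a m)%E.
Proof. by apply: integral_ge0 => x _; rewrite lee_fin beta_density_ge0. Qed.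

Lemma beta_integral_le1 a m : 0 < a -> 0 < m -> (beta_integral (a + 1) (m + 1) <= 1)%E.
Proof.
move=> a0 m0; apply: (@le_trans _ _ (\int[mu]_(x in `]0%R, 1%R[) (cst 1%:E x))%E); last first.
  by rewrite integral_cst//= mul1e lebesgue_measure_itv/= lte_fin ltr01 -EFinD subr0.
apply: ge0_le_integral => //.
- by move=> x _; rewrite lee_fin beta_density_ge0.
- exact: measurable_EFin_beta_density.
- move=> x /=; rewrite in_itv/= => /andP[x0 x1]; rewrite lee_fin /beta_density !addrK.
  have p1 y b : 0 < b -> 0 <= y <= 1 -> y `^ b <= 1.
    move=> b0 /andP[y0 y1]; apply: (@le_trans _ _ (1 `^ b)); last by rewrite powR1.
    by apply: ge0_ler_powR; rewrite ?nnegrE ?(ltW b0).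
  by rewrite mulr_ile1 ?powR_ge0// p1//; apply/andP; split; lra.
Qed.

Lemma fin_num_mulEl c (y : \bar R) : 0 < c -> (0 <= y)%E -> (c%:E * y)%E \is a fin_num ->
  y \is a fin_num.
Proof.
move=> c0 y0; have cy0 : (0 <= c%:E * y)%E by rewrite mule_ge0// lee_fin ltW.
rewrite !ge0_fin_numE// => {cy0}; move: y0.
case: y => [r _ _|_|//]; first exact: ltry.
by rewrite gt0_muley// lte_fin.
Qed.

(** The integrand may be unbounded at both ends. At [(a + 1, m + 1)] it is at most 1, and the two
    recursions carry finiteness down to [(a, m + 1)] and then to [(a, m)]. *)
Lemma beta_integral_fin a m : 0 < a -> 0 < m -> beta_integral a m \is a fin_num.
Proof.
have half a' m' : 0 < a' -> 0 < m' -> beta_integral a' (m' + 1) \is a fin_num ->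
    beta_integral a' m' \is a fin_num.
  move=> a0 m0 h; rewrite beta_integral_split// fin_numD h andbT.
  apply: (@fin_num_mulEl m'); rewrite ?beta_integral_ge0//.
  by rewrite beta_integral_parts// fin_numM.
move=> a0 m0; apply: half => //; have m10 : 0 < m + 1 by rewrite addr_gt0.
rewrite beta_integral_split// fin_numD; apply/andP.
have h : beta_integral (a + 1) (m + 1) \is a fin_num.
  rewrite ge0_fin_numE ?beta_integral_ge0//.
  by rewrite (le_lt_trans (beta_integral_le1 a0 m0))// ltry.
split => //; apply: (@fin_num_mulEl a); rewrite ?beta_integral_ge0//.
by rewrite -beta_integral_parts// fin_numM.
Qed.

Definition beta_real a m : R := fine (beta_integral a m).

Lemma beta_realE a m : 0 < a -> 0 < m -> beta_integral a m = (beta_real a m)%:E.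
Proof. by move=> a0 m0; rewrite fineK// beta_integral_fin. Qed.

Lemma beta_real_ge0 a m : 0 <= beta_real a m.
Proof. by rewrite fine_ge0// beta_integral_ge0. Qed.

Lemma beta_real_recl a m : 0 < a -> 0 < m -> beta_real (a + 1) m = a / (a + m) * beta_real a m.
Proof.
move=> a0 m0; have a1 : 0 < a + 1 by rewrite addr_gt0.
have m1 : 0 < m + 1 by rewrite addr_gt0.
have := beta_integral_parts a0 m0; have := beta_integral_split a0 m0.
rewrite !beta_realE// -EFinD -!EFinM => -[->] [h].
have am : a + m != 0 by rewrite gt_eqF// addr_gt0.
apply: (mulfI am); rewrite mulrA [(a + m) * (_ / _)]mulrC divfK//.
by rewrite mulrDl mulrDr -h; ring.
Qed.

Lemma beta_real_recr a m : 0 < a -> 0 < m -> beta_real a (m + 1) = m / (a + m) * beta_real a m.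
Proof.
move=> a0 m0; have a1 : 0 < a + 1 by rewrite addr_gt0.
have m1 : 0 < m + 1 by rewrite addr_gt0.
have := beta_integral_parts a0 m0; have := beta_integral_split a0 m0.
rewrite !beta_realE// -EFinD -!EFinM => -[->] [h].
have am : a + m != 0 by rewrite gt_eqF// addr_gt0.
apply: (mulfI am); rewrite mulrA [(a + m) * (_ / _)]mulrC divfK//.
by rewrite mulrDl mulrDr h; ring.
Qed.

Lemma beta_integral_scaled a m s : 0 < a -> 0 < m -> 0 < s ->
  (\int[mu]_(x in `]0%R, s[) (x `^ (a - 1) * (s - x) `^ (m - 1))%:E =
   (beta_real a m * s `^ (a + m - 1))%:E)%E.
Proof.
move=> a0 m0 s0; rewrite (ge0_integral_scale s0)//; last 2 first.
- apply/measurable_EFinP/measurable_funM.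
    by apply: measurable_funTS; exact: measurable_powR.
  apply: measurable_funTS.
  have h : measurable_fun setT (fun x : R => s - x) by exact: measurable_funB.
  exact: (measurableT_comp (measurable_powR (m - 1)) h).
- by move=> x _; rewrite lee_fin mulr_ge0// powR_ge0.
have -> : [set x : R | `]0, s[%classic (s * x)] = `]0, 1[%classic.
  apply/seteqP; split=> x /=; rewrite !in_itv/= pmulr_rgt0// => /andP[->] /=.
    by rewrite -[X in _ < X -> _]mulr1 ltr_pM2l.
  by rewrite -[X in _ -> _ < X]mulr1 ltr_pM2l.
have -> : (\int[mu]_(x in `]0%R, 1%R[) ((s * x) `^ (a - 1) * (s - s * x) `^ (m - 1))%:E =
    \int[mu]_(x in `]0%R, 1%R[) ((s `^ (a - 1) * s `^ (m - 1))%:E * (beta_density a m x)%:E))%E.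
  apply: eq_integral => x; rewrite inE/= in_itv/= => /andP[x0 x1].
  rewrite -EFinM /beta_density -{2}[s]mulr1 -mulrBr !powRM ?(ltW s0) ?(ltW x0) ?subr_ge0 ?(ltW x1)//.
  by congr EFin; ring.
rewrite integral_beta_densityZ ?mulr_ge0 ?powR_ge0//.
rewrite [X in (_ * (_ * X))%E](beta_realE a0 m0) -!EFinM; congr EFin.
have sn : s != 0 by rewrite gt_eqF.
have -> : a + m - 1 = 1 + (a - 1) + (m - 1) by ring.
rewrite !powRD ?powRr1 ?(ltW s0) ?sn ?implybT//.
ring.
Qed.

(** The unnormalised Dirichlet density on the simplex of total mass [s], with [b] the parameter of
    the last coordinate, which is [s] minus the sum of [l]. The recursion follows that of the
    iterated integral. *)
Fixpoint simplex_density (a : nat -> R) b s (l : seq R) : R :=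
  if l is x :: l' then
    if 0 < x then x `^ (a 0 - 1) * simplex_density (fun i => a i.+1) b (s - x) l' else 0
  else if 0 < s then s `^ (b - 1) else 0.

(** The integral of [simplex_density] for total mass 1, as a product of beta integrals. *)
Fixpoint simplex_const n (a : nat -> R) b : R :=
  if n is n'.+1 then
    beta_real (a 0) (\sum_(i < n') a i.+1 + b) * simplex_const n' (fun i => a i.+1) b
  else 1.

Lemma simplex_const_ge0 n (a : nat -> R) b : 0 <= simplex_const n a b.
Proof. by elim: n a => //= n ih a; rewrite mulr_ge0// beta_real_ge0. Qed.

(** The factor [c] is there for the induction: in the inner integral the power of the first variable
    is a constant. *)
Lemma lebesgue_iint_simplex n (a : nat -> R) b s c : (forall i, 0 < a i) -> 0 < b -> 0 <= c ->
  lebesgue_iint (fun t : n.-tuple R => (c * simplex_density a b s t)%:E) =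
  (c * (if 0 < s then simplex_const n a b * s `^ (\sum_(i < n) a i + b - 1) else 0))%:E.
Proof.
elim: n a s c => [|n ih] a s c a0 b0 c0 /=.
  by rewrite big_ord0 add0r mul1r.
pose m := \sum_(i < n) a i.+1 + b; pose K := simplex_const n (fun i => a i.+1) b.
have m0 : 0 < m by rewrite ltr_wpDl// sumr_ge0// => i _; rewrite ltW.
have K0 : 0 <= K by exact: simplex_const_ge0.
transitivity (\int[mu]_x (((fun x => ((c * K)%:E * (x `^ (a 0 - 1) * (s - x) `^ (m - 1))%:E)%E) \_ `]0%R, s[) x))%E.
  apply: eq_integral => x _; rewrite patchE.
  have [x0|x0] := ltP 0 x; last first.
    rewrite memNset; last by rewrite /= in_itv/= ltNge x0.
    transitivity (lebesgue_iint (fun t : n.-tuple R =>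
        (0 * simplex_density (fun i => a i.+1) b (s - x) t)%:E)).
      by congr lebesgue_iint; apply/funext => t; rewrite mulr0 mul0r.
    by rewrite ih// mul0r.
  transitivity (lebesgue_iint (fun t : n.-tuple R =>
      (c * x `^ (a 0 - 1) * simplex_density (fun i => a i.+1) b (s - x) t)%:E)).
    by congr lebesgue_iint; apply/funext => t; rewrite mulrA.
  rewrite ih ?mulr_ge0 ?powR_ge0// subr_gt0.
  have [xs|xs] := ltP x s; last first.
    by rewrite memNset ?mulr0//= in_itv/= x0 ltNge xs.
  rewrite mem_set; last by rewrite /= in_itv/= x0.
  by rewrite -EFinM -/K -/m; congr EFin; ring.
rewrite -integral_mkcond.
have [s0|s0] := ltP 0 s; last first.
  by rewrite set_itv_ge ?integral_set0 ?mulr0// bnd_simp -leNgt.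
rewrite ge0_integralZl//; last 3 first.
- apply/measurable_EFinP/measurable_funM.
    by apply: measurable_funTS; exact: measurable_powR.
  apply: measurable_funTS.
  have h : measurable_fun setT (fun x : R => s - x) by exact: measurable_funB.
  exact: (measurableT_comp (measurable_powR (m - 1)) h).
- by move=> x _; rewrite lee_fin mulr_ge0// powR_ge0.
- by rewrite lee_fin mulr_ge0.
rewrite beta_integral_scaled// -EFinM; congr EFin.
have eS : \sum_(i < n.+1) a i + b = a 0 + m by rewrite big_ord_recl /m addrA.
by rewrite eS -/m -/K; ring.
Qed.

Lemma simplex_const_recr n (a : nat -> R) b : (forall i, 0 < a i) -> 0 < b ->
  simplex_const n a (b + 1) = b / (\sum_(i < n) a i + b) * simplex_const n a b.
Proof.
elim: n a => [|n ih] a a0 b0 /=; first by rewrite big_ord0 add0r divff ?mul1r// gt_eqF.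
have m0 : 0 < \sum_(i < n) a i.+1 + b.
  by rewrite ltr_wpDl// sumr_ge0// => i _; rewrite ltW.
rewrite addrA beta_real_recr// ih// big_ord_recl.
by field; rewrite -addrA !gt_eqF// addr_gt0.
Qed.

(** A telescoping product: a beta factor before index [j] changes by the ratio of the parameter sums
    after and from its index, the factor at [j] by [a j] over the sum from [j] on, and later factors
    do not change. *)
Lemma simplex_const_recl n (a : nat -> R) b j : (forall i, 0 < a i) -> 0 < b -> (j < n)%N ->
  simplex_const n (fun i => a i + (i == j)%:R) b =
  a j / (\sum_(i < n) a i + b) * simplex_const n a b.
Proof.
elim: n a j => [|n ih] a j a0 b0 // jn /=.
have m0 : 0 < \sum_(i < n) a i.+1 + b.
  by rewrite ltr_wpDl// sumr_ge0// => i _; rewrite ltW.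
rewrite big_ord_recl; case: j jn => [|j] jn /=.
  rewrite (eq_bigr (fun i : 'I_n => a i.+1)) => [|i _]; last by rewrite addr0.
  rewrite beta_real_recl// -addrA.
  have -> : (fun i => a i.+1 + 0%:R) = (fun i => a i.+1) by apply/funext => i; rewrite addr0.
  by rewrite mulrA.
rewrite (_ : (fun i => a i.+1 + (i.+1 == j.+1)%:R) = (fun i => a i.+1 + (i == j)%:R))//.
have sumE : \sum_(i < n) (a i.+1 + (i == j :> nat)%:R) = \sum_(i < n) a i.+1 + 1.
  rewrite big_split/=; congr (_ + _).
  rewrite (bigD1 (Ordinal (jn : (j < n)%N)))//= eqxx big1 ?addr0// => i.
  by rewrite -val_eqE/= => /negPf ->.
rewrite (ih (fun i => a i.+1))// addr0 sumE addrAC beta_real_recr// -addrA.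
by field; rewrite !gt_eqF// addr_gt0.
Qed.

End BetaReal.

(** * Dirichlet moments *)

Section DirichletMoments.
Context {R : realType} {n : nat}.
Implicit Types (be : 'I_n.+1 -> R).

Lemma simplex_densityE (a : nat -> R) (b s : R) (l : seq R) :
  simplex_density a b s l =
  if all (fun x => 0 < x) l && (0 < s - \sum_(y <- l) y) then
    (\prod_(i < size l) nth 0 l i `^ (a i - 1)) * (s - \sum_(y <- l) y) `^ (b - 1)
  else 0.
Proof.
elim: l a s => [|x l ih] a s /=; first by rewrite big_nil subr0 big_ord0 mul1r.
rewrite ih big_cons opprD addrA big_ord_recl /=.
by case: ifP => //= _; case: ifP => _; rewrite ?mulr0// mulrA.
Qed.

(** [dirichlet_distributed] speaks of functions that are nonnegative everywhere, which monomials are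
    not. Cutting them off outside the open orthant, where the density vanishes, makes it
    applicable. *)
Definition positive_part (f : n.+1.-tuple R -> R) (p : n.+1.-tuple R) : R :=
  if [forall i, 0 < tnth p i] then f p else 0.

Lemma simplex_pt_density be (t : n.-tuple R) :
  positive_part (fun p => \prod_i tnth p i `^ (be i - 1)) (@simplex_pt R n.+1 t) =
  simplex_density (fun i => be (inord i)) (be ord_max) 1 t.
Proof.
rewrite simplex_densityE /positive_part.
have wE (i : 'I_n) : tnth (@simplex_pt R n.+1 t) (widen_ord (leqnSn n) i) = nth 0 t i.
  by rewrite tnth_mktuple; apply: set_nth_default; rewrite /= size_tuple.
have mE : tnth (@simplex_pt R n.+1 t) ord_max = 1 - \sum_(y <- t) y.
  by rewrite tnth_mktuple nth_default// size_tuple.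
have -> : [forall i, 0 < tnth (@simplex_pt R n.+1 t) i] =
    all (fun x => 0 < x) t && (0 < 1 - \sum_(y <- t) y).
  apply/forallP/andP => [h|[/allP h1 h2] i].
    split; last by rewrite -mE.
    apply/(all_nthP 0) => i; rewrite size_tuple => it.
    by have := h (widen_ord (leqnSn n) (Ordinal it)); rewrite wE.
  have [it|] := ltnP i n.
    have -> : i = widen_ord (leqnSn n) (Ordinal it) by apply: val_inj.
    by rewrite wE; apply: h1; rewrite mem_nth// size_tuple.
  move=> ni; have -> : i = ord_max by apply: val_inj => /=; apply/eqP; rewrite eqn_leq ni -ltnS ltn_ord.
  by rewrite mE.
case: ifP => // _; rewrite big_ord_recr/= mE size_tuple; congr (_ * _).
apply: eq_bigr => i _; rewrite wE; congr (_ `^ (be _ - 1)).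
by apply: val_inj => /=; rewrite inordK// ltnS ltnW.
Qed.

Definition dirichlet_const be : R :=
  simplex_const n (fun i => be (inord i)) (be ord_max).

Definition incr_at be (j : 'I_n.+1) : 'I_n.+1 -> R := fun i => be i + (i == j)%:R.

Lemma simplex_const_ext (m : nat) (a a' : nat -> R) (b : R) :
  (forall i, (i < m)%N -> a i = a' i) -> simplex_const m a b = simplex_const m a' b.
Proof.
elim: m a a' => //= m ih a a' aa'; rewrite aa'//.
rewrite (ih _ (fun i => a' i.+1)) => [|i im]; last exact: aa'.
rewrite (eq_bigr (fun i : 'I_m => a' i.+1))// => i _; by apply: aa'; rewrite ltnS ltn_ord.
Qed.

Lemma dirichlet_const_incr be j : (forall i, 0 < be i) ->
  dirichlet_const (incr_at be j) = be j / (\sum_i be i) * dirichlet_const be.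
Proof.
move=> be0; rewrite /dirichlet_const.
have sE : \sum_i be i = \sum_(i < n) be (inord i) + be ord_max.
  rewrite big_ord_recr/=; congr (_ + _); apply: eq_bigr => i _; congr be.
  by apply: val_inj => /=; rewrite inordK// ltnS ltnW.
rewrite sE; have [jn|nj] := ltnP j n.
  rewrite [incr_at be j ord_max]/incr_at (_ : (ord_max == j) = false) ?addr0; last first.
    by apply/negbTE; rewrite -val_eqE/= gtn_eqF.
  have := simplex_const_recl (a := fun i => be (inord i)) (fun i => be0 _) (be0 ord_max) jn.
  rewrite inord_val => <-; apply: simplex_const_ext => i ni.
  by rewrite /incr_at -val_eqE/= inordK// ltnS ltnW.
have -> : j = ord_max by apply: val_inj => /=; apply/eqP; rewrite eqn_leq nj -ltnS ltn_ord.
rewrite [incr_at be ord_max ord_max]/incr_at eqxx.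
rewrite -(simplex_const_recr n (a := fun i => be (inord i)) (fun i => be0 _) (be0 _)).
apply: simplex_const_ext => i ni; rewrite /incr_at (_ : (_ == _) = false) ?addr0//.
by apply/negbTE; rewrite -val_eqE/= inordK ?ltn_eqF// ltnS ltnW.
Qed.

End DirichletMoments.

(** * Moments of a Dirichlet vector *)

Section Moments.
Context {R : realType} {n : nat} {dd : measure_display} {T : measurableType dd}.
Variables (P : probability T R) (alpha : 'I_n.+1 -> R) (h : T -> n.+1.-tuple R).
Hypotheses (alpha0 : forall i, 0 < alpha i) (h_dir : dirichlet_distributed P alpha h).

Definition positive_orthant : set (n.+1.-tuple R) := [set p | forall i, 0 < tnth p i].

Lemma measurable_positive_orthant : measurable positive_orthant.
Proof.
have -> : positive_orthant = \bigcap_(i in [set: 'I_n.+1]) [set p | 0 < tnth p i].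
  by apply/seteqP; split=> p /= pp i; [move=> _; exact: pp|exact: pp].
apply: fin_bigcap_measurable => [|i _]; first exact: finite_finset.
have := @measurable_tnth _ R n.+1 i measurableT `]0, +oo[%classic (measurable_itv _).
by rewrite setTI; congr measurable; apply/seteqP; split=> p /=; rewrite in_itv/= andbT.
Qed.

Lemma positive_partE (f : n.+1.-tuple R -> R) p :
  positive_part f p = f p * \1_positive_orthant p.
Proof.
rewrite /positive_part indicE; case: ifPn => pp.
  by rewrite mem_set ?mulr1// => i; exact: (forallP pp).
by rewrite memNset ?mulr0// => pp'; case/negP: pp; apply/forallP.
Qed.

Definition dirichlet_factor : R :=
  gamma_fun (\sum_i alpha i) / (\prod_i gamma_fun (alpha i)).

Lemma gamma_fun_ge0 (a : R) : 0 <= gamma_fun a.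
Proof. by apply: Rintegral_ge0 => x _; rewrite mulr_ge0 ?powR_ge0 ?expR_ge0. Qed.

Lemma dirichlet_factor_ge0 : 0 <= dirichlet_factor.
Proof.
by rewrite divr_ge0 ?gamma_fun_ge0// prodr_ge0// => i _; exact: gamma_fun_ge0.
Qed.

Definition incr_all (L : seq 'I_n.+1) : 'I_n.+1 -> R :=
  foldr (fun j be => incr_at be j) alpha L.

Lemma incr_all_gt0 L i : 0 < incr_all L i.
Proof. by elim: L => //= j L ih; rewrite /incr_at ltr_wpDr. Qed.

(** A monomial times a Dirichlet density is, up to normalisation, the density with the corresponding
    parameters increased. *)
Lemma dirichlet_moment_raw (L : seq 'I_n.+1) :
  (\int[P]_w (positive_part (fun p => \prod_(j <- L) tnth p j) (h w))%:E)%E =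
  (dirichlet_factor * dirichlet_const (incr_all L))%:E.
Proof.
rewrite h_dir; first last.
- move=> p; rewrite /positive_part; case: ifP => // /forallP pp.
  by apply: prodr_ge0 => i _; rewrite ltW.
- rewrite (_ : positive_part _ =
      (fun p => (\prod_(j <- L) tnth p j) * \1_positive_orthant p)); last first.
    by apply/funext => p; rewrite positive_partE.
  apply: measurable_funM; last by apply: measurable_indic; exact: measurable_positive_orthant.
  by apply: measurable_prod => i _; exact: measurable_tnth.
transitivity (lebesgue_iint (fun t : n.-tuple R => (dirichlet_factor *
    simplex_density (fun i => incr_all L (inord i)) (incr_all L ord_max) 1 t)%:E)).
  congr lebesgue_iint; apply/funext => t; congr EFin.
  rewrite -simplex_pt_density /dirichlet_pdf /positive_part; case: ifP => pp; last by rewrite !mulr0.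
  rewrite -/dirichlet_factor mulrCA; congr (_ * _).
  elim: L => [|j L ih] /=; first by rewrite big_nil mul1r.
  rewrite big_cons -mulrA ih (bigD1 j)//= [RHS](bigD1 j)//= mulrA; congr (_ * _).
    have px := forallP pp j; rewrite /incr_at eqxx addrK mulr_powRB1 ?(ltW px)//.
    exact: (incr_all_gt0 L j).
  by apply: eq_bigr => i /negPf ij; rewrite /incr_at ij addr0.
rewrite lebesgue_iint_simplex ?dirichlet_factor_ge0 ?incr_all_gt0//; last first.
  by move=> i; exact: incr_all_gt0.
by rewrite ltr01 powR1 mulr1.
Qed.

(** The gamma integrals are never evaluated: the density has total mass 1 because [P] has. *)
Lemma dirichlet_normalized : dirichlet_factor * dirichlet_const alpha = 1.
Proof.
have h1 : (\int[P]_w ((cst 1 : n.+1.-tuple R -> R) (h w))%:E)%E = 1%E.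
  transitivity (\int[P]_w (cst 1%E w))%E; first by apply: eq_integral.
  by rewrite integral_cst//= mul1e probability_setT.
have := dirichlet_moment_raw [::]; rewrite /incr_all/= => h2.
apply: EFin_inj; rewrite -h2 -h1 !h_dir//; last 2 first.
- rewrite (_ : positive_part _ = \1_positive_orthant); last first.
    by apply/funext => p; rewrite positive_partE big_nil mul1r.
  by apply: measurable_indic; exact: measurable_positive_orthant.
- by move=> p; rewrite /positive_part big_nil; case: ifP.
congr lebesgue_iint; apply/funext => t; congr EFin.
by rewrite /positive_part /dirichlet_pdf big_nil; case: ifP => _; rewrite ?mul1r ?mul0r ?mulr0.
Qed.

Hypothesis mh : measurable_fun setT h.

Lemma measurable_orthant_preimage : measurable (h @^-1` positive_orthant).
Proof. by rewrite -[X in measurable X]setTI; apply: mh => //; exact: measurable_positive_orthant. Qed.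

(** The probability of the orthant is the moment of the empty monomial, which is 1 by the
    normalisation. *)
Lemma pr_orthant : pr P (~` (h @^-1` positive_orthant)) = 0.
Proof.
have mO := measurable_orthant_preimage.
rewrite pr_setC//; apply/eqP; rewrite subr_eq0 eq_sym /pr; apply/eqP.
rewrite -[RHS]/(fine 1%:E) -dirichlet_normalized; congr fine.
rewrite -(dirichlet_moment_raw [::]) -[X in P X]setIT -integral_indic//.
apply: eq_integral => w _; rewrite positive_partE big_nil mul1r.
by rewrite !indicE; congr (_%:R)%:E; apply/idP/idP; rewrite !inE.
Qed.

Let a0 := \sum_i alpha i.
Lemma sum_incr_at (be : 'I_n.+1 -> R) j : \sum_i incr_at be j i = \sum_i be i + 1.
Proof.
rewrite big_split/=; congr (_ + _); rewrite (bigD1 j)//= eqxx big1 ?addr0// => i.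
by move=> /negPf ->.
Qed.

(** Rising factorials, with all coincidences among the indices in one formula: for [a = b = c] the
    numerator is [alpha_a (alpha_a + 1) (alpha_a + 2)]. *)
Definition third_moment (a b c : 'I_n.+1) : R :=
  alpha a * (alpha b + (b == a)%:R) * (alpha c + (c == a)%:R + (c == b)%:R)
  / (a0 * (a0 + 1) * (a0 + 2)).

Lemma dirichlet_third_moment a b c :
  (\int[P]_w (positive_part (fun p => tnth p a * tnth p b * tnth p c) (h w))%:E)%E =
  (third_moment a b c)%:E.
Proof.
have a00 : 0 < a0.
  by rewrite /a0 big_ord_recl ltr_pwDl// sumr_ge0// => i _; rewrite ltW.
have -> : (fun p : n.+1.-tuple R => tnth p a * tnth p b * tnth p c) =
    (fun p => \prod_(j <- [:: c; b; a]) tnth p j).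
  by apply/funext => p; rewrite !big_cons big_nil; ring.
rewrite dirichlet_moment_raw; congr EFin.
have g1 := incr_all_gt0 [:: a]; have g2 := incr_all_gt0 [:: b; a].
rewrite /incr_all/= in g1 g2 *.
rewrite (dirichlet_const_incr c g2) (dirichlet_const_incr b g1) (dirichlet_const_incr a alpha0).
rewrite !sum_incr_at -/a0.
transitivity (third_moment a b c * (dirichlet_factor * dirichlet_const alpha)); last first.
  by rewrite dirichlet_normalized mulr1.
rewrite /third_moment /incr_at; field.
by rewrite !gt_eqF// ?addr_gt0// -addrA addr_gt0.
Qed.

End Moments.

(** * The law of a triple *)

(** Triples serve as a finite sample space, functions on ['I_3] are the form used in the model; this
    converts the former into the latter. *)
Definition tri (A : Type) (s : A * A * A) (v : 'I_3) : A :=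
  if val v is v'.+1 then (if v' is _.+1 then s.2 else s.1.2) else s.1.1.

Lemma sum_delta (R : pzRingType) (I : finType) (f : I -> R) a :
  \sum_i f i * (i == a)%:R = f a.
Proof.
rewrite (bigD1 a)//= eqxx mulr1 big1 ?addr0// => i /negPf ->.
by rewrite mulr0.
Qed.

Section TripleLaw.
Context {R : realType} {d n : nat}.
Variables (alpha : 'I_n.+1 -> R) (O : 'M[R]_(d, n.+1)).
Hypotheses (alpha0 : forall i, 0 < alpha i) (O_em : emission_matrix O).
Let a0 := \sum_i alpha i.

Definition emission_prod (j : 'I_d * 'I_d * 'I_d) (i : 'I_n.+1 * 'I_n.+1 * 'I_n.+1) : R :=
  O j.1.1 i.1.1 * O j.1.2 i.1.2 * O j.2 i.2.

Definition triple_law (j : 'I_d * 'I_d * 'I_d) : R :=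
  \sum_i third_moment alpha i.1.1 i.1.2 i.2 * emission_prod j i.

Lemma alpha_sum_gt0 : 0 < a0.
Proof. by rewrite /a0 big_ord_recl ltr_pwDl// sumr_ge0// => i _; rewrite ltW. Qed.

Lemma third_moment_ge0 a b c : 0 <= third_moment alpha a b c.
Proof.
have := alpha_sum_gt0; rewrite /a0 => h.
by rewrite divr_ge0 ?mulr_ge0 ?addr_ge0 ?(ltW h) ?(ltW (alpha0 _)).
Qed.

Let O0 j i : 0 <= O j i. Proof. by case: O_em. Qed.
Let O1 i : \sum_j O j i = 1. Proof. by case: O_em. Qed.

Lemma emission_prod_ge0 j i : 0 <= emission_prod j i.
Proof. by rewrite !mulr_ge0. Qed.

Lemma triple_law_ge0 j : 0 <= triple_law j.
Proof. by apply: sumr_ge0 => i _; rewrite mulr_ge0 ?third_moment_ge0 ?emission_prod_ge0. Qed.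

Definition second_moment (a b : 'I_n.+1) : R :=
  alpha a * (alpha b + (b == a)%:R) / (a0 * (a0 + 1)).
Definition first_moment (a : 'I_n.+1) : R := alpha a / a0.

Let sum_delta1 (a : 'I_n.+1) : \sum_i (i == a)%:R = 1 :> R.
Proof. by rewrite -[RHS](sum_delta (fun=> 1) a); apply: eq_bigr => i _; rewrite mul1r. Qed.

Lemma sum_third_moment a b : \sum_c third_moment alpha a b c = second_moment a b.
Proof.
have a00 := alpha_sum_gt0; rewrite /third_moment -/a0 -mulr_suml -mulr_sumr.
rewrite !big_split/= -/a0 !sum_delta1 /second_moment.
by field; rewrite -?addrA !gt_eqF// ?addr_gt0.
Qed.

Lemma sum_second_moment a : \sum_b second_moment a b = first_moment a.
Proof.
have a00 := alpha_sum_gt0; rewrite /second_moment -mulr_suml -mulr_sumr.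
rewrite big_split/= -/a0 sum_delta1 /first_moment.
by field; rewrite !gt_eqF// addr_gt0.
Qed.

Definition pop_second (j l : 'I_d) : R := \sum_a \sum_b second_moment a b * (O j a * O l b).
Definition pop_mean (j : 'I_d) : R := \sum_a first_moment a * O j a.

Lemma triple_lawE j l m : triple_law (j, l, m) =
  \sum_a \sum_b \sum_c third_moment alpha a b c * (O j a * O l b * O m c).
Proof.
by rewrite pair_bigA/= pair_bigA.
Qed.

Lemma triple_law_sum2 j l : \sum_m triple_law (j, l, m) = pop_second j l.
Proof.
under eq_bigr do rewrite triple_lawE.
rewrite exchange_big; apply: eq_bigr => a _ /=.
rewrite exchange_big; apply: eq_bigr => b _ /=.
rewrite exchange_big -sum_third_moment mulr_suml; apply: eq_bigr => c _ /=.
by rewrite -mulr_sumr -mulr_sumr O1 mulr1.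
Qed.

Lemma pop_second_sum j : \sum_l pop_second j l = pop_mean j.
Proof.
rewrite exchange_big; apply: eq_bigr => a _ /=.
rewrite exchange_big -sum_second_moment mulr_suml; apply: eq_bigr => b _ /=.
by rewrite -mulr_sumr -mulr_sumr O1 mulr1.
Qed.

Lemma pop_mean_sum : \sum_j pop_mean j = 1.
Proof.
rewrite exchange_big/= -[RHS](divff (lt0r_neq0 alpha_sum_gt0)) mulr_suml.
by apply: eq_bigr => a _; rewrite -mulr_sumr O1 mulr1.
Qed.

Lemma sum_by_second j l :
  \sum_(s : 'I_d * 'I_d * 'I_d | s.1 == (j, l)) triple_law s = pop_second j l.
Proof.
rewrite -triple_law_sum2 big_mkcond -(pair_bigA _ (fun p m => if p == (j, l) then triple_law (p, m) else 0))/=.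
rewrite (bigD1 (j, l))//= eqxx [X in _ + X]big1 ?addr0// => p /negPf ->.
by rewrite big1.
Qed.

Lemma sum_by_first j :
  \sum_(s : 'I_d * 'I_d * 'I_d | s.1.1 == j) triple_law s = pop_mean j.
Proof.
rewrite -pop_second_sum.
rewrite [RHS](eq_bigr (fun l => \sum_m triple_law (j, l, m))) => [|l _]; last first.
  by rewrite triple_law_sum2.
rewrite big_mkcond -(pair_bigA _ (fun p m => if p.1 == j then triple_law (p, m) else 0))/=.
rewrite -(pair_bigA _ (fun i l => \sum_m if i == j then triple_law (i, l, m) else 0))/=.
rewrite (bigD1 j)//= eqxx [X in _ + X]big1 ?addr0// => i /negPf ->.
by rewrite big1// => l _; rewrite big1.
Qed.

Lemma triple_law_sum : \sum_s triple_law s = 1.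
Proof.
rewrite -pop_mean_sum; under [RHS]eq_bigr do rewrite -sum_by_first.
by rewrite (partition_big (fun s : 'I_d * 'I_d * 'I_d => s.1.1) xpredT).
Qed.

Context {dd : measure_display} {T : measurableType dd}.
Variables (P : probability T R) (h : T -> n.+1.-tuple R).
Variables (z : 'I_3 -> T -> 'I_n.+1) (x : 'I_3 -> T -> 'I_d).
Hypothesis draw : lda_draw P alpha O h z x.

Lemma measurable_triple_event j : measurable [set w | forall v, x v w = tri j v].
Proof.
have -> : [set w | forall v, x v w = tri j v] =
    \bigcap_(v in [set: 'I_3]) [set w | x v w = tri j v].
  by apply/seteqP; split=> w /= h' v; [move=> _; exact: h'|exact: h'].
apply: fin_bigcap_measurable => [|v _]; first exact: finite_finset.
by case: draw.
Qed.

Let B : set (n.+1.-tuple R) := @positive_orthant R n.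

Let event j i := [set w | B (h w) /\ forall v, z v w = tri i v /\ x v w = tri j v].

Let measurable_event j i : measurable (event j i).
Proof.
have [mh mz mx hd _] := draw.
have -> : event j i = h @^-1` B `&`
    \bigcap_(v in [set: 'I_3]) ([set w | z v w = tri i v] `&` [set w | x v w = tri j v]).
  apply/seteqP; split=> w /=.
    by move=> [h1 h2]; split=> // v _; exact: h2.
  by move=> [h1 h2]; split=> // v; exact: h2.
apply: measurableI; first exact: measurable_orthant_preimage.
apply: fin_bigcap_measurable => [|v _]; first exact: finite_finset.
exact: measurableI.
Qed.

Let pr_event j i : P (event j i) =
  (third_moment alpha i.1.1 i.1.2 i.2 * emission_prod j i)%:E.
Proof.
have [mh mz mx hd law] := draw.
rewrite /event (law B (tri i) (tri j)); last exact: measurable_positive_orthant.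
pose g := positive_part (fun p : n.+1.-tuple R => tnth p i.1.1 * tnth p i.1.2 * tnth p i.2).
have gE p : g p = tnth p i.1.1 * tnth p i.1.2 * tnth p i.2 * \1_B p.
  exact: positive_partE.
have mg : measurable_fun setT (fun w => (g (h w))%:E).
  apply/measurable_EFinP; apply: (measurableT_comp (f := g)) mh.
  rewrite (_ : g = (fun p => (tnth p i.1.1 * tnth p i.1.2 * tnth p i.2) * \1_B p)).
    apply: measurable_funM; last by apply: measurable_indic; exact: measurable_positive_orthant.
    by do 2?apply: measurable_funM; exact: measurable_tnth.
  by apply/funext => p; exact: gE.
have g0 p : 0 <= g p.
  rewrite gE indicE; case: (boolP (_ \in _)) => hp; last by rewrite mulr0.
  by rewrite mulr1; move: hp; rewrite inE => hp; rewrite !mulr_ge0// ltW.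
transitivity (\int[P]_w ((emission_prod j i)%:E * (g (h w))%:E))%E.
  rewrite integral_mkcond; apply: eq_integral => w _; rewrite patchE.
  rewrite -EFinM gE indicE.
  have -> : (w \in h @^-1` B) = (h w \in B) by apply/idP/idP; rewrite !inE.
  case: ifP => _; last by rewrite !mulr0.
  by congr EFin; rewrite !big_ord_recl big_ord0 /emission_prod /tri /=; ring.
rewrite ge0_integralZl//.
- by rewrite /g (dirichlet_third_moment alpha0 hd) -EFinM mulrC.
- by move=> w _; rewrite lee_fin.
- by rewrite lee_fin emission_prod_ge0.
Qed.

(* The law sums to 1, hence this inequality is an equality, but it suffices for
   tail bounds and makes a discussion of the boundary of the simplex
   unnecessary. *)
Lemma pr_triple_le j : pr P [set w | forall v, x v w = tri j v] <= triple_law j.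
Proof.
have [mh mz mx hd law] := draw.
have mO := measurable_orthant_preimage mh.
(* The extra index stands for [h] outside the open orthant, a null event. *)
pose A (o : unit + 'I_n.+1 * 'I_n.+1 * 'I_n.+1) :=
  if o is inr i then event j i else ~` (h @^-1` B).
apply: (@le_trans _ _ (\sum_o pr P (A o))).
  apply: pr_bigcup => [|[u|i]|w xw].
  - exact: measurable_triple_event.
  - exact: measurableC.
  - exact: measurable_event.
  - have [Bw|nB] := pselect (B (h w)); last by exists (inl tt).
    exists (inr (z (inord 0) w, z (inord 1) w, z (inord 2) w)); split=> // v.
    split=> //; rewrite /tri/=; case: v => [[|[|[|v]]] v3] //=; congr z; apply: val_inj;
      by rewrite /= inordK.
rewrite big_sumType/= big_const card_unit/= addr0 (pr_orthant alpha0 hd mh) add0r.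
by apply: ler_sum => i _; rewrite /pr pr_event.
Qed.

End TripleLaw.

(** * Concentration of the empirical moments *)

Section Samples.
Context {R : realType} {d n N : nat} {dd : measure_display} {T : measurableType dd}.
Variables (alpha : 'I_n.+1 -> R) (O : 'M[R]_(d, n.+1)) (P : probability T R).
Variables (h : 'I_N -> T -> n.+1.-tuple R) (z : 'I_N -> 'I_3 -> T -> 'I_n.+1).
Variable x : 'I_N -> 'I_3 -> T -> 'I_d.
Hypotheses (alpha0 : forall i, 0 < alpha i) (O_em : emission_matrix O).
Hypotheses (x_lda : forall i, lda_draw P alpha O (h i) (z i) (x i))
  (x_indep : independent_triples P x).

Let q := triple_law alpha O.
Let S := ('I_d * 'I_d * 'I_d)%type.

Definition sample (w : T) (i : 'I_N) : S :=
  (x i (inord 0) w, x i (inord 1) w, x i (inord 2) w).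

Lemma triE (s : S) (v : 'I_N) w : sample w v = s <-> forall u, x v u w = tri s u.
Proof.
split=> [<- u|e]; last first.
  by case: s e => [[s0 s1] s2] e; rewrite /sample !e /tri /= !inordK.
rewrite /tri /sample; case: u => [[|[|[|u]]] u3] //=; congr x; apply: val_inj;
  by rewrite /= inordK.
Qed.

Definition cylinder (g : {ffun 'I_N -> S}) : set T := [set w | forall i, sample w i = g i].

Lemma cylinderE g : cylinder g = [set w | forall i u, x i u w = tri (g i) u].
Proof. by apply/seteqP; split=> w /= e i; apply/triE. Qed.

Lemma measurable_cylinder g : measurable (cylinder g).
Proof.
have -> : cylinder g = \bigcap_(i in [set: 'I_N]) [set w | forall u, x i u w = tri (g i) u].
  by rewrite cylinderE; apply/seteqP; split=> w /= e i; [move=> _; exact: e|exact: e].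
apply: fin_bigcap_measurable => [|i _]; first exact: finite_finset.
exact: measurable_triple_event (x_lda i) _.
Qed.

Lemma pr_cylinder g : pr P (cylinder g) <= \prod_i q (g i).
Proof.
have -> : pr P (cylinder g) = \prod_i pr P [set w | forall u, x i u w = tri (g i) u].
  apply: EFin_inj; rewrite -prE; last exact: measurable_cylinder.
  rewrite cylinderE (x_indep (fun i => [set f | forall u, f u = tri (g i) u])) -prodEFin.
  apply: eq_bigr => i _; rewrite -prE//; exact: measurable_triple_event (x_lda i) _.
apply: ler_prod => i _; rewrite pr_ge0/=.
exact: (pr_triple_le alpha0 O_em (x_lda i)).
Qed.

Definition deviation (J : finType) (phi : S -> J) (g : {ffun 'I_N -> S}) : R :=
  l2 (fun j => N%:R^-1 * (\sum_i (phi (g i) == j)%:R) - \sum_(s | phi s == j) q s).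

Definition sample_ffun w : {ffun 'I_N -> S} := [ffun i => sample w i].

(** The bad event is a finite union of cylinders, each of probability at most that of the i.i.d. law
    [q], so the finite sum in [empirical_tail] bounds it. *)
Lemma deviation_event (J : finType) (phi : S -> J) t : (0 < N)%N -> 0 <= t ->
  let bad := [set w | (1 + t) / Num.sqrt N%:R <= deviation phi (sample_ffun w)] in
  measurable bad /\ pr P bad <= expR (- (t ^+ 2 / 2)).
Proof.
move=> N0 t0 bad.
pose A (g : {ffun 'I_N -> S}) : set T :=
  if (1 + t) / Num.sqrt N%:R <= deviation phi g then cylinder g else set0.
have mA g : measurable (A g) by rewrite /A; case: ifP => // _; exact: measurable_cylinder.
have badE : bad = \bigcup_(g in [set: {ffun 'I_N -> S}]) A g.
  apply/seteqP; split=> w.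
    move=> bw; exists (sample_ffun w) => //; rewrite /A; rewrite /bad/= in bw; rewrite bw.
    by move=> i; rewrite ffunE.
  move=> [g _]; rewrite /A; case: ifP => // hg cw.
  rewrite /bad/= (_ : sample_ffun w = g)//.
  by apply/ffunP => i; rewrite ffunE cw.
have mbad : measurable bad.
  by rewrite badE; apply: fin_bigcup_measurable => // ; exact: finite_finset.
split=> //; apply: (@le_trans _ _ (\sum_g pr P (A g))).
  apply: pr_bigcup => // w; rewrite badE => -[g _ Ag]; by exists g.
apply: le_trans (empirical_tail phi (triple_law_ge0 alpha0 O_em) (triple_law_sum alpha0 O_em) N0 t0).
rewrite [leRHS]big_mkcond/=; apply: ler_sum => g _; rewrite /A.
case: ifP => hg; last by rewrite /pr measure0.
exact: pr_cylinder.
Qed.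

Lemma good_event (delta : R) : (0 < N)%N -> 0 < delta -> delta < 1 ->
  exists E : set T, [/\ measurable E, 1 - delta < pr P E &
    forall w, E w ->
      let f := (1 + 3 / 2 * Num.sqrt (ln (3 / delta))) / Num.sqrt N%:R in
      [/\ deviation (fun s => s.1.1) (sample_ffun w) <= f,
          deviation (fun s => s.1) (sample_ffun w) <= f
        & deviation id (sample_ffun w) <= f]].
Proof.
move=> N0 d0 d1; pose L := Num.sqrt (ln (3 / delta)); pose t := 3 / 2 * L.
have L2 : L ^+ 2 = ln (3 / delta).
  by rewrite sqr_sqrtr// ln_ge0// ler_pdivlMr// mul1r; lra.
have lnp : 0 < ln (3 / delta) by apply: ln_gt0; rewrite ltr_pdivlMr// mul1r; lra.
have t0 : 0 <= t by rewrite mulr_ge0// ?divr_ge0// sqrtr_ge0.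
(* The factor [3/2] makes [t^2 / 2 = 9/8 ln (3 / delta)]; being above [sqrt 2], it yields the strict
   inequality required of the final probability. *)
have tail : expR (- (t ^+ 2 / 2)) < delta / 3.
  have -> : delta / 3 = expR (- ln (3 / delta)).
    by rewrite expRN lnK ?invf_div// posrE divr_gt0.
  by rewrite ltr_expR ltrN2 /t exprMn L2; lra.
have [m1 p1] := deviation_event (fun s => s.1.1) N0 t0.
have [m2 p2] := deviation_event (fun s => s.1) N0 t0.
have [m3 p3] := deviation_event id N0 t0.
set B1 := [set w | _] in m1 p1; set B2 := [set w | _] in m2 p2; set B3 := [set w | _] in m3 p3.
have mU : measurable (B1 `|` B2 `|` B3) by do !apply: measurableU.
exists (~` (B1 `|` B2 `|` B3)); split; first exact: measurableC.
  rewrite pr_setC// ltrD2l ltrN2.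
  pose A (i : 'I_3) := tri (B1, B2, B3) i.
  apply: (@le_lt_trans _ _ (\sum_i pr P (A i))).
    apply: pr_bigcup => // [[[|[|[|v]]] v3] //|w].
    move=> [[b|b]|b]; [exists (inord 0)|exists (inord 1)|exists (inord 2)];
      by rewrite /A /tri/= inordK.
  by rewrite !big_ord_recl big_ord0 /A /tri/=; lra.
move=> w /= /not_orP[/not_orP[b1 b2] b3].
by split; apply: ltW; rewrite ltNge; apply/negP.
Qed.

End Samples.

(** * The smallest singular value *)

Lemma l2_prob_le1 (R : rcfType) (J : finType) (p : J -> R) :
  (forall j, 0 <= p j) -> \sum_j p j = 1 -> l2 p <= 1.
Proof.
move=> p0 p1; rewrite -(@ler_pXn2r _ 2)// ?nnegrE ?l2_ge0// l2_sqr expr1n -p1.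
apply: ler_sum => j _; rewrite expr2 ler_piMl// -p1 (bigD1 j)//= lerDl sumr_ge0//.
Qed.

(** Evaluate the form at [y - C^-1 H y], where [C] exceeds the norm of [H]. For invertible [H] this
    makes the form coercive. *)
Lemma psd_dot_bound (R : rcfType) n (H : 'M[R]_n) : H^T = H ->
  (forall y, 0 <= dot y (H *m y)) ->
  forall y, nF (H *m y) ^+ 2 <= (nF H + 1) * dot y (H *m y).
Proof.
move=> Hs H0 y; set C := nF H + 1; have C0 : 0 < C by rewrite ltr_wpDl.
have HH : dot (H *m y) (H *m (H *m y)) <= C * nF (H *m y) ^+ 2.
  apply: le_trans (ler_norm _) _; apply: le_trans (dot_le _ _) _.
  rewrite mulrC expr2 mulrA ler_wpM2r//; apply: le_trans (opb_nF _ _) _.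
  by rewrite ler_wpM2r// /C lerDl.
have := H0 (y - C^-1 *: (H *m y)).
rewrite mulmxBr -scalemxAr dotDl !dotDr !dotNl !dotNr !dotZl !dotZr.
have -> : dot y (H *m (H *m y)) = nF (H *m y) ^+ 2.
  by rewrite nF_sqrV dot_mulmxl Hs.
rewrite -nF_sqrV.
set a := nF _ ^+ 2 in HH *; set b := dot _ (H *m (H *m y)) in HH *; set c := dot y (H *m y) => h.
rewrite mulrC -ler_pdivrMr// mulrC.
have h2 : C^-1 * (C^-1 * b) <= C^-1 * a.
  by rewrite ler_pM2l ?invr_gt0// mulrC ler_pdivrMr// mulrC.
lra.
Qed.

Section SigmaMin.
Context {R : realType} {m n : nat}.
Variable A : 'M[R]_(m, n.+1).
Hypothesis rA : \rank A = n.+1.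
Let G := A^T *m A.

Let Gdot y : dot y (G *m y) = nF (A *m y) ^+ 2.
Proof. by rewrite nF_sqrV dot_mulmxl mulmxA. Qed.

Let ker0 (y : 'cV_n.+1) : A *m y = 0 -> y = 0.
Proof.
move=> Ay; have fA : row_free A^T by rewrite /row_free mxrank_tr rA.
have : y^T *m A^T == 0 by rewrite -trmx_mul Ay trmx0.
by rewrite mulmx_free_eq0// trmx_eq0 => /eqP.
Qed.

Let eigen_vec a : eigenvalue G a -> exists2 y : 'cV_n.+1, y != 0 & nF (A *m y) ^+ 2 = a * nF y ^+ 2.
Proof.
move=> /eigenvalueP[v vG v0]; exists v^T; first by rewrite trmx_eq0.
rewrite -Gdot [in LHS]dotC dot_mulmxl nF_sqrV -dotZr; congr dot.
by rewrite -(trmxK (G^T *m _)) trmx_mul !trmxK vG -linearZ.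
Qed.

(** Its supremum [lam] is the minimum of the Rayleigh quotient of [A^T A]; working with it
    identifies the smallest eigenvalue without a diagonalisation. *)
Let gap_set : set R := [set c : R | forall y : 'cV_n.+1, c * nF y ^+ 2 <= nF (A *m y) ^+ 2].
Let lam := sup gap_set.

Let gap_ub : ubound gap_set (nF A ^+ 2).
Proof.
move=> c /(_ (delta_mx 0 0)); rewrite nF_delta expr1n mulr1 => /le_trans; apply.
have := opb_nF A (delta_mx 0 0); rewrite nF_delta mulr1 => h.
by rewrite ler_sqr// nnegrE.
Qed.

Let gap0 : gap_set 0.
Proof. by move=> y; rewrite mul0r sqr_ge0. Qed.

Let gap_sup : has_sup gap_set.
Proof. by split; [exists 0|exists (nF A ^+ 2)]. Qed.

Let lamP (y : 'cV_n.+1) : lam * nF y ^+ 2 <= nF (A *m y) ^+ 2.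
Proof.
have [->|y0] := eqVneq y 0; first by rewrite mulmx0 !nF0 expr0n mulr0.
have ny : 0 < nF y ^+ 2.
  by rewrite exprn_gt0// lt0r nF_ge0 andbT; apply: contra_neq y0; exact: nF_eq0.
rewrite -ler_pdivlMr//; apply: ge_sup; first by exists 0.
by move=> c /(_ y); rewrite ler_pdivlMr.
Qed.

Let lam0 : 0 <= lam.
Proof. exact: (ub_le_sup (proj2 gap_sup) gap0). Qed.

(* If [G - lam] were invertible, it would be bounded below, and [lam] could be
   increased. *)
Let eigen_lam : eigenvalue G lam.
Proof.
rewrite /eigenvalue /eigenspace kermx_eq0 row_free_unit; apply/negP => uH.
set H := G - lam%:M in uH.
have Hdot y : dot y (H *m y) = nF (A *m y) ^+ 2 - lam * nF y ^+ 2.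
  by rewrite mulmxBl mul_scalar_mx dotDr dotNr dotZr Gdot -(nF_sqrV y).
have Hs : H^T = H by rewrite /H linearB/= tr_scalar_mx trmx_mul trmxK.
have H0 y : 0 <= dot y (H *m y) by rewrite Hdot subr_ge0.
pose K := nF (invmx H) ^+ 2 * (nF H + 1) + 1.
have K0 : 0 < K by rewrite ltr_wpDl// mulr_ge0// ?sqr_ge0// addr_ge0.
have HK y : nF y ^+ 2 <= K * dot y (H *m y).
  have e : nF y ^+ 2 <= nF (invmx H) ^+ 2 * nF (H *m y) ^+ 2.
    rewrite -exprMn ler_sqr ?nnegrE ?mulr_ge0//.
    by rewrite -{1}(mulKmx uH y) opb_nF.
  apply: le_trans e _; apply: le_trans (ler_wpM2l (sqr_ge0 _) (psd_dot_bound Hs H0 y)) _.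
  by rewrite mulrA ler_wpM2r// /K lerDl.
have : gap_set (lam + K^-1).
  move=> y; have := HK y; rewrite mulrC -ler_pdivrMr// Hdot mulrDl.
  by rewrite lerBrDl mulrC [_ / K]mulrC.
move/(ub_le_sup (proj2 gap_sup)); rewrite -/lam gerDl leNgt invr_gt0 K0//.
Qed.

Let lam_gt0 : 0 < lam.
Proof.
rewrite lt0r lam0 andbT; apply/eqP => l0; have [y y0] := eigen_vec eigen_lam.
rewrite l0 mul0r => /eqP; rewrite sqrf_eq0 => /eqP /nF_eq0 /ker0 /eqP.
by rewrite (negPf y0).
Qed.

Lemma sigma_minE : sigma_min A = Num.sqrt lam.
Proof.
have mem : [set s : R | 0 < s /\ eigenvalue (A^T *m A) (s ^+ 2)] (Num.sqrt lam).
  by split; rewrite ?sqrtr_gt0// sqr_sqrtr.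
have lb : lbound [set s : R | 0 < s /\ eigenvalue (A^T *m A) (s ^+ 2)] (Num.sqrt lam).
  move=> s [s0 /eigen_vec[y y0 e]]; rewrite -(@ler_pXn2r _ 2)// ?nnegrE ?sqrtr_ge0 ?(ltW s0)//.
  rewrite sqr_sqrtr//; have := lamP y; rewrite e ler_pM2r// exprn_gt0// lt0r nF_ge0 andbT.
  by apply: contra_neq y0; exact: nF_eq0.
apply/eqP; rewrite eq_le; apply/andP; split.
  by apply: ge_inf mem; exists (Num.sqrt lam).
by apply: lb_le_inf lb; exists (Num.sqrt lam).
Qed.

Lemma sigma_min_gt0 : 0 < sigma_min A.
Proof. by rewrite sigma_minE sqrtr_gt0. Qed.

Lemma sigma_minP (y : 'cV_n.+1) : sigma_min A * nF y <= nF (A *m y).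
Proof.
rewrite -(@ler_pXn2r _ 2)// ?nnegrE ?mulr_ge0// ?(ltW sigma_min_gt0)//.
by rewrite exprMn sigma_minE sqr_sqrtr.
Qed.

End SigmaMin.

Lemma emission_col_le1 (R : realType) d k (O : 'M[R]_(d, k)) i :
  emission_matrix O -> nF (col i O) <= 1.
Proof.
move=> [p0 p1 rO]; rewrite nF_cVl2; apply: l2_prob_le1 => [j| ]; first by rewrite mxE.
by rewrite -[RHS](p1 i); apply: eq_bigr => j _; rewrite mxE.
Qed.

Lemma sigma_min_le1 (R : realType) d k (O : 'M[R]_(d, k.+1)) :
  emission_matrix O -> sigma_min O <= 1.
Proof.
move=> em; have [_ _ rO] := em; have := sigma_minP rO (delta_mx 0 0).
rewrite nF_delta mulr1 => /le_trans; apply.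
by rewrite -colE emission_col_le1.
Qed.

(** * Adjusted moments *)

Section MomentForms.
Context {R : rcfType} {d : nat}.
Implicit Types (D : 'I_d * 'I_d * 'I_d -> R) (S : 'M[R]_d) (m h u w : 'cV[R]_d).

(** The argument [h] is contracted with the third index, as in [u^T Triples(h) w]. *)
Definition cubic D h u w : R := \sum_s D s * (u s.1.1 0 * w s.1.2 0 * h s.2 0).

(** This and [triples_form] are functions of the raw moments, so that one perturbation bound
    compares their empirical and population values. *)
Definition pairs_form (a0 : R) S m : 'M[R]_d := S - (a0 / (a0 + 1)) *: (m *m m^T).

Definition triples_form (a0 : R) D S m h u w : R :=
  cubic D h u w
  - a0 / (a0 + 2) * (dot u (S *m h) * dot m w + dot u m * dot h (S *m w)
                     + dot h m * dot u (S *m w))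
  + 2 * a0 ^+ 2 / ((a0 + 2) * (a0 + 1)) * (dot h m * dot u m * dot m w).

Lemma cubic_le D h u w : `|cubic D h u w| <= l2 D * (nF h * nF u * nF w).
Proof.
apply: le_trans (cauchy_schwarz_norm _ _) _.
have -> // : l2 (fun s : 'I_d * 'I_d * 'I_d => u s.1.1 0 * w s.1.2 0 * h s.2 0) =
   nF h * nF u * nF w.
apply/eqP; rewrite -(@eqrXn2 _ 2)// ?mulr_ge0 ?l2_ge0//; apply/eqP.
rewrite l2_sqr !exprMn !nF_sqrV /dot.
rewrite -(pair_bigA _ (fun p k => (u p.1 0 * w p.2 0 * h k 0) ^+ 2))/=.
rewrite -(pair_bigA _ (fun i j => \sum_k (u i 0 * w j 0 * h k 0) ^+ 2))/=.
rewrite -mulrA mulrC mulr_suml mulr_suml; apply: eq_bigr => i _.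
rewrite -mulrA mulr_suml mulr_sumr; apply: eq_bigr => j _.
rewrite mulr_sumr mulr_sumr; apply: eq_bigr => k _; ring.
Qed.

Lemma bilinear_le S u w : `|dot u (S *m w)| <= nF S * (nF u * nF w).
Proof.
apply: le_trans (dot_le _ _) _; rewrite mulrCA ler_wpM2l//; exact: opb_nF.
Qed.

Let mul_dist (b b' l l' x y f g : R) : `|b' - b| <= f * x -> `|l'| <= y ->
  `|b| <= x -> `|l' - l| <= g * y -> `|b' * l' - b * l| <= (f + g) * (x * y).
Proof.
move=> hb hl' hb0 hl.
have -> : b' * l' - b * l = (b' - b) * l' + b * (l' - l) by ring.
apply: le_trans (ler_normD _ _) _; rewrite !normrM.
rewrite (_ : (f + g) * (x * y) = f * x * y + x * (g * y)); last by ring.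
by apply: lerD; apply: ler_pM.
Qed.

Variables (D D' : 'I_d * 'I_d * 'I_d -> R) (S S' : 'M[R]_d) (m m' : 'cV[R]_d).
Variables (a0 f : R).
Hypotheses (a0_gt0 : 0 < a0) (m_le1 : nF m <= 1) (m'_le1 : nF m' <= 1)
  (S_le1 : nF S <= 1) (m_dist : nF (m' - m) <= f) (S_dist : nF (S' - S) <= f)
  (D_dist : l2 (fun s => D' s - D s) <= f).

Let f0 : 0 <= f. Proof. exact: le_trans (nF_ge0 _) m_dist. Qed.

Lemma pairs_form_dist : nF (pairs_form a0 S' m' - pairs_form a0 S m) <= 3 * f.
Proof.
have -> : pairs_form a0 S' m' - pairs_form a0 S m = (S' - S)
    - (a0 / (a0 + 1)) *: ((m' - m) *m m'^T + m *m (m' - m)^T).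
  by apply/matrixP => i j; rewrite !mxE !big_ord1 !mxE; ring.
apply: le_trans (nFB _ _) _; rewrite nFZ.
have c0 : 0 <= a0 / (a0 + 1) by rewrite divr_ge0 ?addr_ge0 ?(ltW a0_gt0).
have c1 : a0 / (a0 + 1) <= 1 by rewrite ler_pdivrMr ?mul1r ?lerDl// addr_gt0.
have e1 : nF ((m' - m) *m m'^T) <= f.
  apply: le_trans (nF_mul _ _) _; rewrite nFT -[leRHS]mulr1; exact: ler_pM.
have e2 : nF (m *m (m' - m)^T) <= f.
  apply: le_trans (nF_mul _ _) _; rewrite nFT -[leRHS]mul1r; exact: ler_pM.
have := nFD ((m' - m) *m m'^T) (m *m (m' - m)^T).
move=> hy; rewrite ger0_norm//.
rewrite (_ : 3 * f = f + 1 * (f + f)); last by ring.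
by apply: lerD => //; apply: ler_pM => //; apply: le_trans hy _; apply: lerD.
Qed.

(** [13 = 1 + 3 * 2 + 2 * 3]: the cubic term; three products of two perturbed factors, with a
    coefficient at most 1; one product of three, with a coefficient at most 2. *)
Lemma triples_form_dist h u w :
  `|triples_form a0 D' S' m' h u w - triples_form a0 D S m h u w|
    <= 13 * f * nF h * nF u * nF w.
Proof.
have dot1 (v v1 : 'cV[R]_d) : nF v <= 1 -> `|dot v1 v| <= nF v1.
  by move=> v_le; apply: le_trans (dot_le _ _) _; rewrite ler_piMr.
have dotd v1 : `|dot v1 m' - dot v1 m| <= f * nF v1.
  rewrite -dotNr -dotDr; apply: le_trans (dot_le _ _) _.
  by rewrite mulrC ler_wpM2r.
have bil1 v1 v2 : `|dot v1 (S *m v2)| <= nF v1 * nF v2.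
  apply: le_trans (bilinear_le _ _ _) _; by rewrite ler_piMl// mulr_ge0.
have bild v1 v2 : `|dot v1 (S' *m v2) - dot v1 (S *m v2)| <= f * (nF v1 * nF v2).
  rewrite -dotNr -dotDr -mulmxBl; apply: le_trans (bilinear_le _ _ _) _.
  by rewrite ler_wpM2r// mulr_ge0.
have e0 : `|cubic D' h u w - cubic D h u w| <= f * (nF h * nF u * nF w).
  have -> : cubic D' h u w - cubic D h u w = cubic (fun s => D' s - D s) h u w.
    by rewrite /cubic -sumrB; apply: eq_bigr => s _; rewrite mulrBl.
  by apply: le_trans (cubic_le _ _ _ _) _; rewrite ler_wpM2r// !mulr_ge0.
rewrite /triples_form ![dot _ w]dotC.
have e1 := mul_dist (bild u h) (dot1 _ w m'_le1) (bil1 u h) (dotd w).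
have e2 := mul_dist (bild h w) (dot1 _ u m'_le1) (bil1 h w) (dotd u).
have e3 := mul_dist (bild u w) (dot1 _ h m'_le1) (bil1 u w) (dotd h).
have e4 := mul_dist (dotd h) (dot1 _ u m'_le1) (dot1 _ h m_le1) (dotd u).
have e5 : `|dot h m * dot u m| <= nF h * nF u.
  by rewrite normrM ler_pM// dot1.
have e6 := mul_dist e4 (dot1 _ w m'_le1) e5 (dotd w).
have c1p : 0 <= a0 / (a0 + 2) by rewrite divr_ge0 ?addr_ge0 ?(ltW a0_gt0).
have c1 : a0 / (a0 + 2) <= 1 by rewrite ler_pdivrMr ?mul1r ?lerDl// addr_gt0.
have c2p : 0 <= 2 * a0 ^+ 2 / ((a0 + 2) * (a0 + 1)).
  by rewrite divr_ge0 ?mulr_ge0 ?sqr_ge0 ?addr_ge0 ?(ltW a0_gt0).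
have c2 : 2 * a0 ^+ 2 / ((a0 + 2) * (a0 + 1)) <= 2.
  rewrite ler_pdivrMr ?mulr_gt0 ?addr_gt0// ler_wpM2l// expr2.
  by apply: ler_pM; rewrite ?(ltW a0_gt0)// lerDl.
move: c1p c1 c2p c2; set k1 := a0 / (a0 + 2); set k2 := 2 * a0 ^+ 2 / _ => c1p c1 c2p c2.
set X := nF h * nF u * nF w in e0 *.
have X0 : 0 <= X by rewrite !mulr_ge0.
have -> : 13 * f * nF h * nF u * nF w = f * X + 1 * (2 * f * X + 2 * f * X + 2 * f * X) + 2 * (3 * f * X).
  by rewrite /X; ring.
set q' := cubic D' _ _ _; set q := cubic D _ _ _; rewrite -/q -/q' in e0.
have g1 : `|dot u (S' *m h) * dot w m' - dot u (S *m h) * dot w m| <= 2 * f * X.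
  by apply: le_trans e1 _; rewrite le_eqVlt; apply/orP; left; apply/eqP; rewrite /X; ring.
have g2 : `|dot u m' * dot h (S' *m w) - dot u m * dot h (S *m w)| <= 2 * f * X.
  rewrite ![dot u _ * _]mulrC.
  by apply: le_trans e2 _; rewrite le_eqVlt; apply/orP; left; apply/eqP; rewrite /X; ring.
have g3 : `|dot h m' * dot u (S' *m w) - dot h m * dot u (S *m w)| <= 2 * f * X.
  rewrite ![dot h _ * _]mulrC.
  by apply: le_trans e3 _; rewrite le_eqVlt; apply/orP; left; apply/eqP; rewrite /X; ring.
have g4 : `|dot h m' * dot u m' * dot w m' - dot h m * dot u m * dot w m| <= 3 * f * X.
  by apply: le_trans e6 _; rewrite le_eqVlt; apply/orP; left; apply/eqP; rewrite /X; ring.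
move: g1 g2 g3 g4.
set x1 := _ * _ ; set y1 := (X in `|x1 - X|) => g1.
set x2 := (X in `|X - _|); set y2 := (X in `|x2 - X|) => g2.
set x3 := (X in `|X - _|); set y3 := (X in `|x3 - X|) => g3.
set x4 := (X in `|X - _|); set y4 := (X in `|x4 - X|) => g4.
have -> : q' - k1 * (x1 + x2 + x3) + k2 * x4 - (q - k1 * (y1 + y2 + y3) + k2 * y4) =
  (q' - q) + (- k1) * ((x1 - y1) + (x2 - y2) + (x3 - y3)) + k2 * (x4 - y4) by ring.
apply: le_trans (ler_normD _ _) _; apply: lerD.
  apply: le_trans (ler_normD _ _) _; apply: lerD => //.
  rewrite normrM normrN (ger0_norm c1p); apply: ler_pM => //.
  by apply: le_trans (ler_normD _ _) _; apply: lerD => //; apply: le_trans (ler_normD _ _) _; apply: lerD.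
by rewrite normrM (ger0_norm c2p); apply: ler_pM.
Qed.

End MomentForms.

(** * Population moments in canonical form *)

Section Population.
Context {R : realType} {d n : nat}.
Variables (alpha : 'I_n.+1 -> R) (O : 'M[R]_(d, n.+1)).
Hypothesis (alpha0 : forall i, 0 < alpha i).
Let a0 := \sum_i alpha i.
Let a0_gt0 : 0 < a0. Proof. exact: alpha_sum_gt0 alpha0. Qed.
Let p i := alpha i / a0.
Let B := canonical_mx O p a0.

Definition mean_mx : 'cV[R]_d := \col_j pop_mean alpha O j.
Definition second_mx : 'M[R]_d := \matrix_(j, l) pop_second alpha O j l.

Let alpha_sum (F : 'I_n.+1 -> R) := \sum_a alpha a * F a.

Let sum_second (F G : 'I_n.+1 -> R) :
  \sum_a \sum_b second_moment alpha a b * (F a * G b) =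
  (alpha_sum F * alpha_sum G + alpha_sum (fun a => F a * G a)) / (a0 * (a0 + 1)).
Proof.
rewrite /alpha_sum mulr_suml -big_split mulr_suml; apply: eq_bigr => a _ /=.
rewrite mulr_sumr (eq_bigr (fun b => alpha a * F a / (a0 * (a0 + 1)) * (alpha b * G b)
   + alpha a * F a / (a0 * (a0 + 1)) * (G b * (b == a)%:R))).
  by rewrite big_split/= -!mulr_sumr sum_delta; ring.
by move=> b _; rewrite /second_moment -/a0; ring.
Qed.

(** The five terms correspond to the partitions of the three positions, a block of size [b] having
    weight [(b - 1)!]. *)
Let sum_third (F G H : 'I_n.+1 -> R) :
  \sum_i third_moment alpha i.1.1 i.1.2 i.2 * (F i.1.1 * G i.1.2 * H i.2) =
  (alpha_sum F * alpha_sum G * alpha_sum H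
   + alpha_sum (fun a => F a * H a) * alpha_sum G
   + alpha_sum F * alpha_sum (fun a => G a * H a)
   + alpha_sum (fun a => F a * G a) * alpha_sum H
   + 2 * alpha_sum (fun a => F a * G a * H a)) / (a0 * (a0 + 1) * (a0 + 2)).
Proof.
pose D := a0 * (a0 + 1) * (a0 + 2).
rewrite -(pair_bigA _ (fun q c => third_moment alpha q.1 q.2 c * (F q.1 * G q.2 * H c)))/=.
rewrite -(pair_bigA _ (fun a b => \sum_c third_moment alpha a b c * (F a * G b * H c)))/=.
have inner a b : \sum_c third_moment alpha a b c * (F a * G b * H c) =
   alpha a * F a * ((alpha b + (b == a)%:R) * G b) * (alpha_sum H + H a + H b) / D.
  rewrite (eq_bigr (fun c => alpha a * F a * ((alpha b + (b == a)%:R) * G b) / D *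
     (alpha c * H c + H c * (c == a)%:R + H c * (c == b)%:R))).
    by rewrite -mulr_sumr !big_split/= !sum_delta -/(alpha_sum H); ring.
  by move=> c _; rewrite /third_moment -/a0 -/D; ring.
under eq_bigr do under eq_bigr do rewrite inner.
have mid a : \sum_b alpha a * F a * ((alpha b + (b == a)%:R) * G b) * (alpha_sum H + H a + H b) / D =
   alpha a * F a / D * (alpha_sum G * (alpha_sum H + H a) + alpha_sum (fun a => G a * H a)
      + G a * alpha_sum H + 2 * (G a * H a)).
  rewrite (eq_bigr (fun b => alpha a * F a / D *
     (alpha b * G b * (alpha_sum H + H a) + alpha b * (G b * H b)
       + (G b * (alpha_sum H + H a) + G b * H b) * (b == a)%:R))).
    rewrite -mulr_sumr !big_split/= sum_delta -mulr_suml -/(alpha_sum G) -/(alpha_sum _); ring.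
  by move=> b _; ring.
under eq_bigr do rewrite mid.
rewrite (eq_bigr (fun a => (alpha a * F a * (alpha_sum G * alpha_sum H)
   + alpha a * (F a * H a) * alpha_sum G
   + alpha a * F a * alpha_sum (fun a => G a * H a)
   + alpha a * (F a * G a) * alpha_sum H
   + 2 * (alpha a * (F a * G a * H a))) / D)); last by move=> a _; ring.
rewrite -mulr_suml !big_split/= -!mulr_suml -mulr_sumr -!/(alpha_sum _).
by rewrite mulrA.
Qed.

Let Om u : 'cV[R]_n.+1 := O^T *m u.

Lemma dot_mean_mx u : dot u mean_mx = alpha_sum (fun a => Om u a 0) / a0.
Proof.
rewrite /dot /alpha_sum mulr_suml.
under eq_bigr do rewrite mxE mulr_sumr.
rewrite exchange_big; apply: eq_bigr => a _ /=; rewrite mxE mulr_sumr mulr_suml.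
by apply: eq_bigr => j _; rewrite mxE /first_moment -/a0; ring.
Qed.

Lemma dot_second_mx u w : dot u (second_mx *m w) =
  (alpha_sum (fun a => Om u a 0) * alpha_sum (fun a => Om w a 0)
   + alpha_sum (fun a => Om u a 0 * Om w a 0)) / (a0 * (a0 + 1)).
Proof.
have -> : second_mx = O *m (\matrix_(a, b) second_moment alpha a b) *m O^T.
  apply/matrixP => j l; rewrite !mxE /pop_second exchange_big; apply: eq_bigr => b _ /=.
  rewrite !mxE mulr_suml; apply: eq_bigr => a _; rewrite !mxE; ring.
rewrite -!mulmxA -[in LHS](trmxK O) -dot_mulmxl trmxK -/(Om u) -/(Om w) -sum_second; move: (Om u) (Om w) => v1 v2.
apply: eq_bigr => a _; rewrite mxE mulr_sumr; apply: eq_bigr => b _; rewrite mxE; ring.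
Qed.

Lemma cubic_triple_law h u w : cubic (triple_law alpha O) h u w =
  \sum_i third_moment alpha i.1.1 i.1.2 i.2 * (Om u i.1.1 0 * Om w i.1.2 0 * Om h i.2 0).
Proof.
rewrite /cubic /triple_law; under eq_bigr do rewrite mulr_suml.
rewrite exchange_big; apply: eq_bigr => -[[a b] c] _.
rewrite (eq_bigr (fun s => third_moment alpha a b c *
   (emission_prod O s (a, b, c) * (u s.1.1 0 * w s.1.2 0 * h s.2 0)))); last first.
  by move=> s _ /=; ring.
rewrite -mulr_sumr; congr (_ * _).
rewrite -(pair_bigA _ (fun q m => emission_prod O (q, m) (a, b, c) * (u q.1 0 * w q.2 0 * h m 0)))/=.
rewrite -(pair_bigA _ (fun j l => \sum_m emission_prod O (j, l, m) (a, b, c) * (u j 0 * w l 0 * h m 0)))/=.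
rewrite /Om !mxE !mulr_suml; apply: eq_bigr => j _.
rewrite -mulrA mulr_suml mulr_sumr; apply: eq_bigr => l _.
by rewrite !mulr_sumr; apply: eq_bigr => m _; rewrite !mxE /emission_prod/=; ring.
Qed.

Lemma canonical_dot u l : (B^T *m u) l 0 = Num.sqrt (p l / (a0 + 1)) * Om u l 0.
Proof.
rewrite /B /canonical_mx trmx_mul tr_diag_mx -mulmxA mul_diag_mx !mxE//.
Qed.

Let p_gt0 l : 0 < p l. Proof. exact: divr_gt0. Qed.

(** The corrections cancel every term of [sum_third] except that of the single block, which is
    diagonal in the topics. *)
Lemma triples_form_population h u w :
  triples_form a0 (triple_law alpha O) second_mx mean_mx h u w =
  \sum_l tensor_weight p a0 l * (B^T *m h) l 0 * (B^T *m u) l 0 * (B^T *m w) l 0.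
Proof.
transitivity (2 * alpha_sum (fun a => Om u a 0 * Om w a 0 * Om h a 0) / (a0 * (a0 + 1) * (a0 + 2))).
  rewrite /triples_form cubic_triple_law (sum_third (Om u ^~ 0) (Om w ^~ 0) (Om h ^~ 0)).
  rewrite ![dot mean_mx _]dotC !dot_second_mx !dot_mean_mx.
  rewrite (_ : alpha_sum (fun a => Om h a 0 * Om w a 0) = alpha_sum (fun a => Om w a 0 * Om h a 0)); last first.
    by apply: eq_bigr => a _; rewrite [Om h _ _ * _]mulrC.
  by field; rewrite !gt_eqF// addr_gt0.
rewrite /alpha_sum mulr_sumr mulr_suml; apply: eq_bigr => l _; rewrite !canonical_dot /tensor_weight.
have pl := p_gt0 l; have sq : Num.sqrt (p l / (a0 + 1)) = Num.sqrt (p l) / Num.sqrt (a0 + 1).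
  by rewrite sqrtrM ?(ltW pl)// sqrtrV// ltW// addr_gt0.
have s0 : 0 < Num.sqrt (p l) by rewrite sqrtr_gt0.
have t0 : 0 < Num.sqrt (a0 + 1) by rewrite sqrtr_gt0 addr_gt0.
have t2 : Num.sqrt (a0 + 1) ^+ 2 = a0 + 1 by rewrite sqr_sqrtr// ltW// addr_gt0.
have s2 : alpha l = Num.sqrt (p l) ^+ 2 * a0 by rewrite sqr_sqrtr ?(ltW pl)// divfK ?gt_eqF.
rewrite sq {1}s2 -{1}t2; set t := Num.sqrt (a0 + 1); set s := Num.sqrt (p l).
by field; rewrite !gt_eqF// addr_gt0.
Qed.

(** The bilinear forms are compared: the correction removes the product of the two sums from
    [dot_second_mx]. Entries are read off at basis vectors. *)
Lemma pairs_form_population : pairs_form a0 second_mx mean_mx = B *m B^T.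
Proof.
have form u w : dot u (pairs_form a0 second_mx mean_mx *m w) = dot u (B *m B^T *m w).
  rewrite -mulmxA -[in RHS](trmxK B) -dot_mulmxl !trmxK.
  rewrite mulmxBl -scalemxAl -mulmxA dotDr dotNr dotZr dot_mx mul_mx_scalar dotZr.
  rewrite dot_second_mx [dot mean_mx _]dotC !dot_mean_mx.
  transitivity (alpha_sum (fun a => Om u a 0 * Om w a 0) / (a0 * (a0 + 1))).
    by field; rewrite !gt_eqF// addr_gt0.
  rewrite /dot /alpha_sum mulr_suml; apply: eq_bigr => l _; rewrite !canonical_dot mulrACA -expr2 sqr_sqrtr.
    by rewrite /p; field; rewrite !gt_eqF// addr_gt0.
  by rewrite divr_ge0 ?(ltW (p_gt0 l))// addr_ge0// ltW.
apply/matrixP => i j; have := form (delta_mx i 0) (delta_mx j 0).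
by rewrite -!colE !dot_mxE trmx_delta -!rowE !mxE.
Qed.

End Population.

(** * Empirical moments as functions of the frequencies *)

Section EmpiricalMoments.
Context {R : realType} {d N : nat}.
Variable x : 'I_N -> 'I_3 -> 'I_d.
Let y : 'I_N -> 'I_3 -> 'cV[R]_d := onehot x.
Let g i := (x i (inord 0), x i (inord 1), x i (inord 2)).

Definition freq (J : eqType) (phi : 'I_d * 'I_d * 'I_d -> J) (j : J) : R :=
  N%:R^-1 * (\sum_i (phi (g i) == j)%:R).

Lemma freq_ge0 (J : eqType) (phi : 'I_d * 'I_d * 'I_d -> J) j : 0 <= freq phi j.
Proof. by rewrite mulr_ge0// ?invr_ge0// sumr_ge0. Qed.

Lemma freq_sum (J : finType) (phi : 'I_d * 'I_d * 'I_d -> J) : (0 < N)%N ->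
  \sum_j freq phi j = 1.
Proof.
move=> N0; rewrite -mulr_sumr exchange_big/=.
rewrite (eq_bigr (fun=> 1)) => [|i _].
  by rewrite sumr_const card_ord mulVf// pnatr_eq0 -lt0n.
rewrite (bigD1 (phi (g i)))//= eqxx big1 ?addr0// => j; by rewrite eq_sym => /negPf ->.
Qed.

Lemma emp_meanE j : emp_mean y j 0 = freq (fun s => s.1.1) j.
Proof.
rewrite !mxE summxE; congr (_ * _); apply: eq_bigr => i _.
by rewrite !mxE andbT eq_sym.
Qed.

Let outer i j l : (y i (inord 0) *m (y i (inord 1))^T) j l = ((g i).1 == (j, l))%:R.
Proof.
rewrite !mxE big_ord1 !mxE !andbT xpair_eqE -natrM mulnb.
by rewrite [j == _]eq_sym [l == _]eq_sym.
Qed.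

Lemma emp_secondE j l : emp_second y j l = freq (fun s => s.1) (j, l).
Proof. by rewrite !mxE summxE; congr (_ * _); apply: eq_bigr => i _; exact: outer. Qed.

Lemma dot_emp_third h u w : dot u (emp_third y h *m w) = cubic (freq id) h u w.
Proof.
rewrite dot_mxE mulmxA /emp_third -scalemxAr -scalemxAl mxE mulmx_sumr mulmx_suml summxE.
rewrite /cubic (eq_bigr (fun s => N%:R^-1 * \sum_i (g i == s)%:R * (u s.1.1 0 * w s.1.2 0 * h s.2 0))); last first.
  by move=> s _; rewrite -mulr_suml (mulrA N%:R^-1).
rewrite -mulr_sumr exchange_big; congr (_ * _); apply: eq_bigr => i _ /=.
rewrite (bigD1 (g i))//= eqxx mul1r [X in _ = _ + X]big1 ?addr0; last first.
  by move=> s; rewrite eq_sym => /negPf ->; rewrite mul0r.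
rewrite -scalemxAr -scalemxAl mxE mulmxA /y /onehot -colE.
have -> : dotv h (delta_mx (x i (inord 2)) 0) = h (x i (inord 2)) 0.
  by rewrite [LHS](dot_mxE h) -colE !mxE.
rewrite -mulmxA trmx_delta -rowE mxE big_ord1 !mxE; ring.
Qed.

Lemma triples_hatE a0 h u w : dot u (triples_hat a0 y h *m w) =
  triples_form a0 (freq id) (emp_second y) (emp_mean y) h u w.
Proof.
rewrite /triples_hat /triples_form -dot_emp_third.
move: (emp_third y h) (emp_second y) (emp_mean y) => E3 E2 m.
rewrite mulmxDl mulmxBl -!scalemxAl !mulmxDl -!scalemxAl.
rewrite -(mulmxA (E2 *m h)) -!(mulmxA m) -(mulmxA h^T) !dot_mx !mul_mx_scalar.
rewrite !dotDr dotNr !dotZr !dotDr !dotZr (_ : dotv h _ = dot h m)//; ring.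
Qed.

End EmpiricalMoments.

Section Deviation.
Context {R : realType} {d n N : nat}.
Variables (alpha : 'I_n.+1 -> R) (O : 'M[R]_(d, n.+1)) (x : 'I_N -> 'I_3 -> 'I_d) (f : R).
Hypotheses (alpha0 : forall i, 0 < alpha i) (O_em : emission_matrix O) (N0 : (0 < N)%N).
Let y : 'I_N -> 'I_3 -> 'cV[R]_d := onehot x.
Let q := triple_law alpha O.
Let a0 := \sum_i alpha i.
Let B := canonical_mx O (fun i => alpha i / a0) a0.

Definition freq_dist (J : finType) (phi : 'I_d * 'I_d * 'I_d -> J) : R :=
  l2 (fun j => freq x phi j - \sum_(s | phi s == j) q s).

Hypotheses (f1 : freq_dist (fun s => s.1.1) <= f) (f2 : freq_dist (fun s => s.1) <= f)
  (f3 : freq_dist id <= f).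

Let pop_sum (J : finType) (phi : 'I_d * 'I_d * 'I_d -> J) :
  \sum_j \sum_(s | phi s == j) q s = 1.
Proof.
by rewrite -(triple_law_sum alpha0 O_em) [RHS](partition_big phi xpredT).
Qed.

Let pop_ge0 (J : finType) (phi : 'I_d * 'I_d * 'I_d -> J) j :
  0 <= \sum_(s | phi s == j) q s.
Proof. by apply: sumr_ge0 => s _; exact: triple_law_ge0. Qed.

Let mean_distE : nF (emp_mean y - mean_mx alpha O) = freq_dist (fun s => s.1.1).
Proof.
rewrite nF_cVl2; apply: eq_l2 => j; rewrite mxE [X in _ + X]mxE [mean_mx _ _ _ _]mxE emp_meanE.
by rewrite sum_by_first.
Qed.

Let second_distE : nF (emp_second y - second_mx alpha O) = freq_dist (fun s => s.1).
Proof.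
apply: eq_l2 => -[j l]; rewrite mxE [X in _ + X]mxE [second_mx _ _ _ _]mxE emp_secondE.
by rewrite sum_by_second.
Qed.

Let mean_le1 : nF (mean_mx alpha O) <= 1.
Proof.
rewrite nF_cVl2; apply: le_trans (l2_prob_le1 (pop_ge0 (fun s => s.1.1)) (pop_sum _)).
by rewrite le_eqVlt; apply/orP; left; apply/eqP; apply: eq_l2 => j; rewrite mxE sum_by_first.
Qed.

Let second_le1 : nF (second_mx alpha O) <= 1.
Proof.
apply: le_trans (l2_prob_le1 (pop_ge0 (fun s => s.1)) (pop_sum _)).
by rewrite le_eqVlt; apply/orP; left; apply/eqP; apply: eq_l2 => -[j l]; rewrite mxE sum_by_second.
Qed.

Let emp_mean_le1 : nF (emp_mean y) <= 1.
Proof.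
rewrite nF_cVl2; apply: le_trans (l2_prob_le1 (freq_ge0 x (fun s => s.1.1)) (freq_sum x _ N0)).
by rewrite le_eqVlt; apply/orP; left; apply/eqP; apply: eq_l2 => j; rewrite emp_meanE.
Qed.

Let third_dist : l2 (fun s => freq x id s - q s) <= f.
Proof.
apply: le_trans f3; rewrite le_eqVlt; apply/orP; left; apply/eqP; apply: eq_l2 => s.
by rewrite big_pred1_eq.
Qed.

Lemma pairs_hat_dist : nF (pairs_hat a0 y - B *m B^T) <= 3 * f.
Proof.
rewrite -(pairs_form_population O alpha0).
apply: pairs_form_dist; rewrite ?mean_distE ?second_distE//.
exact: alpha_sum_gt0 alpha0.
Qed.

Lemma triples_hat_dist h u w :
  `|dot u (triples_hat a0 y h *m w) -
    \sum_l tensor_weight (fun i => alpha i / a0) a0 l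
      * (B^T *m h) l 0 * (B^T *m u) l 0 * (B^T *m w) l 0| <= 13 * f * nF h * nF u * nF w.
Proof.
rewrite triples_hatE -(triples_form_population O alpha0).
apply: triples_form_dist; rewrite ?mean_distE ?second_distE//.
exact: alpha_sum_gt0 alpha0.
Qed.

End Deviation.

(** * Sample size and conclusion *)

(** The hypothesis amounts to [sqrt N pm sk^2 / A >= 6 + 6 L], and three quarters of the right-hand
    side are at least [3 + 9/2 L]. *)
Lemma sample_size (R : realType) (N : nat) (A pm sk L : R) :
  1 <= A -> 0 < pm -> 0 < sk -> 0 <= L ->
  (A * (6 + 6 * L) / (pm * sk ^+ 2)) ^+ 2 <= N%:R ->
  (0 < N)%N /\ 3 * ((1 + 3 / 2 * L) / Num.sqrt N%:R) <= 3 / 4 * (pm * sk ^+ 2 / A).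
Proof.
move=> A1 pm0 sk0 L0; have A0 : 0 < A by exact: lt_le_trans A1.
set D := A * _ / _ => DN.
have S0 : 0 < pm * sk ^+ 2 by rewrite mulr_gt0// exprn_gt0.
have D0 : 0 < D by rewrite divr_gt0// mulr_gt0// ltr_pwDl// mulr_ge0.
have N0 : 0 < N%:R :> R by apply: lt_le_trans DN; rewrite exprn_gt0.
split; first by rewrite -(ltr0n R).
have sN : 0 < Num.sqrt N%:R :> R by rewrite sqrtr_gt0.
have Ds : D <= Num.sqrt N%:R.
  by rewrite -(@ler_pXn2r _ 2)// ?nnegrE ?(ltW D0) ?(ltW sN)// sqr_sqrtr// ltW.
rewrite mulrA ler_pdivrMr//.
have e : pm * sk ^+ 2 / A * D = 6 + 6 * L by rewrite /D; field; rewrite !gt_eqF.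
have := ler_wpM2l (ltW (divr_gt0 S0 A0)) Ds; rewrite e -mulrA; lra.
Qed.

(** From [ln 3 <= 2], with [l^2 = ln (1 / delta)]: [ln (3 / delta) <= 2 + l^2 <= (3/2 + l)^2], and
    [1 + 3/2 (3/2 + l) <= 4 (1 + l)]. *)
Lemma deviation_rate (R : realType) (delta t : R) : 0 < delta -> delta < 1 -> 0 <= t ->
  (1 + 3 / 2 * Num.sqrt (ln (3 / delta))) / t <= 4 * ((1 + Num.sqrt (ln (1 / delta))) / t).
Proof.
move=> d0 d1 t0; rewrite mulrA ler_wpM2r ?invr_ge0//.
set l := Num.sqrt (ln (1 / delta)).
have l0 : 0 <= l by exact: sqrtr_ge0.
have l2 : l ^+ 2 = ln (1 / delta).
  by rewrite sqr_sqrtr// ln_ge0// ler_pdivlMr// mul1r ltW.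
have ln3 : ln 3 <= 2 :> R.
  by have := @le_ln1Dx R 2; rewrite (_ : 1 + 2 = 3 :> R); [apply; lra|ring].
suff : Num.sqrt (ln (3 / delta)) <= 3 / 2 + l by lra.
have h0 : 0 <= 3 / 2 + l by lra.
rewrite -(ger0_norm h0) -sqrtr_sqr ler_wsqrtr//.
rewrite (_ : 3 / delta = 3 * (1 / delta)); last by rewrite mul1r.
rewrite lnM ?posrE ?divr_gt0// -l2 sqrrD; lra.
Qed.

Theorem theorem5p1 (R : realType) :
  exists c : R,
  forall (d k : nat) (k_gt0 : (0 < k)%N) (lekd : (k <= d)%N)
    (alpha : 'I_k -> R) (O : 'M[R]_(d, k))
    (alpha_gt0 : forall i, 0 < alpha i) (O_emission : emission_matrix O)
    (N : nat) (dd : measure_display) (Omega : measurableType dd)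
    (P : probability Omega R)
    (h : 'I_N -> Omega -> k.-tuple R)
    (z : 'I_N -> 'I_3 -> Omega -> 'I_k)
    (x : 'I_N -> 'I_3 -> Omega -> 'I_d)
    (x_lda : forall n, lda_draw P alpha O (h n) (z n) (x n))
    (x_indep : independent_triples P x)
    (Q : probability (k.-tuple R) R) (Q_unif : uniform_sphere Q)
    (delta : R) (delta_gt0 : 0 < delta) (delta_lt1 : delta < 1),
  let a0 := \sum_i alpha i in
  (* the ratios are at most 1, so that the default value 1 is harmless *)
  let p_min := \big[Num.min/1]_i (alpha i / a0) in
  let sk := sigma_min O in
  ((a0 + 1) * (6 + 6 * Num.sqrt (ln (3 / delta))) / (p_min * sk ^+ 2)) ^+ 2
    <= N%:R ->
  with_prob_gt P (1 - delta) [set w |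
    let y := onehot (fun n v => x n v w) in
    let T := triples_hat a0 y in
    forall U s V, is_svd (pairs_hat a0 y) U s V ->
    (forall i : 'I_k, 0 < s 0 (widen_ord lekd i)) /\
    let W := whitening lekd U s in
    with_prob_gt Q (3 / 4) [set theta |
      forall U' s' V',
      is_svd (W^T *m T (W *m col_of_tuple theta) *m W) U' s' V' ->
      exists sigma : 'S_k, forall i : 'I_k,
        norm2 (col i O - O_hat a0 T W (col (sigma i) U')) <=
        c * ((a0 + 1) ^+ 2 * k%:R ^+ 3 / (p_min ^+ 2 * sk ^+ 3))
          * ((1 + Num.sqrt (ln (1 / delta))) / Num.sqrt N%:R)]].
Proof.
(* The two moments deviate by at most [3 f] and [13 f], and [f] is at most 4 times the rate [eps];
   hence 12 and 52. *)
exists (rate_const 12 52) => d [//|n] k_gt0 lekd alpha O alpha_gt0 O_em N dd Omega P h z x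
  x_lda x_indep Q Q_unif delta delta_gt0 delta_lt1 a0 p_min sk.
have a0_gt0 : 0 < a0 := alpha_sum_gt0 alpha_gt0.
have pm_gt0 : 0 < p_min by apply: lt_bigmin => // i _; rewrite divr_gt0.
have pm_le i : p_min <= alpha i / a0 by exact: bigmin_le.
have p_le1 i : alpha i / a0 <= 1.
  rewrite ler_pdivrMr// mul1r /a0 (bigD1 i)//= lerDl sumr_ge0// => j _; exact: ltW.
have sum_p : \sum_i alpha i / a0 = 1 by rewrite -mulr_suml divff// gt_eqF.
have O1 i : nF (col i O) <= 1 by exact: emission_col_le1.
have [_ _ rO] := O_em.
have sk_gt0 : 0 < sk by exact: sigma_min_gt0.
have sk_le1 : sk <= 1 by exact: sigma_min_le1.
have skP : forall y : 'cV_n.+1, sk * nF y <= nF (O *m y) by exact: sigma_minP.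
have A1 : 1 <= a0 + 1 by rewrite lerDr ltW.
move=> /(sample_size A1 pm_gt0 sk_gt0 (sqrtr_ge0 _))[N_gt0 e_sP].
have sN : 0 < Num.sqrt N%:R :> R by rewrite sqrtr_gt0 ltr0n.
have eps_gt0 : 0 < (1 + Num.sqrt (ln (1 / delta))) / Num.sqrt N%:R.
  by rewrite divr_gt0// ltr_pwDl// sqrtr_ge0.
have := deviation_rate delta_gt0 delta_lt1 (ltW sN).
set f := (1 + _) / _ in e_sP *; set eps := (1 + _) / _ in eps_gt0 * => f_eps.
have f_gt0 : 0 < f by rewrite divr_gt0// ltr_pwDl// mulr_ge0// ?divr_ge0// sqrtr_ge0.
have [E [mE PE good]] := good_event alpha_gt0 O_em x_lda x_indep N_gt0 delta_gt0 delta_lt1.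
exists E; split => //; first by rewrite (prE P mE) lte_fin.
move=> w /good; rewrite -/f => -[f1 f2 f3] y T U s V [UU VV s_ge0 s_sort PhE].
have dev (J : finType) (phi : 'I_d * 'I_d * 'I_d -> J) : deviation alpha O phi (sample_ffun x w) <= f ->
    freq_dist alpha O (fun i v => x i v w) phi <= f.
  apply: le_trans; rewrite le_eqVlt; apply/orP; left; apply/eqP; apply: eq_l2 => j.
  by congr (_ * _ - _); apply: eq_bigr => i _; rewrite ffunE.
have {f1 f2 f3} [f1 f2 f3] := And3 (dev _ _ f1) (dev _ _ f2) (dev _ _ f3).
have Ph_e := pairs_hat_dist alpha_gt0 O_em N_gt0 f1 f2.
have TP := triples_hat_dist alpha_gt0 O_em N_gt0 f1 f2 f3.
have s_gt0 i : 0 < s 0 (widen_ord lekd i).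
  apply: lt_le_trans (singular_values_ge lekd a0_gt0 pm_gt0 pm_le sk_gt0 skP UU VV s_ge0 s_sort PhE Ph_e e_sP i).
  by rewrite divr_gt0// divr_gt0 ?mulr_gt0 ?exprn_gt0 ?addr_gt0.
split=> [//|W].
pose gap (a : 'I_n.+1 * 'I_n.+1 * bool) :=
  gap_vector lekd O (fun i => alpha i / a0) a0 U s a.1.1 a.1.2 a.2.
have t0 : 0 <= gap_radius n.+1 :> R by rewrite invr_ge0 mulr_ge0.
have [F [mF QF gapF]] := pr_all_gaps Q_unif gap t0.
exists F; split=> //.
  rewrite (prE Q mF) lte_fin; apply: lt_le_trans QF.
  (* With [K = n + 1] the loss is [2 K^2] times [2 K / (20 K^3)], that is [1/5], and [4/5 > 3/4]. *)
  rewrite !card_prod !card_ord card_bool /gap_radius !natrM.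
  rewrite (_ : _ - _ = 1 - 5^-1); first by lra.
  have : n.+1%:R != 0 :> R by rewrite pnatr_eq0.
  by move: (n.+1%:R : R) => K K0; field.
move=> theta /gapF[theta1 theta_gap] U' s' V' [UU' VV' s'_ge0 _ X'E].
have eC : 3 * f <= 12 * eps by lra.
have eTC : 13 * f <= 52 * eps by lra.
have eT_gt0 : 0 < 13 * f by rewrite mulr_gt0.
have th1 : nF (col_of_tuple theta) = 1 by rewrite nF_cV.
have [sg sgP] := eca_recovery k_gt0 a0_gt0 pm_gt0 pm_le p_le1 sum_p O1 sk_gt0 sk_le1 skP
  UU VV s_ge0 s_sort PhE Ph_e e_sP eps_gt0 eC eT_gt0 eTC TP th1
  (fun i j b => theta_gap (i, j, b)) UU' VV' s'_ge0 X'E.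
exists sg => i.
have -> : norm2 (col i O - O_hat a0 T W (col (sg i) U')) = nF (col i O - O_hat a0 T W (col (sg i) U')).
  by rewrite nF_cV.
(* Inverting [Z_hat] turns the quotient into a multiple of the cubic form, an identity that also
   holds where the form vanishes. *)
rewrite /O_hat /Z_hat invf_div (mulrAC (a0 + 2)).
apply: le_trans (sgP i) _; rewrite le_eqVlt; apply/orP; left; apply/eqP.
by rewrite -[RHS]mulrA [X in _ = _ * X]mulrAC.
Qed.
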